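(* Let $X$ be a complex Banach space and let $T\in B(X)$ be a power $\gamma$-bounded operator. Then the set $$\{P(T):\ P\text{ is a polynomial with }\|P\|_{\mathcal{A}}\le1\}$$ is $\gamma$-bounded.
   Context: Let $(\gamma_k)_{k\ge1}$ be independent complex standard Gaussian variables on a probability space $\Sigma$, and $\|\sum_k\gamma_k\otimes x_k\|_{G(X)}=\big(\int_\Sigma\|\sum_k\gamma_k(\lambda)x_k\|^2d\lambda\big)^{1/2}$ for finitely many $x_k\in X$. A set $\mathcal{T}\subset B(X)$ is $\gamma$-bounded if there is $C\ge0$ with $\|\sum_{n=1}^N\gamma_n\otimes T_nx_n\|_{G(X)}\le C\|\sum_{n=1}^N\gamma_n\otimes x_n\|_{G(X)}$ for all $N$, $T_1,\dots,T_N\in\mathcal{T}$, $x_1,\dots,x_N\in X$. $T$ is power $\gamma$-bounded if $\{T^n:n\ge1\}$ is $\gamma$-bounded. $\mathbb{D}$ is the open unit disc, $\mathbb{T}$ the unit circle, $H^1$ the Hardy space over $\mathbb{D}$ with norm $\|\cdot\|_1$ (normalized Lebesgue measure on $\mathbb{T}$), and $C(\mathbb{T})$ has the sup norm $\|\cdot\|_\infty$. For $f\in C(\mathbb{T})$, $h\in H^1$ and $z\in\overline{\mathbb{D}}$, $f\star h(z)=\frac{1}{2\pi}\int_0^{2\pi}f(e^{is})h(e^{-is}z)\,ds$ (using boundary values of $h$ when $|z|=1$). $\mathcal{A}(\mathbb{D})$ is the set of functions $F:\overline{\mathbb{D}}\to\mathbb{C}$ for which there exist sequences $(f_k)_{k\ge1}$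 in $C(\mathbb{T})$ and $(h_k)_{k\ge1}$ in $H^1$ with $\sum_k\|f_k\|_\infty\|h_k\|_1<\infty$ and $F(z)=\sum_{k\ge1}f_k\star h_k(z)$ for all $z\in\overline{\mathbb{D}}$; $\|F\|_{\mathcal{A}}$ is the infimum of $\sum_k\|f_k\|_\infty\|h_k\|_1$ over all such representations. *)

(* Defs.v *)
From HB Require Import structures.
From mathcomp Require Import all_boot all_order all_algebra.
From mathcomp Require Import complex.
From mathcomp Require Import all_classical all_reals all_analysis.

Set Implicit Arguments.
Unset Strict Implicit.
Unset Printing Implicit Defensive.

Import Order.TTheory GRing.Theory Num.Theory.
Import numFieldNormedType.Exports.

Local Open Scope classical_set_scope.
Local Open Scope complex_scope.
Local Open Scope ring_scope.

(* [`|x|] is a nonnegative element of [R[i]]; [rnorm x] is the corresponding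
   real number. *)
Definition rnorm (R : realType) (V : normedModType R[i]) (x : V) : R :=
  complex.Re `|x|.

Definition cmod (R : realType) (z : R[i]) : R := complex.Re `|z|.

Section Gaussian.
Context (d : measure_display) (Sigma : measurableType d) (R : realType).
Variables (P : probability Sigma R) (gamma : nat -> Sigma -> R[i]).

Definition re_im (k : nat) (w : Sigma) : R * R :=
  (complex.Re (gamma k w), complex.Im (gamma k w)).

(* Normalized by E|gamma_k|^2 = 1: real and imaginary parts are independent
   centred normal variables of variance 1/2 ([normal_prob] takes the standard
   deviation). *)
Definition standard_complex_gaussian (k : nat) : Prop :=
  measurable_fun [set: Sigma] (re_im k) /\
  forall A : set (R * R), measurable A ->
    P (re_im k @^-1` A) =
    (normal_prob 0 (Num.sqrt 2)^-1 \x normal_prob 0 (Num.sqrt 2)^-1)%E A.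

Definition mutually_independent : Prop :=
  forall (J : seq nat) (A : nat -> set (R * R)), uniq J ->
    (forall k, measurable (A k)) ->
    P (\bigcap_(k in [set` J]) (re_im k @^-1` A k)) =
    (\prod_(k <- J) P (re_im k @^-1` A k))%E.

Definition iid_complex_gaussian : Prop :=
  (forall k, standard_complex_gaussian k) /\ mutually_independent.

Variable X : normedModType R[i].

Definition Gnorm (N : nat) (x : 'I_N -> X) : \bar R :=
  ((\int[P]_w ((rnorm (\sum_(n < N) gamma n w *: x n)) ^+ 2)%:E) `^ 2^-1)%E.

Definition gamma_bounded (S : set (X -> X)) : Prop :=
  exists2 C : R, 0 <= C &
    forall (N : nat) (T : 'I_N -> X -> X) (x : 'I_N -> X),
      (forall n, S (T n)) ->
      (Gnorm (fun n => T n (x n)) <= C%:E * Gnorm x)%E.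

Definition power_gamma_bounded (T : X -> X) : Prop :=
  gamma_bounded [set S | exists2 n : nat, (1 <= n)%N & S = iter n T].

End Gaussian.

Definition poly_op (R : realType) (X : normedModType R[i]) (p : {poly R[i]})
    (T : X -> X) : X -> X :=
  fun x => \sum_(i < size p) p`_i *: iter i T x.

Section DiscAlgebra.
Context (R : realType).
Local Notation C := (R[i]^o).
Local Notation mu := (@lebesgue_measure R).

Definition unit_disc : set C := [set z | cmod z < 1].
Definition unit_circle : set C := [set z | cmod z = 1].
Definition closed_unit_disc : set C := [set z | cmod z <= 1].

Definition expi (t : R) : C := cos t +i* sin t.

Definition cintegral (a b : R) (g : R -> C) : C :=
  (\int[mu]_(t in `[a, b]) complex.Re (g t)) +i*
  (\int[mu]_(t in `[a, b]) complex.Im (g t)).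

Definition CT (f : C -> C) : Prop := {within unit_circle, continuous f}.

Definition sup_norm (f : C -> C) : \bar R :=
  ereal_sup [set (cmod (f z))%:E | z in unit_circle].

Definition holomorphic_disc (h : C -> C) : Prop :=
  forall z, unit_disc z -> derivable h z 1.

Definition H1_norm (h : C -> C) : \bar R :=
  ereal_sup [set (((2 * pi)^-1)%:E *
     \int[mu]_(t in `[0%R, (2 * pi)%R]) (cmod (h (r%:C * expi t)))%:E)%E
     | r in [set r : R | 0 <= r < 1]].

Definition H1 (h : C -> C) : Prop :=
  holomorphic_disc h /\ (H1_norm h < +oo)%E.

(* On the circle, radial limits (which exist almost everywhere for [H1 h]). *)
Definition boundary_ext (h : C -> C) (z : C) : C :=
  if cmod z < 1 then h z else lim (h (r%:C * z) @[r --> (1 : R)^'-]).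

Definition star (f h : C -> C) (z : C) : C :=
  ((2 * pi)^-1)%:C *
  cintegral 0 (2 * pi) (fun s => f (expi s) * boundary_ext h (expi (- s) * z)).

Definition A_cost (f h : nat -> C -> C) : \bar R :=
  (\sum_(0 <= k <oo) (sup_norm (f k) * H1_norm (h k)))%E.

Definition A_repr (F : C -> C) (f h : nat -> C -> C) : Prop :=
  [/\ forall k, CT (f k), forall k, H1 (h k), (A_cost f h < +oo)%E &
      forall z, closed_unit_disc z ->
        series (fun k => star (f k) (h k) z) @ \oo --> F z].

(* Equal to [+oo] when [F] does not belong to A(D). *)
Definition A_norm (F : C -> C) : \bar R :=
  ereal_inf [set c | exists f h, A_repr F f h /\ c = A_cost f h].

End DiscAlgebra.

(* Main.v *)
(* If the coefficients of [p] are sums of products [al i * Phi i j * be j] sitting at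
   the powers [e1 i + e2 j], with [al] and [be] square summable and [Phi] a
   contraction, then [p(T)] is the composition of a row, a diagonal of powers of [T],
   [Phi], a diagonal of powers of [T] and a column. Scalar matrices act on Gaussian
   sums with their operator norm, since Gaussian vectors are unitarily invariant, and
   the diagonals are controlled by power gamma-boundedness; hence such [p(T)] form a
   gamma-bounded set.

   Every [p] with [A_norm p <= 1] is a sum of two such polynomials. Up to small
   coefficients, [p] is a finite sum of terms [f * h] with [h] analytic on a
   neighbourhood of the closed disc, and [h = U V] approximately, where [|U|^2] and
   [|V|^2] are of the order of [|h|] on the circle. The coefficients of [f * (U V)] are
   then sums of [fhat (a + b) * U_a * V_b], and the Hankel matrix [fhat (a + b)] has
   norm at most the supremum of [|f|]. A polynomial with small absolute sum of
   coefficients is handled by a diagonal [Phi]. *)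
Require Import Defs.
From HB Require Import structures.
From mathcomp Require Import all_boot all_order all_algebra.
From mathcomp Require Import complex.
From mathcomp Require Import all_classical all_reals all_analysis.
From mathcomp Require Import measurable_realfun zify ring lra.
Import Order.TTheory GRing.Theory Num.Theory.
Import numFieldNormedType.Exports.
Local Open Scope classical_set_scope.
Local Open Scope complex_scope.
Local Open Scope ring_scope.
Set Implicit Arguments.
Unset Strict Implicit.
Unset Printing Implicit Defensive.

(** * Rotation invariance of the planar Gaussian measure *)

(** No limit of operators is ever taken: [p] is split exactly, and every approximation error is
    moved into the second summand. The obstacle is that this error must have absolutely summable
    coefficients with a bound independent of the degree, whereas an error [eta] on the circle only
    bounds each coefficient by [eta]. Dilating the first summand by [r < 1] cures this: the sum
    becomes at most [eta / (1 - r)], and the dilation itself costs little once [1 - r] is small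
    compared with [p]. So [r] depends on [p], then [eta] on [r], then the number of terms and their
    accuracy on [eta], while the final bounds depend on none of them. The splitting of [h] needs no
    division by its zeros: only an approximate outer function [exp Q] is built, with [Re Q] near
    half of [ln |h|], and the zeros stay in the other factor [h exp (- Q)]. The constant
    [3 * expR 1] arises from a representation of cost below [2], errors of total at most [1], and
    the factor [expR 1] lost in the splitting; [1 + 3 * expR 1] has a square above both this and
    [1]. *)

Lemma product_measure_pushforward d d1 d2 (T : measurableType d)
    (T1 : measurableType d1) (T2 : measurableType d2) (R : realType)
    (m : {measure set T -> \bar R})
    (m1 : {sigma_finite_measure set T1 -> \bar R})
    (m2 : {sigma_finite_measure set T2 -> \bar R}) (f : T -> T1 * T2) :
  measurable_fun setT f ->
  (forall A B, measurable A -> measurable B ->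
    m (f @^-1` (A `*` B)) = m1 A * m2 B)%E ->
  forall X, measurable X -> m (f @^-1` X) = (m1 \x m2)%E X.
Proof.
move=> mf mE X mX; apply/esym.
exact: (@product_measure_unique _ _ _ _ _ m1 m2
  (measure_function_pushforward__canonical__measure_function_Measure m mf)).
Qed.

Section PlaneMeasure.
Context (R : realType).
Local Notation mu := (@lebesgue_measure R).
Local Notation RR := (measurableTypeR R).

Lemma lebesgue_measure_translation (a : R) (A : set RR) : measurable A ->
  mu ((fun x : RR => x + a) @^-1` A) = mu A.
Proof.
move=> mA; have mf : measurable_fun setT (fun x : RR => x + a : RR).
  by apply: measurable_funD.
suff : mu A = pushforward mu (fun x : RR => x + a : RR) A by move=> ->.
apply: lebesgue_measure_unique => //= _ [[x y]] _ <-.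
rewrite /pushforward (_ : _ @^-1` _ = `]x - a, y - a]%classic); last first.
  by apply/seteqP; split=> z /=; rewrite !in_itv/=; lra.
rewrite !lebesgue_measure_itv /= !lte_fin ltrD2r.
by case: ifP => // _; rewrite -!EFinB; congr (_%:E); lra.
Qed.

Definition shear (t : R) (z : RR * RR) : RR * RR := (z.1, z.2 + t * z.1).

Lemma measurable_shear (t : R) : measurable_fun setT (shear t).
Proof.
apply/measurable_fun_pairP; split => /=; first exact: measurable_fst.
by apply: measurable_funD => //; exact: measurable_funM.
Qed.

(** By uniqueness of the product measure only rectangles matter, and over each first coordinate [x]
    the section of the preimage is a translate by [t * x]. *)
Lemma lebesgue2_shear (t : R) (A : set (RR * RR)) : measurable A ->
  (mu \x mu)%E (shear t @^-1` A) = (mu \x mu)%E A.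
Proof.
move: A; apply: product_measure_pushforward; first exact: measurable_shear.
move=> B D mB mD; rewrite -product_measure1E//; apply: eq_integral => x _ /=.
have [xB|xB] := pselect (B x); last first.
  by congr (mu _); apply/seteqP; split => y; rewrite /xsection /= !inE => -[].
transitivity (mu ((fun y : RR => y + t * x) @^-1` D)).
  by congr (mu _); apply/seteqP; split => y; rewrite /xsection /= inE => // -[].
rewrite lebesgue_measure_translation//; congr (mu _).
by apply/seteqP; split => y; rewrite /xsection /= inE => // -[].
Qed.

Lemma lebesgue2_swap (A : set (RR * RR)) : measurable A ->
  (mu \x mu)%E (@unstable.swap RR RR @^-1` A) = (mu \x mu)%E A.
Proof.
move: A; apply: product_measure_pushforward; first exact: measurable_swap.
move=> B D mB mD; rewrite [in RHS]muleC -product_measure1E//; congr (_ _).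
by apply/seteqP; split=> -[x y] /= [].
Qed.

Definition rot (c s : R) (z : RR * RR) : RR * RR :=
  (c * z.1 - s * z.2, s * z.1 + c * z.2).

Lemma measurable_rot (c s : R) : measurable_fun setT (rot c s).
Proof.
apply/measurable_fun_pairP; split => /=.
  by apply: measurable_funB => //; exact: measurable_funM.
by apply: measurable_funD => //; exact: measurable_funM.
Qed.

Lemma lebesgue2_rot (c s : R) (A : set (RR * RR)) : c ^+ 2 + s ^+ 2 = 1 ->
  measurable A -> (mu \x mu)%E (rot c s @^-1` A) = (mu \x mu)%E A.
Proof.
(* For [s != 0] the rotation is a product of three shears. *)
have pull (f : RR * RR -> RR * RR) : measurable_fun setT f ->
    forall A, measurable A -> measurable (f @^-1` A).
  by move=> mf B mB; rewrite -[X in measurable X]setTI; exact: mf.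
have main c' s' B : c' ^+ 2 + s' ^+ 2 = 1 -> s' != 0 -> measurable B ->
    (mu \x mu)%E (rot c' s' @^-1` B) = (mu \x mu)%E B.
  (* [t] is minus the tangent of the half angle; conjugation by the swap makes the shear act on the
     first coordinate. *)
  move=> cs s0 mB; pose t := (c' - 1) / s'.
  have -> : rot c' s' =
      @unstable.swap RR RR \o shear t \o @unstable.swap RR RR \o shear s' \o @unstable.swap RR RR \o
      shear t \o @unstable.swap RR RR.
    have t1 : t * s' = c' - 1 by rewrite /t divfK.
    have t2 : t * (1 + c') = - s'.
      by apply: (mulIf s0); rewrite mulrAC t1; lra.
    apply/funext => -[x y]; rewrite /rot /shear /unstable.swap /=; congr pair.
      transitivity ((1 + t * s') * x + t * (1 + (1 + t * s')) * y); last by ring.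
      by rewrite t1 addrCA subrr addr0 t2 mulNr.
    transitivity (s' * x + (1 + t * s') * y); last by ring.
    by rewrite t1 addrCA subrr addr0.
  have ms := @measurable_swap _ _ RR RR.
  have msh := measurable_shear.
  rewrite !comp_preimage.
  rewrite lebesgue2_swap; last by repeat (apply: (pull); [solve [exact: ms | exact: msh] |]).
  rewrite lebesgue2_shear; last by repeat (apply: (pull); [solve [exact: ms | exact: msh] |]).
  rewrite lebesgue2_swap; last by repeat (apply: (pull); [solve [exact: ms | exact: msh] |]).
  rewrite lebesgue2_shear; last by repeat (apply: (pull); [solve [exact: ms | exact: msh] |]).
  rewrite lebesgue2_swap; last by repeat (apply: (pull); [solve [exact: ms | exact: msh] |]).
  rewrite lebesgue2_shear; last by repeat (apply: (pull); [solve [exact: ms | exact: msh] |]).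
  by rewrite lebesgue2_swap.
move=> cs mA; have [s0|s0] := eqVneq s 0; last exact: main.
have [c1|c1] := eqVneq c 1.
  congr (_ _); apply/seteqP; split=> -[x y];
  by rewrite /rot /= c1 s0 !mul0r !mul1r subr0 add0r.
have cN : c = -1.
  have : (c - 1) * (c + 1) = 0 by rewrite -subr_sqr expr1n -cs s0; ring.
  by move/eqP; rewrite mulf_eq0 subr_eq0 (negbTE c1)/= addr_eq0 => /eqP.
(* The half turn is the square of the quarter turn, whose sine is nonzero. *)
have -> : rot c s = rot 0 1 \o rot 0 1.
  by apply/funext => -[x y]; rewrite /rot /= cN s0; congr pair; ring.
rewrite comp_preimage main ?main//; try by lra.
exact: pull (measurable_rot _ _) _ _.
Qed.

End PlaneMeasure.

Section GaussPlane.
Context (R : realType) (sg : R).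
Local Notation mu := (@lebesgue_measure R).
Local Notation RR := (measurableTypeR R).
Local Notation N := (normal_prob 0 sg).

Definition gauss2_pdf (z : RR * RR) : R :=
  normal_pdf 0 sg z.1 * normal_pdf 0 sg z.2.

Lemma measurable_gauss2_pdf : measurable_fun setT (EFin \o gauss2_pdf).
Proof.
apply/measurable_EFinP; apply: measurable_funM; apply: measurableT_comp => //;
exact: measurable_normal_pdf.
Qed.

Lemma gauss2_pdf_ge0 z : (0 <= (gauss2_pdf z)%:E)%E.
Proof. by rewrite lee_fin mulr_ge0// normal_pdf_ge0. Qed.

Definition gauss2 (A : set (RR * RR)) : \bar R :=
  (\int[(mu \x mu)%E]_(z in A) (gauss2_pdf z)%:E)%E.

Let gauss2_set0 : gauss2 set0 = 0%E.
Proof. by rewrite /gauss2 integral_set0. Qed.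

Let gauss2_ge0 A : (0 <= gauss2 A)%E.
Proof. by apply: integral_ge0 => z _; exact: gauss2_pdf_ge0. Qed.

Let gauss2_sigma_additive : semi_sigma_additive gauss2.
Proof.
exact: (semi_sigma_additive_nng_induced measurable_gauss2_pdf gauss2_pdf_ge0).
Qed.

HB.instance Definition _ := isMeasure.Build _ _ _
  gauss2 gauss2_set0 gauss2_ge0 gauss2_sigma_additive.

Let normal_prob_indic (V : set RR) :
  N V = (\int[mu]_x (normal_pdf 0 sg x * \1_V x)%:E)%E.
Proof.
rewrite /normal_prob integral_mkcond; apply: eq_integral => x _.
by rewrite patchE indicE; case: ifP; rewrite ?mulr1 ?mulr0.
Qed.

Let gauss2_indic (A : set (RR * RR)) :
  gauss2 A = (\int[(mu \x mu)%E]_z (gauss2_pdf z * \1_A z)%:E)%E.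
Proof.
rewrite /gauss2 integral_mkcond; apply: eq_integral => x _.
by rewrite patchE indicE; case: ifP; rewrite ?mulr1 ?mulr0.
Qed.

Let measurable_pdf_indic (V : set RR) : measurable V ->
  measurable_fun setT (fun x : RR => (normal_pdf 0 sg x * \1_V x)%:E).
Proof.
move=> mV; apply/measurable_EFinP; apply: measurable_funM.
  exact: measurable_normal_pdf.
exact: measurable_indic.
Qed.

Lemma normal_prob2E (A : set (RR * RR)) : measurable A ->
  (N \x N)%E A = gauss2 A.
Proof.
move: A; apply: product_measure_unique => A B mA mB /=.
rewrite gauss2_indic fubini_tonelli1; last 2 first.
- apply/measurable_EFinP; apply: measurable_funM.
    by apply/measurable_EFinP; exact: measurable_gauss2_pdf.
  by apply: measurable_indic; exact: measurableX.
- by move=> z; rewrite EFinM mule_ge0 ?gauss2_pdf_ge0 ?lee_fin.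
have nn V x : (0 <= (normal_pdf 0 sg x * \1_V x)%:E)%E.
  by rewrite lee_fin mulr_ge0// normal_pdf_ge0.
rewrite !normal_prob_indic -ge0_integralZr//=; last 2 first.
- exact: measurable_pdf_indic.
- by apply: integral_ge0 => x _; exact: nn.
apply: eq_integral => x _.
rewrite /fubini_F -ge0_integralZl//=; last exact: measurable_pdf_indic.
apply: eq_integral => y _; rewrite -EFinM /gauss2_pdf /=; congr (_%:E).
rewrite !indicE in_setX; case: (x \in A); case: (y \in B); by rewrite /= ?mulr1 ?mulr0 ?mul0r.
Qed.

(** The product density depends on [z.1 ^+ 2 + z.2 ^+ 2] alone, and the rotation preserves this
    quantity as well as Lebesgue measure. *)
Lemma gauss2_rot (c s : R) (A : set (RR * RR)) : sg != 0 -> c ^+ 2 + s ^+ 2 = 1 ->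
  measurable A -> (N \x N)%E (rot c s @^-1` A) = (N \x N)%E A.
Proof.
move=> s0 cs mA; have mr := @measurable_rot R c s.
rewrite !normal_prob2E//; last by rewrite -[X in measurable X]setTI; exact: mr.
rewrite !gauss2_indic.
transitivity (\int[pushforward (mu \x mu)%E (rot c s)]_z
    (gauss2_pdf z * \1_A z)%:E)%E; last first.
  apply: eq_measure_integral => //= B mB _.
  exact: lebesgue2_rot.
rewrite ge0_integral_pushforward//=.
- rewrite preimage_setT; apply: eq_integral => -[x y] _ /=.
  congr ((_ * _)%:E); rewrite /gauss2_pdf /rot /=.
  rewrite !normal_pdfE// /normal_fun mulrACA -expRD.
  rewrite [RHS]mulrACA -expRD; congr (_ * expR _).
  rewrite -!mulrDl -!opprD !subr0; congr (- _ / _).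
  by rewrite -[LHS]mul1r -cs; ring.
- by apply/measurable_EFinP; apply: measurable_funM;
    [apply/measurable_EFinP; exact: measurable_gauss2_pdf|exact: measurable_indic].
- by move=> z _; rewrite EFinM mule_ge0 ?gauss2_pdf_ge0 ?lee_fin.
Qed.
End GaussPlane.

(** * Moduli and norms as real numbers *)

Section ComplexModulus.
Context (R : realType).
Implicit Types (z w : R[i]) (r : R).

Lemma normcmodE z : `|z| = (cmod z)%:C.
Proof. by rewrite /cmod normc_def. Qed.

Lemma cmod_ge0 z : 0 <= cmod z.
Proof. by rewrite -ler0c -normcmodE. Qed.

Lemma cmodM z w : cmod (z * w) = cmod z * cmod w.
Proof. by apply: complexI; rewrite rmorphM /= -!normcmodE normrM. Qed.

Lemma cmod0 : cmod (0 : R[i]) = 0.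
Proof. by rewrite /cmod normr0. Qed.

Lemma cmod1 : cmod (1 : R[i]) = 1.
Proof. by rewrite /cmod normr1. Qed.

Lemma cmodN z : cmod (- z) = cmod z.
Proof. by rewrite /cmod normrN. Qed.

Lemma cmodB z w : cmod (z - w) = cmod (w - z).
Proof. by rewrite /cmod distrC. Qed.

Lemma cmodX z n : cmod (z ^+ n) = cmod z ^+ n.
Proof. by elim: n => [|n IH]; rewrite ?cmod1// !exprS cmodM IH. Qed.

Lemma cmodV z : cmod z^-1 = (cmod z)^-1.
Proof. by apply: complexI; rewrite fmorphV /= -!normcmodE normfV. Qed.

Lemma cmodJ z : cmod (z^*) = cmod z.
Proof. by rewrite /cmod normcJ. Qed.

Lemma cmod_real r : cmod r%:C = `|r|.
Proof. by rewrite /cmod normc_def /= expr0n addr0 sqrtr_sqr. Qed.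

Lemma ler_cmodD z w : cmod (z + w) <= cmod z + cmod w.
Proof. by rewrite -lecR rmorphD /= -!normcmodE ler_normD. Qed.

Lemma ler_cmodB z w : cmod (z - w) <= cmod z + cmod w.
Proof. by rewrite -(cmodN w) ler_cmodD. Qed.

Lemma ler_cmod_dist x z w : cmod (z - w) <= cmod (z - x) + cmod (x - w).
Proof. by rewrite (le_trans _ (ler_cmodD _ _))// addrA subrK. Qed.

Lemma ler_cmod_sum (I : Type) (s : seq I) (Q : pred I) (F : I -> R[i]) :
  cmod (\sum_(i <- s | Q i) F i) <= \sum_(i <- s | Q i) cmod (F i).
Proof.
elim/big_rec2: _ => [|i x y _]; first by rewrite cmod0.
by move=> h; rewrite (le_trans (ler_cmodD _ _))// lerD2l.
Qed.

Lemma cmod_eq0 z : (cmod z == 0) = (z == 0).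
Proof. by rewrite -[RHS]normr_eq0 normcmodE -(inj_eq (@complexI R)). Qed.

Lemma cmod_sqr z : cmod z ^+ 2 = complex.Re z ^+ 2 + complex.Im z ^+ 2.
Proof. by apply: complexI; rewrite add_Re2_Im2 normcmodE rmorphXn. Qed.

Lemma cmod_sqrC z : (cmod z ^+ 2)%:C = z * z^*.
Proof. by rewrite -sqr_normc normcmodE rmorphXn. Qed.

Lemma ler_Re_cmod z : `|complex.Re z| <= cmod z.
Proof.
rewrite -(@ler_pXn2r _ 2)// ?nnegrE ?cmod_ge0// cmod_sqr real_normK ?num_real//.
by rewrite lerDl sqr_ge0.
Qed.

Lemma ler_Im_cmod z : `|complex.Im z| <= cmod z.
Proof.
rewrite -(@ler_pXn2r _ 2)// ?nnegrE ?cmod_ge0// cmod_sqr real_normK ?num_real//.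
by rewrite lerDr sqr_ge0.
Qed.

Lemma ReD z w : complex.Re (z + w) = complex.Re z + complex.Re w.
Proof. by case: z w => [a b] [c d]. Qed.

Lemma ImD z w : complex.Im (z + w) = complex.Im z + complex.Im w.
Proof. by case: z w => [a b] [c d]. Qed.

Lemma ReM z w : complex.Re (z * w) =
  complex.Re z * complex.Re w - complex.Im z * complex.Im w.
Proof. by case: z w => [a b] [c d]. Qed.

Lemma ImM z w : complex.Im (z * w) =
  complex.Re z * complex.Im w + complex.Im z * complex.Re w.
Proof. by case: z w => [a b] [c d]. Qed.

Variable V : normedModType R[i].
Implicit Types x y : V.

Lemma rnormE x : `|x| = (rnorm x)%:C.
Proof. by rewrite /rnorm RRe_real// ger0_real. Qed.

Lemma rnorm_ge0 x : 0 <= rnorm x.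
Proof. by rewrite -ler0c -rnormE. Qed.

Lemma rnorm0 : rnorm (0 : V) = 0.
Proof. by rewrite /rnorm normr0. Qed.

Lemma ler_rnormD x y : rnorm (x + y) <= rnorm x + rnorm y.
Proof. by rewrite -lecR rmorphD /= -!rnormE ler_normD. Qed.

Lemma rnormZ z x : rnorm (z *: x) = cmod z * rnorm x.
Proof. by apply: complexI; rewrite rmorphM /= -normcmodE -!rnormE normrZ. Qed.

Lemma ler_rnorm_sum (I : Type) (s : seq I) (Q : pred I) (F : I -> V) :
  rnorm (\sum_(i <- s | Q i) F i) <= \sum_(i <- s | Q i) rnorm (F i).
Proof.
elim/big_rec2: _ => [|i x y _]; first by rewrite rnorm0.
by move=> h; rewrite (le_trans (ler_rnormD _ _))// lerD2l.
Qed.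

Lemma rnorm_sqrD x y :
  rnorm (x + y) ^+ 2 <= 2 * rnorm x ^+ 2 + 2 * rnorm y ^+ 2.
Proof.
have h := ler_rnormD x y; have := rnorm_ge0 (x + y).
by have := sqr_ge0 (rnorm x - rnorm y); nra.
Qed.

Lemma rnorm_sqr_half x y :
  rnorm (2^-1%:C *: (x + y)) ^+ 2 <= 2^-1 * rnorm x ^+ 2 + 2^-1 * rnorm y ^+ 2.
Proof.
rewrite rnormZ cmod_real ger0_norm// exprMn.
by have := rnorm_sqrD x y; lra.
Qed.

End ComplexModulus.

(** * Invariance of Gaussian sums *)

Section MeasurableNorm.
Context d (T : measurableType d) (R : realType) (V : normedModType R[i]).
Variables (I : finType) (g : I -> T -> R) (y : I -> V).
Hypothesis mg : forall i, measurable_fun setT (g i).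

Let approx (q : I -> R) (t : T) : R :=
  rnorm (\sum_i (q i)%:C *: y i) + \sum_i `|g i t - q i| * rnorm (y i).

Let lip (a b : I -> R) :
  rnorm (\sum_i (a i)%:C *: y i) <=
  rnorm (\sum_i (b i)%:C *: y i) + \sum_i `|a i - b i| * rnorm (y i).
Proof.
have -> : \sum_i (a i)%:C *: y i =
    \sum_i (b i)%:C *: y i + \sum_i (a i - b i)%:C *: y i.
  rewrite -big_split /=; apply: eq_bigr => i _.
  by rewrite -scalerDl -rmorphD /= addrC subrK.
rewrite (le_trans (ler_rnormD _ _))// lerD2l (le_trans (ler_rnorm_sum _ _ _))//.
by apply: ler_sum => i _; rewrite rnormZ cmod_real.
Qed.

(* The norm is [1]-Lipschitz, hence equals the infimum of the functions
   [approx q] over the countably many rational [q]: no separability of [V] is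
   needed. *)
Lemma measurable_rnorm_sum :
  measurable_fun setT (fun t => rnorm (\sum_i (g i t)%:C *: y i)).
Proof.
apply: (measurability _ (RGenInftyO.measurableE R)) => //.
move=> _ [_ [c ->] <-]; rewrite setTI.
have -> : (fun t => rnorm (\sum_i (g i t)%:C *: y i)) @^-1` `]-oo, c[ =
    \bigcup_(q in [set: {ffun I -> rat}])
      [set t | approx (fun i => ratr (q i)) t < c].
  apply/seteqP; split=> t /=; rewrite in_itv/=.
    move=> tc; pose S := \sum_i rnorm (y i) + 1.
    have S0 : 0 < S by rewrite ltr_wpDl// sumr_ge0// => i _; exact: rnorm_ge0.
    set phi := rnorm _ in tc; pose del := (c - phi) / (2 * S).
    have del0 : 0 < del by rewrite divr_gt0 ?subr_gt0 ?mulr_gt0.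
    have /choice[q qP] (i : I) : exists q : rat, `|g i t - ratr q| < del.
      have [q] := @rat_in_itvoo R (g i t - del) (g i t + del) ltac:(lra).
      by rewrite in_itv/= => /andP[? ?]; exists q; rewrite ltr_norml; lra.
    exists [ffun i => q i] => //=.
    have bd : \sum_i `|g i t - ratr ([ffun i0 => q i0] i)| * rnorm (y i) <=
        del * (S - 1).
      rewrite /S addrK mulr_sumr; apply: ler_sum => i _; rewrite ffunE.
      by rewrite ler_wpM2r ?rnorm_ge0// ltW.
    have := lip (fun i => ratr ([ffun i0 => q i0] i)) (fun i => g i t).
    under [X in _ <= _ + X]eq_bigr do rewrite distrC.
    rewrite -/phi => h; rewrite /approx.
    have dS : del * S * 2 = c - phi by rewrite /del; field; rewrite gt_eqF.
    by lra.
  move=> [q _] /= qc; rewrite (le_lt_trans _ qc)//.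
  exact: (lip (fun i => g i t)).
apply: countable_bigcupT_measurable => // q.
rewrite -[X in measurable X]setTI.
have -> : [set t | approx (fun i => ratr (q i)) t < c] =
  approx (fun i => ratr (q i)) @^-1` `]-oo, c[.
  by apply/seteqP; split=> t /=; rewrite in_itv.
suff : measurable_fun setT (approx (fun i => ratr (q i))) by apply.
apply: measurable_funD => //; apply: measurable_sum => i.
apply: measurable_funM => //; apply: measurableT_comp => //.
exact: measurable_funB.
Qed.

End MeasurableNorm.


(** Both sides are finite measures in [A] that agree on the pi-system [G]. When [m] is the law of
    [f], this extends the independence of [f] and the event [B] to all measurable sets. *)
Lemma measure_preimage_unique d d1 (T : measurableType d) (T1 : measurableType d1)
    (R : realType) (P : probability T R) (m : {measure set T1 -> \bar R})
    (G : set (set T1)) (f : T -> T1) (B : set T) :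
  measurable = <<s G >> -> setI_closed G -> G setT ->
  measurable_fun setT f -> measurable B ->
  (forall A, G A -> P (f @^-1` A `&` B) = m A * P B)%E ->
  forall A, measurable A -> P (f @^-1` A `&` B) = (m A * P B)%E.
Proof.
move=> mG GI GT mf mB PG A mA.
have k0 : 0 <= fine (P B) by rewrite fine_ge0.
pose k : {nonneg R} := NngNum k0.
have mk C : mscale k m C = (m C * P B)%E.
  by rewrite /mscale /= fineK ?fin_num_measure// muleC.
pose m1 := measure_function_pushforward__canonical__measure_function_Measure
  (mrestr P mB) mf.
have m1E C : m1 C = P (f @^-1` C `&` B) by [].
rewrite -m1E -mk.
apply: (measure_unique G (fun=> setT)) => //.
- by rewrite bigcup_const//; exists 0%N.
- by move=> C GC; exact: etrans (PG C GC) (esym (mk C)).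
- by move=> _; rewrite m1E preimage_setT setTI (le_lt_trans (probability_le1 _ _))// ltry.
Qed.

Section RealGaussianSums.
Context d (Sigma : measurableType d) (R : realType) (P : probability Sigma R).
Context (V : normedModType R[i]) (I : finType) (xi : I -> Sigma -> R) (sg : R).
Local Notation N := (normal_prob 0 sg).
Hypothesis sg0 : sg != 0.
Hypothesis mxi : forall i, measurable_fun setT (xi i).
Hypothesis xi_law : forall A : I -> set R, (forall i, measurable (A i)) ->
  P [set w | forall i, A i (xi i w)] = (\prod_i N (A i))%E.

Definition sqint (y : I -> V) : \bar R :=
  (\int[P]_w ((rnorm (\sum_i (xi i w)%:C *: y i)) ^+ 2)%:E)%E.

Definition rotated (a b : I) (c s : R) (y : I -> V) (i : I) : V :=
  if i == a then c%:C *: y a + s%:C *: y b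
  else if i == b then - (s%:C *: y a) + c%:C *: y b else y i.

(** Rotating the vectors [y a], [y b] has the same effect on the sum as applying [rot c s] to the
    coefficients [(xi a, xi b)]; the law of this pair is rotation invariant and independent of the
    other coefficients. *)
Lemma sqint_rotated (a b : I) (c s : R) (y : I -> V) : a != b ->
  c ^+ 2 + s ^+ 2 = 1 -> sqint (rotated a b c s y) = sqint y.
Proof.
move=> ab cs.
(* [S2] is [Sigma] with the sigma-algebra generated by the coordinates other than [a] and [b]. These
   coordinates are carried along by the point [w] itself, so the joint law to compare is a product
   measure on the plane times [S2]. *)
pose G : set (set Sigma) := [set E | exists2 A : I -> set R,
  (forall i, measurable (A i)) &
  E = [set w | forall i, i != a -> i != b -> A i (xi i w)]].
pose S2 := g_sigma_algebraType G.
have mxiA i A : measurable A -> measurable (xi i @^-1` A).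
  by move=> mA; rewrite -[X in measurable X]setTI; exact: mxi.
have Gm : G `<=` measurable.
  move=> E [A mA ->].
  rewrite [X in measurable X](_ : _ = \bigcap_(i in [set i | i != a /\ i != b]) (xi i @^-1` A i)).
    by apply: fin_bigcap_measurable; [exact: finite_finset|move=> i _; exact: mxiA].
  by apply/seteqP; split=> w /= h i; [move=> [] /h|move=> ia ib; exact: h].
have mid : measurable_fun setT (id : Sigma -> S2).
  move=> _ B mB; rewrite setTI preimage_id.
  by apply: (smallest_sub _ Gm mB); exact: sigma_algebra_measurable.
have GI : setI_closed G.
  move=> _ _ [A mA ->] [B mB ->]; exists (fun i => A i `&` B i).
    by move=> i; exact: measurableI.
  by apply/seteqP; split=> w /= => [[h1 h2] i ia ib|h]; split; auto;
    move=> i ia ib; have [] := h i ia ib.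
have GT : G setT by exists (fun=> setT) => //; apply/seteqP; split.
pose Z w := (xi a w, xi b w) : measurableTypeR R * measurableTypeR R.
have mZ : measurable_fun setT Z.
  by apply: (@measurable_fun_pair _ _ _ _ (measurableTypeR R) (measurableTypeR R)); exact: mxi.
have Zrect A1 A2 E : measurable A1 -> measurable A2 -> G E ->
    P (Z @^-1` (A1 `*` A2) `&` E) = (N A1 * N A2 * P E)%E.
  move=> m1 m2 [A mA EE].
  pose A' B1 B2 i := if i == a then B1 else if i == b then B2 else A i.
  have mA' B1 B2 i : measurable B1 -> measurable B2 -> measurable (A' B1 B2 i).
    by move=> ? ?; rewrite /A'; do 2 case: ifP => // _.
  have prodE B1 B2 : (\prod_i N (A' B1 B2 i) =
      N B1 * N B2 * \prod_(i | (i != a) && (i != b)) N (A i))%E.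
    rewrite (bigD1 a)//= (bigD1 b)/=; last by rewrite eq_sym.
    rewrite muleA; congr (_ * _ * _)%E.
    - by rewrite /A' eqxx.
    - by rewrite /A' eqxx eq_sym (negbTE ab).
    - by apply: eq_bigr => i /andP[/negbTE ia /negbTE ib]; rewrite /A' ia ib.
  have -> : Z @^-1` (A1 `*` A2) `&` E = [set w | forall i, A' A1 A2 i (xi i w)].
    rewrite EE; apply/seteqP; split=> w /=.
      move=> [[h1 h2] h] i; rewrite /A'; case: eqVneq => [->//|ia].
      by case: eqVneq => [->//|ib]; exact: h.
    move=> h; split; first split.
    - by have := h a; rewrite /A' eqxx.
    - by have := h b; rewrite /A' eqxx eq_sym (negbTE ab).
    - by move=> i ia ib; have := h i; rewrite /A' (negbTE ia) (negbTE ib).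
  have -> : E = [set w | forall i, A' setT setT i (xi i w)].
    rewrite EE; apply/seteqP; split=> w /= h i.
      by rewrite /A'; case: eqVneq => // ia; case: eqVneq => // ib; exact: h.
    by move=> ia ib; have := h i; rewrite /A' (negbTE ia) (negbTE ib).
  rewrite (@xi_law (A' A1 A2)); last by move=> i; exact: mA'.
  rewrite (@xi_law (A' setT setT)); last by move=> i; exact: mA'.
  by rewrite !prodE probability_setT !mul1e.
(* Independence is extended from generators in two rounds: first in the plane set [A] with [E] in
   [G] fixed, then in [E], with the identity map into [S2] as random variable. *)
have Zind A E : measurable A -> <<s G >> E ->
    P (Z @^-1` A `&` E) = ((N \x N)%E A * P E)%E.
  move=> mA sE.
  have ZG E' : G E' -> P (Z @^-1` A `&` E') = ((N \x N)%E A * P E')%E.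
    move=> GE'.
    apply: (@measure_preimage_unique _ _ _ _ _ P (N \x N)%E
      [set A `*` B | A in measurable & B in measurable] Z E') => //.
    - exact: measurable_prod_measurableType.
    - move=> _ _ [A1 mA1 [A2 mA2 <-]] [B1 mB1 [B2 mB2 <-]].
      exists (A1 `&` B1); first exact: measurableI.
      exists (A2 `&` B2); first exact: measurableI.
      by rewrite setXI.
    - by exists setT => //; exists setT => //; rewrite setXTT.
    - exact: Gm.
    - by move=> _ [A1 mA1 [A2 mA2 <-]]; rewrite Zrect//= product_measure1E.
  have PZ : P (Z @^-1` A) = (N \x N)%E A.
    by have := ZG setT GT; rewrite setIT probability_setT mule1.
  have mZA : measurable (Z @^-1` A) by rewrite -[X in measurable X]setTI; exact: mZ.
  have -> : Z @^-1` A `&` E = id @^-1` E `&` Z @^-1` A by rewrite setIC.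
  rewrite -PZ muleC.
  apply: (@measure_preimage_unique _ _ _ S2 _ P
    (measure_function_pushforward__canonical__measure_function_Measure P mid)
    G id (Z @^-1` A)) => //.
  by move=> E' GE'; rewrite setIC ZG// PZ muleC.
pose P2 : probability S2 R := distribution P (mfun_Sub (mem_set mid)).
have P2E E : P2 E = P E by [].
pose N2 : {sigma_finite_measure set (measurableTypeR R * measurableTypeR R)%type -> \bar R} :=
  product_subprobability ((N : subprobability (measurableTypeR R) R),
    (N : subprobability (measurableTypeR R) R)).
have law (f : Sigma -> measurableTypeR R * measurableTypeR R) :
    measurable_fun setT f ->
    (forall A E, measurable A -> <<s G >> E ->
      P (f @^-1` A `&` E) = ((N \x N)%E A * P E)%E) ->
    forall X, measurable X ->
      P ((fun w => (f w, w : S2)) @^-1` X) = (N2 \x P2)%E X.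
  move=> mf fE.
  have mfw : measurable_fun setT (fun w => (f w, w : S2)) by exact: measurable_fun_pair.
  have K := @product_measure_pushforward _ _ _ Sigma
    (measurableTypeR R * measurableTypeR R)%type S2 R P N2 P2 _ mfw.
  apply K.
  move=> A E mA mE; exact: fE.
have mrot := @measurable_rot R c s.
have mfrot : measurable_fun setT (rot c s \o Z) by exact: measurableT_comp.
have lawZ := law Z mZ Zind.
have lawr : forall X, measurable X ->
    P ((fun w => ((rot c s \o Z) w, w : S2)) @^-1` X) = (N2 \x P2)%E X.
  apply: (law _ mfrot) => A E mA mE.
  have mrA : measurable (rot c s @^-1` A) by rewrite -[X in measurable X]setTI; exact: mrot.
  rewrite comp_preimage (Zind _ _ mrA mE).
  by rewrite (gauss2_rot sg0 cs mA).
have sumab (f : I -> V) : \sum_i f i = f a + (f b + \sum_(i | (i != a) && (i != b)) f i).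
  by rewrite (bigD1 a)//= (bigD1 b)//= eq_sym.
pose rest w := \sum_(i | (i != a) && (i != b)) (xi i w)%:C *: y i.
pose F (u : (measurableTypeR R * measurableTypeR R) * S2) : \bar R :=
  ((rnorm (u.1.1%:C *: y a + (u.1.2%:C *: y b + rest u.2))) ^+ 2)%:E.
have mF : measurable_fun setT F.
  pose g i (u : (measurableTypeR R * measurableTypeR R) * S2) : R :=
    if i == a then u.1.1 else if i == b then u.1.2 else xi i u.2.
  have FE u : F u = ((rnorm (\sum_i (g i u)%:C *: y i)) ^+ 2)%:E.
    rewrite sumab /g !eqxx (eq_sym b) (negbTE ab) /F /rest.
    congr ((rnorm (_ + (_ + _)) ^+ 2)%:E).
    by apply: eq_bigr => i /andP[/negbTE -> /negbTE ->].
  rewrite (funext FE); apply/measurable_EFinP; apply: measurable_funX.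
  apply: measurable_rnorm_sum => i; rewrite /g; case: eqVneq => [_|ia].
    exact: measurableT_comp.
  case: eqVneq => [_|ib]; first exact: measurableT_comp.
  apply: (@measurableT_comp _ _ _ _ _ _ (xi i : S2 -> R)) => //.
  move=> _ B mB; rewrite setTI; apply: sub_sigma_algebra.
  exists (fun j => if j == i then B else setT); first by move=> j; case: ifP.
  apply/seteqP; split=> w /=; first by move=> Bw j ja jb; case: eqVneq => // ->.
  by move=> /(_ i ia ib); rewrite eqxx.
have F0 u : (0 <= F u)%E by rewrite lee_fin sqr_ge0.
have intF (f : Sigma -> measurableTypeR R * measurableTypeR R) :
    measurable_fun setT f ->
    (forall X, measurable X ->
      P ((fun w => (f w, w : S2)) @^-1` X) = (N2 \x P2)%E X) ->
    (\int[P]_w F (f w, w) = \int[N2 \x P2]_u F u)%E.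
  move=> mf fE.
  have mfw : measurable_fun setT (fun w => (f w, w : S2)) by exact: measurable_fun_pair.
  transitivity (\int[pushforward P (fun w => (f w, w : S2))]_u F u)%E.
    by rewrite ge0_integral_pushforward//.
  by apply: eq_measure_integral => //= X mX _; exact: fE.
transitivity (\int[P]_w F (rot c s (Z w), w))%E.
  apply: eq_integral => w _; congr ((_ ^+ 2)%:E); congr rnorm.
  rewrite sumab /rotated !eqxx (eq_sym b) (negbTE ab) /rest /= addrA [RHS]addrA.
  congr (_ + _); last by apply: eq_bigr => i /andP[/negbTE -> /negbTE ->].
  rewrite !scalerDr scalerN !scalerA rmorphB rmorphD !rmorphM /=.
  rewrite scalerBl scalerDl [RHS]addrACA.
  by rewrite ![_ * c%:C]mulrC ![_ * s%:C]mulrC.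
rewrite (intF _ mfrot lawr) -(intF _ mZ lawZ).
apply: eq_integral => w _; congr ((_ ^+ 2)%:E); congr rnorm.
by rewrite [RHS]sumab.
Qed.

End RealGaussianSums.

(** * Unitary invariance of complex Gaussian sums *)

Section ComplexGaussianSums.
Context d (Sigma : measurableType d) (R : realType) (P : probability Sigma R).
Context (gamma : nat -> Sigma -> R[i]) (X : normedModType R[i]).
Hypothesis hgamma : iid_complex_gaussian P gamma.

Definition gint n (x : 'I_n -> X) : \bar R :=
  (\int[P]_w ((rnorm (\sum_(i < n) gamma i w *: x i)) ^+ 2)%:E)%E.

Let sg : R := (Num.sqrt 2)^-1.
Local Notation N := (normal_prob 0 sg).

Let sg0 : sg != 0.
Proof. by rewrite invr_neq0// sqrtr_eq0 -ltNge. Qed.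

Definition gcoord n (i : 'I_n * bool) (w : Sigma) : R :=
  if i.2 then complex.Im (gamma i.1 w) else complex.Re (gamma i.1 w).

Let lift n (x : 'I_n -> X) (i : 'I_n * bool) : X :=
  if i.2 then 'i *: x i.1 else x i.1.

Lemma measurable_gcoord n (i : 'I_n * bool) : measurable_fun setT (gcoord i).
Proof.
have [/(_ i.1)[mg _] _] := hgamma.
rewrite /gcoord; case: i.2.
  by apply: (measurableT_comp measurable_snd mg).
by apply: (measurableT_comp measurable_fst mg).
Qed.

Lemma gcoord_law n (A : 'I_n * bool -> set R) : (forall i, measurable (A i)) ->
  P [set w | forall i, A i (gcoord i w)] = (\prod_i N (A i))%E.
Proof.
move=> mA; have [gl gi] := hgamma.
(* Independence is stated for families of sets indexed by all of [nat], hence the padding with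
   [setT] from [n] on. *)
pose A' (k : nat) : set (R * R) :=
  if insub k is Some o then A (o, false) `*` A (o, true) else setT.
have mA' k : measurable (A' k).
  by rewrite /A'; case: insub => // o; exact: measurableX.
have A'E (o : 'I_n) : A' o = A (o, false) `*` A (o, true) by rewrite /A' valK.
have := gi (map val (enum 'I_n)) A'.
rewrite map_inj_uniq ?enum_uniq; last exact: val_inj.
move=> /(_ isT mA').
have -> : \bigcap_(k in [set` map val (enum 'I_n)]) (re_im gamma k @^-1` A' k) =
    [set w | forall i, A i (gcoord i w)].
  apply/seteqP; split=> w /=.
    move=> h [k b]; have := h k; rewrite /= A'E map_f ?mem_enum//.
    by move=> /(_ isT)[/= ? ?]; case: b.
  move=> h k /= /mapP[j _ ->]; rewrite /preimage /= A'E; split.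
    exact: (h (j, false)).
  exact: (h (j, true)).
move=> ->; rewrite big_map big_enum /=.
rewrite [RHS](eq_bigr (fun p => N (A (p.1, p.2)))); last by case.
rewrite -(pair_bigA _ (fun o b => N (A (o, b))))/=.
apply: eq_bigr => o _; rewrite big_bool/=.
have [_ ->] := gl o; last exact: mA'.
rewrite A'E product_measure1E; [exact: muleC|exact: mA|exact: mA].
Qed.

Lemma gsum_lift n (x : 'I_n -> X) w :
  \sum_(i < n) gamma i w *: x i = \sum_i (@gcoord n i w)%:C *: lift x i.
Proof.
rewrite [RHS](eq_bigr (fun p => (gcoord (p.1, p.2) w)%:C *: lift x (p.1, p.2)));
  last by case.
rewrite -(pair_bigA _ (fun o b => (gcoord (o, b) w)%:C *: lift x (o, b)))/=.
apply: eq_bigr => o _; rewrite big_bool/= /gcoord/= /lift/=.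
by rewrite scalerA -scalerDl {1}[gamma o w]complexE addrC mulrC.
Qed.

Lemma gint_lift n (x : 'I_n -> X) : gint x = sqint P (@gcoord n) (lift x).
Proof. by apply: eq_integral => w _; rewrite gsum_lift. Qed.

Let sqint_lift_rotated n (y : 'I_n * bool -> X) a b (c s : R) : a != b ->
  c ^+ 2 + s ^+ 2 = 1 ->
  sqint P (@gcoord n) (rotated a b c s y) = sqint P (@gcoord n) y.
Proof.
exact: (sqint_rotated sg0 (@measurable_gcoord n) (@gcoord_law n)).
Qed.

(** In the real form of the sum, [x k] and ['i *: x k] occupy the two slots of [gamma k], and a
    unimodular factor rotates this pair. *)
Lemma gint_phase n (x : 'I_n -> X) (k : 'I_n) (z : R[i]) : cmod z = 1 ->
  gint (fun i => if i == k then z *: x k else x i) = gint x.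
Proof.
move=> z1; rewrite !gint_lift.
have -> : lift (fun i => if i == k then z *: x k else x i) =
    rotated (k, false) (k, true) (complex.Re z) (complex.Im z) (lift x).
  apply/funext => -[i b]; rewrite /rotated /lift /= !xpair_eqE.
  case: (eqVneq i k) => [->|//]; rewrite {1 2}[z]complexE.
  case: b => /=; last by rewrite scalerDl scalerA [_%:C * 'i]mulrC.
  rewrite scalerDl scalerDr !scalerA mulrA -expr2 sqr_i mulN1r scaleNr.
  by rewrite addrC [_%:C * 'i]mulrC.
by apply: sqint_lift_rotated; rewrite ?xpair_eqE ?andbF// -cmod_sqr z1 expr1n.
Qed.

(** A real rotation of two complex slots is made of two real ones, on the real parts and then on the
    imaginary parts. *)
Lemma gint_givens n (x : 'I_n -> X) (k l : 'I_n) (c s : R) : k != l ->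
  c ^+ 2 + s ^+ 2 = 1 ->
  gint (fun i => if i == k then c%:C *: x k + s%:C *: x l
    else if i == l then - (s%:C *: x k) + c%:C *: x l else x i) = gint x.
Proof.
move=> kl cs; rewrite !gint_lift.
rewrite -(@sqint_lift_rotated n (lift x) (k, false) (l, false) c s)//; last first.
  by rewrite xpair_eqE (negbTE kl).
rewrite -(@sqint_lift_rotated n (rotated _ _ _ _ _) (k, true) (l, true) c s)//; last first.
  by rewrite xpair_eqE (negbTE kl).
congr (sqint _ _ _); apply/funext => -[i b]; rewrite /rotated /lift /= !xpair_eqE.
case: b => /=; rewrite ?andbT ?andbF /=; do ?case: ifP => // _.
- by rewrite scalerDr !scalerA ![_%:C * 'i]mulrC.
- by rewrite scalerDr scalerN !scalerA ![_%:C * 'i]mulrC.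
Qed.

Let mgint n (x : 'I_n -> X) :
  measurable_fun setT (fun w => ((rnorm (\sum_(i < n) gamma i w *: x i)) ^+ 2)%:E).
Proof.
apply/measurable_EFinP; apply: measurable_funX.
under eq_fun do rewrite gsum_lift.
by apply: measurable_rnorm_sum; exact: measurable_gcoord.
Qed.

Lemma gint_ge0 n (x : 'I_n -> X) : (0 <= gint x)%E.
Proof. by apply: integral_ge0 => w _; rewrite lee_fin sqr_ge0. Qed.

Lemma gint_comb n (u x y : 'I_n -> X) (a b : R) : 0 <= a -> 0 <= b ->
  (forall w, rnorm (\sum_(i < n) gamma i w *: u i) ^+ 2 <=
     a * rnorm (\sum_(i < n) gamma i w *: x i) ^+ 2 +
     b * rnorm (\sum_(i < n) gamma i w *: y i) ^+ 2) ->
  (gint u <= a%:E * gint x + b%:E * gint y)%E.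
Proof.
move=> a0 b0 h; rewrite /gint -!ge0_integralZl//; first last.
- by move=> w _; rewrite lee_fin sqr_ge0.
- by move=> w _; rewrite lee_fin sqr_ge0.
rewrite -ge0_integralD//; first last.
- exact: measurable_funeM.
- by move=> w _; rewrite mule_ge0// lee_fin sqr_ge0.
- exact: measurable_funeM.
- by move=> w _; rewrite mule_ge0// lee_fin sqr_ge0.
apply: ge0_le_integral => //.
- by move=> w _; rewrite lee_fin sqr_ge0.
- by apply: emeasurable_funD; exact: measurable_funeM.
- by move=> w _; rewrite -!EFinM -EFinD lee_fin.
Qed.

Lemma gintD n (x y : 'I_n -> X) :
  (gint (fun i => (x i + y i)%R) <= 2%:E * gint x + 2%:E * gint y)%E.
Proof.
apply: gint_comb => // w.
under eq_bigr do rewrite scalerDr.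
by rewrite big_split; exact: rnorm_sqrD.
Qed.

(* Killing a coordinate averages [x] with its image under a sign change. *)
Lemma gint_kill n (x : 'I_n -> X) (k : 'I_n) :
  (gint (fun i => if i == k then 0%R else x i) <= gint x)%E.
Proof.
have gE : (2^-1%:E * gint x + 2^-1%:E *
    gint (fun i => (if i == k then -1 *: x k else x i)%R) = gint x)%E.
  rewrite gint_phase; last by rewrite cmodN cmod1.
  by rewrite -ge0_muleDl ?lee_fin// -EFinD -mulr2n -[_ *+ 2]mulr_natl divff// mul1e.
rewrite -[leRHS]gE; apply: gint_comb => // w.
have -> : \sum_(i < n) gamma i w *: (if i == k then 0 else x i) =
  2^-1%:C *: (\sum_(i < n) gamma i w *: x i +
    \sum_(i < n) gamma i w *: (if i == k then -1 *: x k else x i)).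
  rewrite -big_split scaler_sumr; apply: eq_bigr => i _ /=.
  rewrite -scalerDr; case: eqVneq => [->|_].
    by rewrite scaleN1r subrr !scaler0.
  rewrite -[x i + x i]mulr2n -[x i *+ 2]scaler_nat !scalerA; congr (_ *: _).
  have h2 : 2^-1%:C * 2%:R = 1 :> R[i].
    by rewrite -(rmorph_nat (real_complex R)) -rmorphM/= mulVf.
  by rewrite mulrAC h2 mul1r.
exact: rnorm_sqr_half.
Qed.

Lemma gint_restrict n (x : 'I_n -> X) (S : pred 'I_n) :
  (gint (fun i => if S i then x i else 0%R) <= gint x)%E.
Proof.
have h (s : seq 'I_n) :
    (gint (fun i => if i \in s then 0%R else x i) <= gint x)%E.
  elim: s => [|k s IH]; first exact: lexx.
  apply: le_trans IH; apply: le_trans (gint_kill _ k).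
  rewrite le_eqVlt; apply/orP; left; apply/eqP; congr gint; apply/funext => i.
  by rewrite in_cons; case: eqVneq.
rewrite (_ : (fun i => _) =
    fun i => if i \in enum (predC S) then 0%R else x i)//.
by apply/funext => i; rewrite mem_enum inE; case: (S i).
Qed.

End ComplexGaussianSums.

(** * Reduction of scalar matrices by unitary row operations *)

Section Contractions.
Context d (Sigma : measurableType d) (R : realType) (P : probability Sigma R).
Context (gamma : nat -> Sigma -> R[i]) (X : normedModType R[i]).
Hypothesis hgamma : iid_complex_gaussian P gamma.
Local Notation C := R[i].

Definition mxapp n m (A : 'M[C]_(n, m)) (z : 'I_m -> X) (i : 'I_n) : X :=
  \sum_j A i j *: z j.

Definition gram n m (A : 'M[C]_(n, m)) (j l : 'I_m) : C :=
  \sum_i (A i j)^* * A i l.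

(** Stands for [B = U A] with [U] unitary, recorded through the two invariants that the elimination
    uses: the Gaussian integrals and the Gram matrix, which keeps an isometry isometric. *)
Definition gequiv n m (A B : 'M[C]_(n, m)) : Prop :=
  (forall z, gint P gamma (mxapp A z) = gint P gamma (mxapp B z)) /\
  (forall j l, gram A j l = gram B j l).

Lemma gequiv_refl n m (A : 'M[C]_(n, m)) : gequiv A A.
Proof. by split. Qed.

Lemma gequiv_trans n m (A B D : 'M[C]_(n, m)) :
  gequiv A B -> gequiv B D -> gequiv A D.
Proof. by move=> [h1 h2] [h3 h4]; split=> *; rewrite ?h1 ?h2 ?h3 ?h4. Qed.

Lemma gequiv_phase n m (A : 'M[C]_(n, m)) k (u : C) : cmod u = 1 ->
  gequiv A (\matrix_(i, j) (if i == k then u * A k j else A i j)).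
Proof.
move=> u1; split=> [z|j l].
  rewrite -(gint_phase hgamma _ k u1); congr gint; apply/funext => i.
  rewrite /mxapp; case: eqVneq => [->|ik].
    by rewrite scaler_sumr; apply: eq_bigr => j _; rewrite mxE eqxx scalerA.
  by apply: eq_bigr => j _; rewrite mxE (negbTE ik).
apply: eq_bigr => i _; rewrite !mxE; case: eqVneq => // ->.
by rewrite rmorphM /= mulrACA [_^* * u]mulrC -cmod_sqrC u1 expr1n mul1r.
Qed.

Lemma gequiv_givens n m (A : 'M[C]_(n, m)) k l (c s : R) : k != l ->
  c ^+ 2 + s ^+ 2 = 1 ->
  gequiv A (\matrix_(i, j) (if i == k then c%:C * A k j + s%:C * A l j
    else if i == l then - (s%:C * A k j) + c%:C * A l j else A i j)).
Proof.
move=> kl cs; split=> [z|j j'].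
  rewrite -(gint_givens hgamma _ kl cs); congr gint; apply/funext => i.
  rewrite /mxapp; case: eqVneq => [->|ik]; last case: eqVneq => [->|il].
  - rewrite !scaler_sumr -big_split; apply: eq_bigr => j _.
    by rewrite mxE eqxx /= scalerDl !scalerA.
  - rewrite !scaler_sumr -sumrN -big_split; apply: eq_bigr => j _.
    by rewrite mxE eq_sym (negbTE kl) eqxx /= scalerDl !scalerA scaleNr.
  - by apply: eq_bigr => j _; rewrite mxE (negbTE ik) (negbTE il).
have lk : l != k by rewrite eq_sym.
rewrite /gram (bigD1 k)//= [RHS](bigD1 k)//= (bigD1 l lk)/=.
rewrite [X in _ = _ + X](bigD1 l lk)/= !addrA.
congr (_ + _); last first.
  by apply: eq_bigr => i /andP[/negbTE ik /negbTE il]; rewrite !mxE ik il.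
rewrite !mxE !eqxx (eq_sym l) (negbTE kl).
have cJ (x : R) : x%:C^* = x%:C :> C by exact: conjc_real.
rewrite !(rmorphD, rmorphN, rmorphM) /= !cJ.
have cs' : c%:C ^+ 2 + s%:C ^+ 2 = 1 :> C by rewrite -!rmorphXn -rmorphD /= cs.
transitivity ((c%:C ^+ 2 + s%:C ^+ 2) * ((A k j)^* * A k j' + (A l j)^* * A l j')).
  by rewrite cs' mul1r.
ring.
Qed.

Definition unphase (p : C) : C := if p == 0 then 1 else p^* / (cmod p)%:C.

Lemma cmod_unphase p : cmod (unphase p) = 1.
Proof.
rewrite /unphase; case: eqVneq => [_|p0]; first by rewrite cmod1.
rewrite cmodM cmodJ cmodV cmod_real ger0_norm ?cmod_ge0// divff//.
by rewrite cmod_eq0.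
Qed.

Lemma unphaseM p : unphase p * p = (cmod p)%:C.
Proof.
rewrite /unphase; case: eqVneq => [->|p0]; first by rewrite mul1r cmod0.
rewrite mulrAC mulrC -[p^* * p]mulrC -cmod_sqrC rmorphXn /= expr2.
by rewrite mulKf// (inj_eq (@complexI R) _ 0) cmod_eq0.
Qed.

(** Givens elimination: phases make the entries of column [j] in rows [k] and [l] nonnegative, then
    a real rotation annihilates the second. The last clause protects the columns that are already
    reduced, since mixing two zeros gives zeros. *)
Lemma gequiv_kill n m (A : 'M[C]_(n, m)) (k l : 'I_n) (j : 'I_m) : k != l ->
  exists B, [/\ gequiv A B, B l j = 0,
    forall i, i != k -> i != l -> forall j', B i j' = A i j' &
    forall j', A k j' = 0 -> A l j' = 0 -> B k j' = 0 /\ B l j' = 0].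
Proof.
move=> kl; have [q0|q0] := eqVneq (A l j) 0.
  by exists A; split => //; exact: gequiv_refl.
set p := A k j; set q := A l j in q0.
pose B1 := \matrix_(i, j') (if i == k then unphase p * A k j' else A i j').
pose B2 := \matrix_(i, j') (if i == l then unphase q * B1 l j' else B1 i j').
pose r := Num.sqrt (cmod p ^+ 2 + cmod q ^+ 2).
have cq : 0 < cmod q by rewrite lt_neqAle cmod_ge0 eq_sym cmod_eq0 q0.
have r2 : r ^+ 2 = cmod p ^+ 2 + cmod q ^+ 2 by rewrite sqr_sqrtr// addr_ge0 ?sqr_ge0.
have r0 : r != 0.
  by rewrite sqrtr_eq0 -ltNge ltr_wpDl ?sqr_ge0// exprn_gt0.
have cs : (cmod p / r) ^+ 2 + (cmod q / r) ^+ 2 = 1.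
  by rewrite !expr_div_n -mulrDl -r2 divff// expf_neq0.
have lk : l != k by rewrite eq_sym.
eexists; split.
- apply: gequiv_trans (gequiv_phase A k (cmod_unphase p)) _.
  apply: gequiv_trans (gequiv_phase B1 l (cmod_unphase q)) _.
  exact: gequiv_givens kl cs.
- rewrite !mxE !eqxx (negbTE lk) (negbTE kl) -/p -/q !unphaseM.
  rewrite -!rmorphM -rmorphN -rmorphD /=; congr (_%:C).
  by field.
- by move=> i ik il j'; rewrite !mxE (negbTE ik) (negbTE il).
- move=> j' pk pl; rewrite !mxE !eqxx (negbTE lk) (negbTE kl) pk pl.
  by rewrite !mulr0 oppr0 !addr0.
Qed.

End Contractions.

Section Isometries.
Context d (Sigma : measurableType d) (R : realType) (P : probability Sigma R).
Context (gamma : nat -> Sigma -> R[i]) (X : normedModType R[i]).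
Hypothesis hgamma : iid_complex_gaussian P gamma.
Local Notation C := R[i].
Local Notation gequiv := (@gequiv _ _ _ P gamma X).

Definition isometric n m (A : 'M[C]_(n, m)) : Prop :=
  forall j l, gram A j l = (j == l)%:R.

Definition std_cols n m (A : 'M[C]_(n, m)) (k : nat) : Prop :=
  forall (i : 'I_n) (j : 'I_m), (j < k)%N -> A i j = (i == j :> nat)%:R.

(** Rotations against row [k] clear column [k] below the diagonal. Orthogonality to the earlier
    standard columns clears it above, so the diagonal entry has modulus one and a phase turns it
    into [1]. *)
Lemma std_cols_step n m (A : 'M[C]_(n, m)) (k : nat) : (k < m)%N -> (m <= n)%N ->
  isometric A -> std_cols A k -> exists2 B, gequiv A B & std_cols B k.+1.
Proof.
move=> km mn iA sA; pose kc := Ordinal km; pose kr := Ordinal (leq_trans km mn).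
(* [t] is detached from [n] so that the rows below [t] can be cleared one by one, by induction on
   [t]. *)
have [t le_nt] : exists t, (n <= t)%N by exists n.
have [B [AB sB Bz]] : exists B, [/\ gequiv A B, std_cols B k &
    forall l : 'I_n, (k < l)%N -> (l < t)%N -> B l kc = 0].
  elim: t {le_nt} => [|t [B [AB sB Bz]]].
    by exists A; split => //; exact: gequiv_refl.
  have [tn|nt] := ltnP t n; last first.
    exists B; split => // l kl lt; apply: Bz => //.
    by rewrite (leq_trans (ltn_ord l)).
  have [tk|kt] := leqP t k.
    exists B; split => // l kl lt; apply: Bz => //.
    by have := leq_ltn_trans tk kl; rewrite ltnNge -ltnS lt.
  pose lt := Ordinal tn.
  have krl : kr != lt by rewrite -val_eqE /= neq_ltn kt.
  have [B' [BB' B'l B'o B'z]] := gequiv_kill X hgamma B kc krl.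
  exists B'; split.
  - exact: gequiv_trans AB BB'.
  - move=> i j jk.
    have [||z1 z2] := B'z j.
    + by rewrite sB//= gtn_eqF.
    + by rewrite sB//= gtn_eqF// (ltn_trans jk).
    have [->|ik] := eqVneq i kr; first by rewrite z1 /= gtn_eqF.
    have [->|il] := eqVneq i lt; first by rewrite z2 /= gtn_eqF// (ltn_trans jk).
    by rewrite B'o// sB.
  - move=> l kl lt1; have [->//|ll] := eqVneq l lt.
    rewrite B'o//; last by rewrite -val_eqE /= gtn_eqF.
    by apply: Bz => //; rewrite ltn_neqAle -ltnS lt1 andbT; exact: ll.
have iB : isometric B by move=> j l; rewrite -AB.2.
have Boff i : i != kr -> B i kc = 0.
  move=> ik; have [ki|] := ltnP k i; first by rewrite Bz// (leq_trans (ltn_ord i)).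
  rewrite leq_eqVlt => /orP[/eqP ik'|ik'].
    by case/negP: ik; rewrite -val_eqE /= ik'.
  have im : (i < m)%N := ltn_trans ik' km.
  have := iB (Ordinal im) kc; rewrite -val_eqE /= ltn_eqF// /gram (bigD1 i)//=.
  rewrite sB// eqxx conjC1 mul1r big1 ?addr0// => l li.
  by rewrite sB//= val_eqE (negbTE li) conjC0 mul0r.
have Bon : cmod (B kr kc) = 1.
  apply: (@pexpIrn _ 2) => //; rewrite ?nnegrE ?cmod_ge0//.
  rewrite expr1n; apply: complexI; rewrite cmod_sqrC mulrC.
  have := iB kc kc; rewrite eqxx /gram (bigD1 kr)//= big1 ?addr0// => l lk.
  by rewrite Boff// mulr0.
eexists; first apply: gequiv_trans AB (gequiv_phase X hgamma B kr (cmod_unphase (B kr kc))).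
move=> i j; rewrite ltnS leq_eqVlt mxE => /orP[/eqP jk|jk].
  have -> : j = kc by exact/val_inj.
  case: eqVneq => [->|ik]; first by rewrite unphaseM Bon /= eqxx.
  by rewrite Boff// /= -[k]/(val kr) val_eqE (negbTE ik).
case: eqVneq => [->|ik]; last by rewrite sB.
by rewrite (sB kr j jk) /= gtn_eqF// mulr0.
Qed.

(** Once all columns are standard, the matrix only pads [z] with zeros, and the sum involves the
    first [m] Gaussian variables alone. *)
Lemma gint_isometric n m (A : 'M[C]_(n, m)) (z : 'I_m -> X) : (m <= n)%N ->
  isometric A -> gint P gamma (mxapp A z) = gint P gamma z.
Proof.
move=> mn iA.
have [B AB sB] : exists2 B, gequiv A B & std_cols B m.
  suff h k : (k <= m)%N -> exists2 B, gequiv A B & std_cols B k by exact: h.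
  elim: k => [|k IH] km.
    by exists A => //; exact: gequiv_refl.
  have [B AB sB] := IH (ltnW km).
  have iB : isometric B by move=> j l; rewrite -AB.2.
  have [D BD sD] := std_cols_step km mn iB sB.
  by exists D => //; exact: gequiv_trans AB BD.
rewrite AB.1; apply: eq_integral => w _; congr ((rnorm _ ^+ 2)%:E).
rewrite /mxapp; under eq_bigr do rewrite scaler_sumr.
rewrite exchange_big /=; apply: eq_bigr => j _.
rewrite (bigD1 (widen_ord mn j))//= big1 ?addr0 => [|i ij].
  by rewrite sB// eqxx scale1r.
by rewrite sB// (_ : (_ == _) = false) ?scale0r ?scaler0//; exact/negbTE.
Qed.

End Isometries.

(** * Completion of a contraction to an isometry *)

Section Defect.
Context (R : realType).
Local Notation C := R[i].
Local Open Scope sesquilinear_scope.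

Definition contraction n m (A : 'M[C]_(n, m)) : Prop :=
  forall y : 'I_m -> C,
    \sum_i cmod (\sum_j A i j * y j) ^+ 2 <= \sum_j cmod (y j) ^+ 2.

(** The Hermitian matrix [H = 1 - A^* A] is nonnegative because [A] contracts. If [U] diagonalizes
    it, the diagonal of square roots of eigenvalues times [U] is a matrix [D] with [D^* D = H]. *)
Lemma defect_exists n m (A : 'M[C]_(n, m)) : contraction A ->
  exists D : 'M[C]_m, forall j l, gram A j l + gram D j l = (j == l)%:R.
Proof.
move=> cA.
pose H : 'M[C]_m := 1%:M - A^t* *m A.
have gramE p (B : 'M[C]_(p, m)) j l : gram B j l = (B^t* *m B) j l.
  by rewrite mxE; apply: eq_bigr => i _; rewrite !mxE.
have Hh : H \is hermsymmx.
  apply/is_hermitianmxP; rewrite expr0 scale1r.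
  by rewrite /H linearB /= map_mxB trmx1 map_mx1 trmx_mul map_mxM trmxCK.
have HE := orthomx_spectralP (hermitian_normalmx Hh).
set U := spectralmx H in HE; set sp := spectral_diag H in HE.
have Uu : U \is unitarymx := spectral_unitarymx H.
rewrite invmx_unitary// in HE.
(* With [w] the adjoint of row [j] of [U], the eigenvalue is the square norm of [w] minus that of
   [A w]. *)
have sp0 j : 0 <= sp 0 j.
  have UH : U *m H *m U^t* = diag_mx sp.
    rewrite {1}HE !mulmxA (unitarymxP Uu) mul1mx -mulmxA (unitarymxP Uu).
    by rewrite mulmx1.
  have <- : (U *m H *m U^t*) j j = sp 0 j by rewrite UH mxE eqxx mulr1n.
  pose w : 'cV[C]_m := (row j U)^t*.
  have -> : (U *m H *m U^t*) j j = (w^t* *m w - (A *m w)^t* *m (A *m w)) 0 0.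
    rewrite trmx_mul map_mxM /w trmxCK.
    have -> : (U *m H *m U^t*) j j = (row j U *m H *m (row j U)^t*) 0 0.
      rewrite -row_mul mxE [RHS]mxE; apply: eq_bigr => i _.
      by congr (_ * _); [rewrite [RHS]mxE|rewrite !mxE].
    by rewrite /H mulmxBr mulmx1 mulmxBl !mulmxA.
  have sq p (B : 'cV[C]_p) : (B^t* *m B) 0 0 = (\sum_i cmod (B i 0) ^+ 2)%:C.
    rewrite mxE rmorph_sum; apply: eq_bigr => i _ /=.
    by rewrite cmod_sqrC !mxE mulrC.
  rewrite mxE [X in _ + X]mxE !sq subr_ge0 lecR.
  apply: le_trans (cA (fun j => w j 0)).
  by rewrite le_eqVlt; apply/orP; left; apply/eqP; apply: eq_bigr => i _; rewrite mxE.
exists (diag_mx (map_mx sqrtC sp) *m U) => j l.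
rewrite !gramE -[RHS](_ : (A^t* *m A + H) j l = _); last first.
  by rewrite addrC subrK mxE.
rewrite [RHS]mxE; congr (_ + _); congr (fun_of_matrix _ j l).
rewrite [RHS]HE trmx_mul map_mxM mulmxA; congr (_ *m _).
rewrite -mulmxA; congr (_ *m _).
rewrite tr_diag_mx map_diag_mx mulmx_diag; congr diag_mx.
apply/rowP => i; rewrite !mxE.
have sr : (sqrtC (sp 0 i))^* = sqrtC (sp 0 i).
  by apply/CrealP; rewrite ger0_real// sqrtC_ge0.
rewrite [X in X * _](_ : _ = (sqrtC (sp 0 i))^*)// sr.
by rewrite -expr2 sqrtCK.
Qed.
End Defect.

(** * The ideal property *)

Section IdealProperty.
Context d (Sigma : measurableType d) (R : realType) (P : probability Sigma R).
Context (gamma : nat -> Sigma -> R[i]) (X : normedModType R[i]).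
Hypothesis hgamma : iid_complex_gaussian P gamma.
Local Notation C := R[i].

(** Stacking the defect under [A] gives an isometry, and discarding its lower rows can only decrease
    the Gaussian integral. *)
Lemma gint_contraction n m (A : 'M[C]_(n, m)) (z : 'I_m -> X) : contraction A ->
  (gint P gamma (mxapp A z) <= gint P gamma z)%E.
Proof.
move=> /defect_exists[D AD]; pose S := col_mx A D.
have iS : isometric S.
  move=> j l; rewrite -AD /gram big_split_ord /=; congr (_ + _).
    by apply: eq_bigr => i _; rewrite !col_mxEu.
  by apply: eq_bigr => i _; rewrite !col_mxEd.
rewrite -(gint_isometric hgamma z (leq_addl n m) iS).
apply: le_trans (gint_restrict hgamma _ (fun i => i < n)%N).
rewrite le_eqVlt; apply/orP; left; apply/eqP; apply: eq_integral => w _.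
congr ((rnorm _ ^+ 2)%:E); rewrite big_split_ord /= [X in _ = _ + X]big1 ?addr0.
  apply: eq_bigr => i _; rewrite ltn_ord; congr (_ *: _).
  by apply: eq_bigr => j _; rewrite col_mxEu.
by move=> i _; rewrite ltnNge leq_addr scaler0.
Qed.

(** Allows Gaussian sums over index types such as dependent pairs, through their enumeration. *)
Definition gintf (K : finType) (x : K -> X) : \bar R :=
  gint P gamma (fun i : 'I_#|K| => x (enum_val i)).

Lemma gintf_ord n (x : 'I_n -> X) : gintf x = gint P gamma x.
Proof.
apply: eq_integral => w _; congr ((rnorm _ ^+ 2)%:E).
have := @big_enum_val _ _ _ _ 'I_n (fun i => gamma i w *: x i).
rewrite (eq_bigl xpredT)// => ->; apply: eq_bigr => i _.
by rewrite enum_val_ord.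
Qed.

Lemma gintfZ (K : finType) (c : R) (x : K -> X) :
  (gintf (fun k => (c%:C *: x k)%R) <= (c ^+ 2)%:E * gintf x)%E.
Proof.
have := @gint_comb _ _ _ _ _ _ hgamma _ (fun i : 'I_#|K| => (c%:C *: x (enum_val i))%R)
  (fun i : 'I_#|K| => x (enum_val i)) (fun i : 'I_#|K| => x (enum_val i)) (c ^+ 2) 0.
rewrite mul0e adde0; apply => //; first exact: sqr_ge0.
move=> w; rewrite mul0r addr0; under eq_bigr do rewrite scalerA mulrC -scalerA.
by rewrite -scaler_sumr rnormZ cmod_real exprMn real_normK ?num_real.
Qed.

Lemma gintf_bounded (K L : finType) (A : K -> L -> C) (c : R) (z : L -> X) :
  0 < c ->
  (forall y : L -> C, \sum_k cmod (\sum_l A k l * y l) ^+ 2 <=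
    c ^+ 2 * \sum_l cmod (y l) ^+ 2) ->
  (gintf (fun k => (\sum_l A k l *: z l)%R) <= (c ^+ 2)%:E * gintf z)%E.
Proof.
move=> c0 Ac.
pose B : 'M[C]_(#|K|, #|L|) :=
  \matrix_(i, j) ((c^-1)%:C * A (enum_val i) (enum_val j)).
have sumL (V : nmodType) (F : L -> V) : \sum_l F l = \sum_(j < #|L|) F (enum_val j).
  by rewrite -big_enum_val.
have sumK (F : K -> R) : \sum_k F k = \sum_(j < #|K|) F (enum_val j).
  by rewrite -big_enum_val.
have cB : contraction B.
  move=> y; pose y' l := y (enum_rank l).
  have := Ac y'; rewrite sumK sumL.
  under [X in _ <= _ * X]eq_bigr do rewrite /y' enum_valK.
  rewrite mulrC -ler_pdivrMr ?exprn_gt0// => h; apply: le_trans h.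
  rewrite mulr_suml le_eqVlt; apply/orP; left; apply/eqP; apply: eq_bigr => i _.
  have -> : \sum_j B i j * y j = (c^-1)%:C * \sum_l A (enum_val i) l * y' l.
    rewrite sumL mulr_sumr; apply: eq_bigr => j _.
    by rewrite mxE /y' enum_valK mulrA.
  rewrite cmodM cmod_real exprMn real_normK ?num_real//.
  by rewrite exprVn mulrC.
apply: (@le_trans _ _ (gintf (fun k => c%:C *: (\sum_l ((c^-1)%:C * A k l) *: z l)))).
  rewrite le_eqVlt; apply/orP; left; apply/eqP; congr gintf; apply/funext => k.
  rewrite scaler_sumr; apply: eq_bigr => l _.
  by rewrite scalerA mulrA -rmorphM /= divff ?mul1r// gt_eqF.
apply: le_trans (gintfZ _ _) _; rewrite lee_wpmul2l// ?lee_fin ?sqr_ge0//.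
apply: le_trans (gint_contraction (fun j => z (enum_val j)) cB).
rewrite le_eqVlt; apply/orP; left; apply/eqP; congr gint; apply/funext => i.
by rewrite sumL; apply: eq_bigr => j _; rewrite mxE.
Qed.

(** Gamma-boundedness with both sides squared, so that estimates chain without square roots. *)
Definition sq_bounded (S : set (X -> X)) (c : R) : Prop :=
  forall N (T : 'I_N -> X -> X) (x : 'I_N -> X), (forall n, S (T n)) ->
    (gint P gamma (fun n => T n (x n)) <= c%:E * gint P gamma x)%E.

Lemma gamma_boundedP (S : set (X -> X)) :
  gamma_bounded P gamma S <-> exists2 c : R, 0 <= c & sq_bounded S c.
Proof.
have G0 N (x : 'I_N -> X) := gint_ge0 P gamma x.
have GE N (x : 'I_N -> X) : Gnorm P gamma x = (gint P gamma x `^ 2^-1)%E by [].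
split=> [[C C0 h]|[c c0 h]].
  exists (C ^+ 2); first exact: sqr_ge0.
  move=> N T x ST; have := h N T x ST; rewrite !GE => hh.
  have := @gt0_ler_poweR R 2 (ler0n _ _) _ _ _ _ hh.
  rewrite !in_itv /= !leey !andbT poweR_ge0 mule_ge0 ?poweR_ge0 ?lee_fin//.
  move=> /(_ isT isT).
  rewrite poweRM ?lee_fin ?poweR_ge0// -!poweRrM mulVf// !poweRe1//.
  by rewrite poweR_EFin powR_mulrn.
exists (Num.sqrt c); first exact: sqrtr_ge0.
move=> N T x ST; rewrite !GE.
have -> : ((Num.sqrt c)%:E = c%:E `^ 2^-1)%E by rewrite poweR_EFin -powR12_sqrt.
rewrite -poweRM ?lee_fin//; apply: gt0_ler_poweR => //.
- by rewrite in_itv/= leey G0.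
- by rewrite in_itv/= leey mule_ge0 ?lee_fin.
exact: h.
Qed.

Lemma gintf_sq_bounded (S : set (X -> X)) c (K : finType) (T : K -> X -> X)
    (x : K -> X) : sq_bounded S c -> (forall k, S (T k)) ->
  (gintf (fun k => T k (x k)) <= c%:E * gintf x)%E.
Proof.
by move=> Sc ST; exact: (Sc _ (fun i => T (enum_val i)) (fun i => x (enum_val i))).
Qed.

End IdealProperty.

(** * Polynomials of operators with a factored coefficient matrix *)

Section PolyOp.
Context (R : realType) (X : normedModType R[i]) (T : {linear X -> X}).
Implicit Types p q : {poly R[i]}.

Lemma poly_op_widen p x n : (size p <= n)%N ->
  poly_op p T x = \sum_(i < n) p`_i *: iter i T x.
Proof.
move=> pn; rewrite /poly_op (big_ord_widen _ (fun i => p`_i *: iter i T x) pn).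
rewrite big_mkcond /=; apply: eq_bigr => i _; case: ltnP => // ip.
by rewrite nth_default// scale0r.
Qed.

Lemma poly_opD p q x : poly_op (p + q) T x = poly_op p T x + poly_op q T x.
Proof.
pose n := maxn (size p) (size q).
rewrite (@poly_op_widen _ _ n) ?size_polyD// (@poly_op_widen p _ n) ?leq_maxl//.
rewrite (@poly_op_widen q _ n) ?leq_maxr// -big_split; apply: eq_bigr => i _ /=.
by rewrite coefD scalerDl.
Qed.

Lemma poly_opZXn (a : R[i]) n x : poly_op (a *: 'X^n) T x = a *: iter n T x.
Proof.
rewrite (@poly_op_widen _ _ n.+1).
  rewrite big_ord_recr /= coefZ coefXn eqxx mulr1 big1 ?add0r// => i _.
  by rewrite coefZ coefXn ltn_eqF// mulr0 scale0r.
by rewrite (leq_trans (size_scale_leq _ _))// size_polyXn.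
Qed.

Lemma poly_op_sum (J : Type) (r : seq J) (F : J -> {poly R[i]}) x :
  poly_op (\sum_(j <- r) F j) T x = \sum_(j <- r) poly_op (F j) T x.
Proof.
elim/big_rec2: _ => [|j y p _ <-]; last exact: poly_opD.
by rewrite /poly_op size_poly0 big_ord0.
Qed.

Lemma iter_linear_sum n (J : Type) (r : seq J) (a : J -> R[i]) (y : J -> X) :
  iter n T (\sum_(j <- r) a j *: y j) = \sum_(j <- r) a j *: iter n T (y j).
Proof.
elim: n => // n IH; rewrite iterS IH linear_sum; apply: eq_bigr => j _.
by rewrite linearZ.
Qed.

End PolyOp.

Record factored (R : realType) := Factored {
  fsize : nat;
  frow : 'I_fsize -> R[i];
  fmid : 'I_fsize -> 'I_fsize -> R[i];
  fcol : 'I_fsize -> R[i];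
  fexp1 : 'I_fsize -> nat;
  fexp2 : 'I_fsize -> nat }.

Definition fpoly (R : realType) (a : factored R) : {poly R[i]} :=
  \sum_i \sum_j (frow i * fmid i j * @fcol _ a j) *: 'X^(fexp1 i + fexp2 j).

Definition fbounded (R : realType) (c : R) (a : factored R) : Prop :=
  [/\ \sum_i cmod (@frow _ a i) ^+ 2 <= c ^+ 2,
      \sum_i cmod (@fcol _ a i) ^+ 2 <= c ^+ 2 &
      forall y : 'I_(fsize a) -> R[i],
        \sum_i cmod (\sum_j fmid i j * y j) ^+ 2 <= \sum_j cmod (y j) ^+ 2].

Lemma cauchy_schwarz_cmod (R : realType) (I : finType) (a b : I -> R[i]) :
  cmod (\sum_i a i * b i) ^+ 2 <=
  (\sum_i cmod (a i) ^+ 2) * (\sum_i cmod (b i) ^+ 2).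
Proof.
set A := \sum_i cmod (a i) ^+ 2; set B := \sum_i cmod (b i) ^+ 2.
set S := \sum_i cmod (a i) * cmod (b i).
have S0 : 0 <= S by apply: sumr_ge0 => i _; rewrite mulr_ge0 ?cmod_ge0.
have A0 : 0 <= A by apply: sumr_ge0 => i _; rewrite sqr_ge0.
apply: (@le_trans _ _ (S ^+ 2)).
  rewrite ler_pXn2r ?nnegrE ?cmod_ge0//.
  by apply: le_trans (ler_cmod_sum _ _ _) _; apply: ler_sum => i _; rewrite cmodM.
have h (t : R) : 0 <= t ^+ 2 * A - 2 * t * S + B.
  rewrite /A /S /B !mulr_sumr -sumrB -big_split; apply: sumr_ge0 => i _ /=.
  rewrite [leRHS](_ : _ = (t * cmod (a i) - cmod (b i)) ^+ 2) ?sqr_ge0//; ring.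
have [A00|A1] := eqVneq A 0.
  have a0 i : cmod (a i) = 0.
    have /eqP := A00; rewrite psumr_eq0; last by move=> ? _; rewrite sqr_ge0.
    by move=> /allP/(_ i); rewrite mem_index_enum /= sqrf_eq0 => /(_ isT)/eqP.
  by rewrite /S big1 ?expr0n ?A00 ?mul0r// => i _; rewrite a0 mul0r.
have Agt : 0 < A by rewrite lt_neqAle eq_sym A1.
(* [S / A] minimizes the quadratic in [h]. *)
have := h (S / A).
have -> : (S / A) ^+ 2 * A - 2 * (S / A) * S + B = B - S ^+ 2 / A by field.
by rewrite subr_ge0 ler_pdivrMr// mulrC.
Qed.

Section GammaBoundedFactored.
Context d (Sigma : measurableType d) (R : realType) (P : probability Sigma R).
Context (gamma : nat -> Sigma -> R[i]) (X : normedModType R[i]).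
Hypothesis hgamma : iid_complex_gaussian P gamma.
Context (T : {linear X -> X}).
Local Notation C := R[i].

(** Power gamma-boundedness concerns exponents from [1] on, while a factored polynomial also uses
    the exponent [0]. The indices with exponent [0] are split off, and adding the two parts costs a
    factor [2] on each. *)
Lemma sq_bounded_powers0 c : 0 <= c ->
  sq_bounded P gamma [set S : X -> X | exists2 n : nat, (1 <= n)%N & S = iter n T] c ->
  sq_bounded P gamma [set S : X -> X | exists n : nat, S = iter n T] (2 * c + 2).
Proof.
move=> c0 h N U x /choice[m mE].
pose J n := (0 < m n)%N.
pose x' n := if J n then x n else 0.
(* Where the exponent is [0], the dummy exponent [1] is applied to the zero vector. *)
have UE : (fun n => U n (x n)) =
    (fun n => iter (maxn 1 (m n)) T (x' n) + (if ~~ J n then x n else 0)).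
  apply/funext => n; rewrite mE /x' /J; case: (posnP (m n)) => [->|m0] /=.
    by rewrite linear0 add0r.
  by rewrite addr0 (maxn_idPr m0).
rewrite UE; apply: le_trans (gintD hgamma _ _) _.
have h1 : (gint P gamma (fun n => iter (maxn 1 (m n)) T (x' n)) <=
    c%:E * gint P gamma x')%E.
  by apply: (h N (fun n => iter (maxn 1 (m n)) T)) => n; exists (maxn 1 (m n)); rewrite ?leq_maxl.
have h2 : (gint P gamma x' <= gint P gamma x)%E := gint_restrict hgamma x J.
have h3 := gint_restrict hgamma x (predC J).
rewrite (EFinD (2 * c)) (EFinM 2 c) ge0_muleDl ?lee_fin ?mulr_ge0// -muleA; apply: leeD.
  rewrite lee_wpmul2l ?lee_fin//; apply: le_trans h1 _.
  by rewrite lee_wpmul2l ?lee_fin.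
by rewrite lee_wpmul2l ?lee_fin.
Qed.

(** Gamma-boundedness involves [N] different polynomials at once, so their factorizations are merged
    into one over the dependent pairs [L]. The block-diagonal matrices inherit the bound common to
    their blocks: row and column contribute [K ^+ 2] each, each diagonal of powers contributes [c],
    and the middle contributes [1]. *)
Lemma sq_bounded_factored c K : 0 <= c -> 0 < K ->
  sq_bounded P gamma [set S : X -> X | exists n : nat, S = iter n T] c ->
  sq_bounded P gamma
    [set S : X -> X | exists2 a : factored R, fbounded K a & S = poly_op (fpoly a) T]
    (K ^+ 2 * (c * (c * K ^+ 2))).
Proof.
move=> c0 K0 hT N S x hS.
have /choice[a aP] (n : 'I_N) : exists a : factored R,
    fbounded K a /\ S n = poly_op (fpoly a) T.
  by have [b ? ?] := hS n; exists b.
pose L := {n : 'I_N & 'I_(fsize (a n))}.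
(* [u], [v], [w], [z] are the successive images of [x] under the column, the inner powers, the
   middle matrix and the outer powers; [A] is the row that leads back to [N] entries. *)
pose u (k : L) : X := fcol (tagged k) *: x (tag k).
pose v (k : L) : X := iter (fexp2 (tagged k)) T (u k).
pose B (k l : L) : C :=
  if tag k == tag l then fmid (tagged k) (tagged_as k l) else 0.
pose w (k : L) : X := \sum_l B k l *: v l.
pose z (k : L) : X := iter (fexp1 (tagged k)) T (w k).
pose A (n : 'I_N) (k : L) : C := if tag k == n then frow (tagged k) else 0.
pose D (k : L) (n : 'I_N) : C := if tag k == n then fcol (tagged k) else 0.
have sumL (V : nmodType) (F : L -> V) :
    \sum_k F k = \sum_n \sum_(i : 'I_(fsize (a n))) F (Tagged (fun n => 'I_(fsize (a n))) i).
  by rewrite (@sig_big_dep _ _ _ _ _ xpredT (fun _ => xpredT)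
    (fun n i => F (Tagged (fun n => 'I_(fsize (a n))) i))); apply: eq_bigr => -[].
have sum1 (V : nmodType) (F : L -> V) (n : 'I_N) :
    (forall k, tag k != n -> F k = 0) ->
    \sum_k F k = \sum_(i : 'I_(fsize (a n))) F (Tagged (fun n => 'I_(fsize (a n))) i).
  move=> F0; rewrite sumL (bigD1 n)//= [X in _ + X]big1 ?addr0// => m mn.
  by rewrite big1// => i _; exact: F0.
have SE n : S n (x n) = \sum_k A n k *: z k.
  have [_ ->] := aP n.
  rewrite (sum1 _ _ n); last by move=> k kn; rewrite /A (negbTE kn) scale0r.
  rewrite /fpoly poly_op_sum; apply: eq_bigr => i _.
  rewrite /A /= eqxx /z /= poly_op_sum /w (sum1 _ _ n); last first.
    by move=> k kn; rewrite /B /= eq_sym (negbTE kn) scale0r.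
  rewrite iter_linear_sum scaler_sumr; apply: eq_bigr => j _.
  rewrite poly_opZXn /B /= eqxx tagged_asE /v /u /= iterD !scalerA.
  (* A sum with a single term turns [iter_linear_sum] into homogeneity of the iterates. *)
  have := iter_linear_sum T (fexp2 j) [:: tt] (fun=> fcol j) (fun=> x n).
  rewrite !big_seq1 => ->.
  have := iter_linear_sum T (fexp1 i) [:: tt] (fun=> fcol j) (fun=> iter (fexp2 j) T (x n)).
  by rewrite !big_seq1 => ->; rewrite scalerA.
have bz : (gint P gamma (fun n => S n (x n)) <= (K ^+ 2)%:E * gintf P gamma z)%E.
  rewrite -gintf_ord; under eq_fun do rewrite SE.
  apply: gintf_bounded => // y.
  rewrite sumL mulr_sumr; apply: ler_sum => n _.
  rewrite (sum1 _ _ n); last by move=> k kn; rewrite /A (negbTE kn) mul0r.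
  apply: le_trans (cauchy_schwarz_cmod _ _) _; rewrite ler_wpM2r//.
    by apply: sumr_ge0 => i _; rewrite sqr_ge0.
  have [[h _ _] _] := aP n; apply: le_trans h.
  by apply: ler_sum => i _; rewrite /A /= eqxx.
have zw : (gintf P gamma z <= c%:E * gintf P gamma w)%E.
  exact: (gintf_sq_bounded w hT (fun k => ex_intro _ (fexp1 (tagged k)) erefl)).
have wv : (gintf P gamma w <= gintf P gamma v)%E.
  rewrite -[leRHS]mul1e -[1%E](congr1 EFin (expr1n R 2)).
  apply: (gintf_bounded hgamma v (ltr01 : 0 < (1 : R)%R)%R) => y.
  rewrite expr1n mul1r !sumL; apply: ler_sum => n _.
  have [[_ _ hm] _] := aP n.
  apply: le_trans (hm (fun i => y (Tagged (fun n => 'I_(fsize (a n))) i))).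
  apply: ler_sum => i _.
  rewrite (sum1 _ _ n); last first.
    by move=> k kn; rewrite /B /= eq_sym (negbTE kn) mul0r.
  rewrite le_eqVlt; apply/orP; left; apply/eqP; congr (cmod _ ^+ 2).
  by apply: eq_bigr => j _; rewrite /B /= eqxx tagged_asE.
have vu : (gintf P gamma v <= c%:E * gintf P gamma u)%E.
  exact: (gintf_sq_bounded u hT (fun k => ex_intro _ (fexp2 (tagged k)) erefl)).
have ux : (gintf P gamma u <= (K ^+ 2)%:E * gint P gamma x)%E.
  have uE : u = fun k => \sum_n D k n *: x n.
    apply/funext => k; rewrite (bigD1 (tag k))//= big1 ?addr0 => [|n nk].
      by rewrite /D eqxx.
    by rewrite /D eq_sym (negbTE nk) scale0r.
  rewrite uE -gintf_ord; apply: gintf_bounded => // y.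
  rewrite sumL mulr_sumr; apply: ler_sum => n _.
  have [[_ h _] _] := aP n.
  apply: (@le_trans _ _ ((\sum_i cmod (@fcol _ (a n) i) ^+ 2) * cmod (y n) ^+ 2)).
    rewrite mulr_suml; apply: ler_sum => i _.
    rewrite (bigD1 n)//= big1 ?addr0 => [|m mn].
      by rewrite /D /= eqxx cmodM exprMn.
    by rewrite /D /= eq_sym (negbTE mn) mul0r.
  by rewrite ler_wpM2r ?sqr_ge0.
rewrite (EFinM (K ^+ 2)) (EFinM c (c * _)) (EFinM c (K ^+ 2)) -!muleA.
apply: le_trans bz _; rewrite lee_wpmul2l ?lee_fin ?sqr_ge0//.
apply: le_trans zw _; rewrite lee_wpmul2l ?lee_fin//.
apply: le_trans wv _; apply: le_trans vu _; rewrite lee_wpmul2l ?lee_fin//.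
Qed.
End GammaBoundedFactored.

(** * Integrals of complex functions over the circle *)

Section ComplexIntegral.
Context (R : realType).
Local Notation C := R[i].
Local Notation mu := (@lebesgue_measure R).
Implicit Types (f : R -> R) (g : R -> C) (a b c t : R).

Lemma continuous_epsP f : continuous f <->
  (forall t e, 0 < e -> exists2 d, 0 < d & forall s, `|s - t| < d -> `|f s - f t| < e).
Proof.
split=> [cf t e e0|h t].
  have /cvgrPdist_lt/(_ e e0)/nbhs_ballP[d d0 dP] := cf t.
  exists d => // s st; rewrite distrC; apply: dP.
  by rewrite /ball /= distrC.
apply/cvgrPdist_lt => e e0; have [d d0 dP] := h t e e0.
apply/nbhs_ballP; exists d => // s; rewrite /ball /= => st.
by rewrite distrC; apply: dP; rewrite distrC.
Qed.

(** Stated on the two parts because [cintegral] integrates them separately; [ccontP] recovers the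
    form with moduli. *)
Definition ccont g := continuous (fun t => complex.Re (g t)) /\
  continuous (fun t => complex.Im (g t)).

Lemma cmod_le_ReIm (z : C) : cmod z <= `|complex.Re z| + `|complex.Im z|.
Proof.
rewrite -(@ler_pXn2r _ 2)// ?nnegrE ?cmod_ge0 ?addr_ge0// cmod_sqr.
rewrite -(real_normK (num_real (complex.Re z))) -(real_normK (num_real (complex.Im z))).
by rewrite sqrrD lerD2r lerDl mulrn_wge0// mulr_ge0.
Qed.

Lemma ReB (z w : C) : complex.Re (z - w) = complex.Re z - complex.Re w.
Proof. by case: z w => [? ?] [? ?]. Qed.

Lemma ImB (z w : C) : complex.Im (z - w) = complex.Im z - complex.Im w.
Proof. by case: z w => [? ?] [? ?]. Qed.

Lemma ccontP g : ccont g <-> (forall t e, 0 < e ->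
  exists2 d, 0 < d & forall s, `|s - t| < d -> cmod (g s - g t) < e).
Proof.
split=> [[/continuous_epsP cR /continuous_epsP cI] t e e0|h].
  have e2 : 0 < e / 2 by rewrite divr_gt0.
  have [d1 d10 h1] := cR t _ e2; have [d2 d20 h2] := cI t _ e2.
  exists (Num.min d1 d2); first by rewrite lt_min d10.
  move=> s; rewrite lt_min => /andP[s1 s2]; apply: le_lt_trans (cmod_le_ReIm _) _.
  by rewrite ReB ImB [e]splitr ltrD// ?h1 ?h2.
split; apply/continuous_epsP => t e e0; have [d d0 dP] := h t e e0; exists d => // s /dP.
  by apply: le_lt_trans; rewrite -ReB ler_Re_cmod.
by apply: le_lt_trans; rewrite -ImB ler_Im_cmod.
Qed.

Lemma ccont_cst (z : C) : ccont (fun=> z).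
Proof. by split => t; exact: cvg_cst. Qed.

Lemma ccontD g1 g2 : ccont g1 -> ccont g2 -> ccont (fun t => g1 t + g2 t).
Proof.
move=> [r1 i1] [r2 i2]; split.
  by under eq_fun do rewrite ReD; move=> t; apply: cvgD; [exact: r1|exact: r2].
by under eq_fun do rewrite ImD; move=> t; apply: cvgD; [exact: i1|exact: i2].
Qed.

Lemma ccontM g1 g2 : ccont g1 -> ccont g2 -> ccont (fun t => g1 t * g2 t).
Proof.
move=> [r1 i1] [r2 i2]; split.
  under eq_fun do rewrite ReM; move=> t.
  by apply: cvgB; apply: cvgM; [exact: r1|exact: r2|exact: i1|exact: i2].
under eq_fun do rewrite ImM; move=> t.
by apply: cvgD; apply: cvgM; [exact: r1|exact: i2|exact: i1|exact: r2].
Qed.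

Lemma ccontN g : ccont g -> ccont (fun t => - g t).
Proof.
move=> /(ccontM (ccont_cst (-1))) h.
by under eq_fun do rewrite -mulN1r.
Qed.

Lemma ccontB g1 g2 : ccont g1 -> ccont g2 -> ccont (fun t => g1 t - g2 t).
Proof. by move=> h1 /ccontN; exact: ccontD. Qed.

Lemma ccontX g n : ccont g -> ccont (fun t => g t ^+ n).
Proof.
move=> cg; elim: n => [|n IH]; first exact: ccont_cst.
by under eq_fun do rewrite exprS; exact: ccontM.
Qed.

Lemma ccont_sum (I : Type) (s : seq I) (F : I -> R -> C) :
  (forall i, ccont (F i)) -> ccont (fun t => \sum_(i <- s) F i t).
Proof.
move=> cF; elim: s => [|i s IH].
  by under eq_fun do rewrite big_nil; exact: ccont_cst.
by under eq_fun do rewrite big_cons; exact: ccontD.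
Qed.

Lemma ccont_real f : continuous f -> ccont (fun t => (f t)%:C).
Proof. by move=> cf; split => // t; exact: cvg_cst. Qed.

Lemma ccontJ g : ccont g -> ccont (fun t => (g t)^*).
Proof.
move=> /ccontP h; apply/ccontP => t e e0; have [d d0 dP] := h t e e0.
by exists d => // s /dP; rewrite -rmorphB/= cmodJ.
Qed.

Lemma continuous_cmod g : ccont g -> continuous (fun t => cmod (g t)).
Proof.
move=> /ccontP h; apply/continuous_epsP => t e e0; have [d d0 dP] := h t e e0.
exists d => // s /dP; apply: le_lt_trans; rewrite ler_norml.
have := ler_cmodD (g s - g t) (g t); have := ler_cmodD (g t - g s) (g s).
by rewrite !subrK cmodB; lra.
Qed.

Lemma ccont_horner (p : {poly C}) g : ccont g -> ccont (fun t => p.[g t]).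
Proof.
move=> cg; under eq_fun do rewrite horner_coef.
by apply: ccont_sum => i; apply: ccontM; [exact: ccont_cst|exact: ccontX].
Qed.

Lemma continuous_integrable_itv f a b : continuous f ->
  mu.-integrable `[a, b] (EFin \o f).
Proof.
move=> cf; apply: continuous_compact_integrable; first exact: segment_compact.
by apply: continuous_subspaceT.
Qed.
#[local] Hint Extern 0 (_.-integrable _ _) =>
  solve [apply: continuous_integrable_itv => //] : core.

Lemma Rintegral_itv_cat f a b c : continuous f -> a <= b -> b <= c ->
  \int[mu]_(t in `[a, c]) f t =
  \int[mu]_(t in `[a, b]) f t + \int[mu]_(t in `[b, c]) f t.
Proof.
move=> cf ab bc.
have := @Rintegral_itvB R f (BLeft a) (BRight c) b (continuous_integrable_itv _ _ cf).
rewrite !bnd_simp => /(_ ab bc) /eqP; rewrite subr_eq => /eqP ->.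
rewrite addrC Rintegral_itv_obnd_cbnd//.
apply: integrableS (continuous_integrable_itv b c cf) => //.
exact: subset_itv_oc_cc.
Qed.

Lemma cintegralD a b g1 g2 : ccont g1 -> ccont g2 ->
  cintegral a b (fun t => g1 t + g2 t) = cintegral a b g1 + cintegral a b g2.
Proof.
move=> [r1 i1] [r2 i2]; rewrite /cintegral.
under [in LHS]eq_Rintegral do rewrite ReD.
under [X in _ +i* X = _]eq_Rintegral do rewrite ImD.
by rewrite !RintegralD//=; exact: continuous_integrable_itv.
Qed.

Lemma cintegralZ a b (z : C) g : ccont g ->
  cintegral a b (fun t => z * g t) = z * cintegral a b g.
Proof.
move=> [r i]; rewrite /cintegral; case: z => x y.
under [in LHS]eq_Rintegral do rewrite ReM /=.
under [X in _ +i* X = _]eq_Rintegral do rewrite ImM /=.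
have cM (k : R) f : continuous f -> continuous (fun t => k * f t).
  by move=> cf t; apply: cvgM; [exact: cvg_cst|exact: cf].
rewrite RintegralB//; try (apply: continuous_integrable_itv; exact: cM).
rewrite RintegralD//; try (apply: continuous_integrable_itv; exact: cM).
rewrite !RintegralZl//; exact: continuous_integrable_itv.
Qed.

Lemma cintegralB a b g1 g2 : ccont g1 -> ccont g2 ->
  cintegral a b (fun t => g1 t - g2 t) = cintegral a b g1 - cintegral a b g2.
Proof.
move=> c1 c2; rewrite cintegralD//; last exact: ccontN.
congr (_ + _); rewrite -mulN1r -cintegralZ//.
by congr cintegral; apply/funext => t; rewrite mulN1r.
Qed.

Lemma cintegral_sum a b (I : Type) (s : seq I) (F : I -> R -> C) :
  (forall i, ccont (F i)) ->
  cintegral a b (fun t => \sum_(i <- s) F i t) = \sum_(i <- s) cintegral a b (F i).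
Proof.
move=> cF; elim: s => [|i s IH].
  rewrite big_nil; under eq_fun do rewrite big_nil.
  by rewrite /cintegral /= !Rintegral_cst// !mul0r.
rewrite big_cons -IH -cintegralD//; last exact: ccont_sum.
by congr cintegral; apply/funext => t; rewrite big_cons.
Qed.

Lemma cintegral_cst a b (z : C) : a <= b ->
  cintegral a b (fun=> z) = (b - a)%:C * z.
Proof.
move=> ab; rewrite /cintegral !Rintegral_cst//= lebesgue_measure_itv /= lte_fin.
case: z => x y; case: ltP => [_|ba] /=; simpc; first by rewrite ![_ * (b - a)]mulrC.
have -> : b = a by lra.
by rewrite subrr !mul0r.
Qed.

Lemma cintegral_cat a b c g : ccont g -> a <= b -> b <= c ->
  cintegral a c g = cintegral a b g + cintegral b c g.
Proof.
by move=> [r i] ab bc; rewrite /cintegral !(Rintegral_itv_cat _ ab bc).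
Qed.

Lemma eq_cintegral a b g1 g2 : (forall t, a <= t <= b -> g1 t = g2 t) ->
  cintegral a b g1 = cintegral a b g2.
Proof.
move=> h; rewrite /cintegral; congr (_ +i* _); apply: eq_Rintegral => t;
by rewrite inE /= in_itv /= => /h ->.
Qed.

(* Rotating the integral onto the positive axis reduces to [Re g <= |g|]. *)
Lemma ler_cmod_cintegral a b g : ccont g ->
  cmod (cintegral a b g) <= \int[mu]_(t in `[a, b]) cmod (g t).
Proof.
move=> cg; set J := cintegral a b g.
have [->|J0] := eqVneq J 0.
  by rewrite cmod0; apply: Rintegral_ge0 => t _; exact: cmod_ge0.
pose u := J^* / (cmod J)%:C.
have cJ : (cmod J)%:C != 0 by rewrite (inj_eq (@complexI R) _ 0) cmod_eq0.
have uJ : u * J = (cmod J)%:C.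
  rewrite /u mulrAC [_ * J]mulrC -cmod_sqrC rmorphXn /= expr2 mulfK//.
have u1 : cmod u = 1.
  by rewrite cmodM cmodJ cmodV cmod_real ger0_norm ?cmod_ge0// divff// cmod_eq0.
have cug : ccont (fun t => u * g t) by apply: ccontM => //; exact: ccont_cst.
have -> : cmod J = \int[mu]_(t in `[a, b]) complex.Re (u * g t).
  have := cintegralZ a b u cg; rewrite -/J uJ => /(congr1 (@complex.Re R)) /= ->.
  by [].
apply: le_Rintegral => //.
- by apply: continuous_integrable_itv; exact: cug.1.
- by apply: continuous_integrable_itv; exact: continuous_cmod.
move=> t _; apply: le_trans (ler_norm _) _; apply: le_trans (ler_Re_cmod _) _.
by rewrite cmodM u1 mul1r.
Qed.

Lemma ler_cmod_cintegral_cst a b g (K : R) : ccont g -> a <= b ->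
  (forall t, a <= t <= b -> cmod (g t) <= K) ->
  cmod (cintegral a b g) <= (b - a) * K.
Proof.
move=> cg ab gK; apply: le_trans (ler_cmod_cintegral _ _ cg) _.
have -> : (b - a) * K = \int[mu]_(t in `[a, b]) K.
  rewrite Rintegral_cst//= lebesgue_measure_itv /= lte_fin mulrC.
  case: ltP => [_|ba] //=; have -> : b = a by lra.
  by rewrite subrr.
apply: le_Rintegral => //.
- by apply: continuous_integrable_itv; exact: continuous_cmod.
- by apply: continuous_integrable_itv => t; exact: cvg_cst.
Qed.

End ComplexIntegral.

Section Expi.
Context (R : realType).
Implicit Types t s : R.

Lemma cmod_expi t : cmod (expi t) = 1.
Proof.
apply: (@pexpIrn _ 2) => //; rewrite ?nnegrE ?cmod_ge0//.
by rewrite expr1n cmod_sqr /= cos2Dsin2.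
Qed.

Lemma cmod_i : cmod ('i : R[i]) = 1.
Proof.
apply: (@pexpIrn _ 2) => //; rewrite ?nnegrE ?cmod_ge0//.
by rewrite expr1n cmod_sqr /= expr0n expr1n add0r.
Qed.

Lemma expiD t s : expi (t + s) = expi t * expi s.
Proof. by apply/eqP; rewrite eq_complex /= cosD sinD eqxx /= addrC. Qed.

Lemma conj_ReIm (z : R[i]) : z^* = complex.Re z -i* complex.Im z.
Proof. by case: z. Qed.

Lemma expiN t : expi (- t) = (expi t)^*.
Proof. by rewrite conj_ReIm /expi cosN sinN. Qed.

Lemma expi0 : expi 0 = 1 :> R[i].
Proof. by rewrite /expi cos0 sin0. Qed.

Lemma expiX t n : expi t ^+ n = expi (n%:R * t).
Proof.
elim: n => [|n IH]; first by rewrite mul0r expi0.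
by rewrite exprS IH -expiD -[n.+1]addn1 natrD mulrDl mul1r addrC.
Qed.

Lemma expiJ t : (expi t)^* * expi t = 1.
Proof. by rewrite mulrC -cmod_sqrC cmod_expi expr1n. Qed.

Lemma expiJr t : expi t * (expi t)^* = 1.
Proof. by rewrite mulrC expiJ. Qed.

Lemma ccont_expi : ccont (@expi R).
Proof. by split; [exact: continuous_cos|exact: continuous_sin]. Qed.

Lemma expi_2pi : expi (2 * pi) = 1 :> R[i].
Proof. by rewrite /expi mulr_natl cos2pi sin2pi. Qed.

End Expi.

(** * Means over the circle and Fourier orthogonality *)

Section Mean.
Context (R : realType).
Local Notation C := R[i].
Local Notation mu := (@lebesgue_measure R).
Implicit Types (f : R -> R) (g : R -> C).

Definition mean g : C := ((2 * pi)^-1)%:C * cintegral 0 (2 * pi) g.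

Definition rmean f : R := (2 * pi)^-1 * \int[mu]_(t in `[0, 2 * pi]) f t.

Let pi2_gt0 : 0 < 2 * pi :> R.
Proof. by rewrite mulr_gt0// pi_gt0. Qed.

Lemma meanB g1 g2 : ccont g1 -> ccont g2 ->
  mean (fun t => g1 t - g2 t) = mean g1 - mean g2.
Proof. by move=> c1 c2; rewrite /mean cintegralB// mulrBr. Qed.

Lemma meanZ (z : C) g : ccont g -> mean (fun t => z * g t) = z * mean g.
Proof. by move=> cg; rewrite /mean cintegralZ// mulrCA. Qed.

Lemma mean_sum (I : Type) (s : seq I) (F : I -> R -> C) :
  (forall i, ccont (F i)) ->
  mean (fun t => \sum_(i <- s) F i t) = \sum_(i <- s) mean (F i).
Proof. by move=> cF; rewrite /mean cintegral_sum// mulr_sumr. Qed.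

Lemma mean_cst (z : C) : mean (fun=> z) = z.
Proof.
rewrite /mean cintegral_cst ?subr0 ?ltW// mulrA -rmorphM /= mulVf ?mul1r//.
by rewrite gt_eqF.
Qed.

Lemma eq_mean g1 g2 : g1 =1 g2 -> mean g1 = mean g2.
Proof. by move=> /funext ->. Qed.

Lemma mean_real f : continuous f -> mean (fun t => (f t)%:C) = (rmean f)%:C.
Proof.
move=> cf; rewrite /mean /cintegral /= Rintegral_cst//= mul0r.
by rewrite rmorphM.
Qed.

Lemma ler_cmod_mean g : ccont g -> cmod (mean g) <= rmean (fun t => cmod (g t)).
Proof.
move=> cg; rewrite /mean /rmean cmodM cmod_real ger0_norm ?invr_ge0 ?(ltW pi2_gt0)//.
by rewrite ler_wpM2l ?invr_ge0 ?(ltW pi2_gt0)// ler_cmod_cintegral.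
Qed.

Lemma ler_rmean f1 f2 : continuous f1 -> continuous f2 ->
  (forall t, 0 <= t <= 2 * pi -> f1 t <= f2 t) -> rmean f1 <= rmean f2.
Proof.
move=> c1 c2 h; apply: ler_wpM2l; [by rewrite invr_ge0 ltW|]; apply: le_Rintegral => //;
exact: continuous_integrable_itv.
Qed.

Lemma rmeanD f1 f2 : continuous f1 -> continuous f2 ->
  rmean (fun t => f1 t + f2 t) = rmean f1 + rmean f2.
Proof.
move=> c1 c2; rewrite /rmean RintegralD ?mulrDr//; exact: continuous_integrable_itv.
Qed.

Lemma rmeanZ (k : R) f : continuous f -> rmean (fun t => k * f t) = k * rmean f.
Proof.
move=> cf; rewrite /rmean RintegralZl ?mulrA 1?[k * _]mulrC//.
exact: continuous_integrable_itv.
Qed.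

Lemma rmean_cst (k : R) : rmean (fun=> k) = k.
Proof. by apply: complexI; rewrite -mean_real ?mean_cst// => t; exact: cvg_cst. Qed.

Lemma ler_cmod_mean_cst g (K : R) : ccont g ->
  (forall t, 0 <= t <= 2 * pi -> cmod (g t) <= K) -> cmod (mean g) <= K.
Proof.
move=> cg h; apply: le_trans (ler_cmod_mean cg) _; rewrite -[leRHS]rmean_cst.
apply: ler_rmean => //; first exact: continuous_cmod.
by move=> t; exact: cvg_cst.
Qed.

Lemma meanJ g : ccont g -> mean (fun t => (g t)^*) = (mean g)^*.
Proof.
move=> [r i]; rewrite /mean rmorphM /=; congr (_ * _).
  by rewrite [RHS]conjc_real.
rewrite conj_ReIm /cintegral /=; congr (_ +i* _).
  by apply: eq_Rintegral => t _; rewrite conj_ReIm.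
rewrite -mulN1r -RintegralZl//; last exact: continuous_integrable_itv.
by apply: eq_Rintegral => t _; rewrite conj_ReIm mulN1r.
Qed.

Lemma mean_expi_mul n : (0 < n)%N -> mean (fun t => expi t ^+ n) = 0.
Proof.
move=> n0; rewrite /mean.
have nr : n%:R != 0 :> R by rewrite pnatr_eq0 -lt0n.
have c_lin : continuous (fun t : R => n%:R * t).
  by move=> t; apply: cvgM; [exact: cvg_cst|exact: cvg_id].
have FTC (f F : R -> R) : continuous f -> (forall t, is_derive t (1 : R) F (f t)) ->
    \int[mu]_(t in `[0, 2 * pi]) f t = F (2 * pi) - F 0.
  move=> cf dF.
  rewrite /Rintegral (@continuous_FTC2 _ f F)//.
  - by apply: continuous_subspaceT.
  - have cF : continuous F.
      by move=> t; apply/differentiable_continuous/derivable1_diffP.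
    split.
    + by move=> t _.
    + by apply: cvg_at_right_filter; exact: cF.
    + by apply: cvg_at_left_filter; exact: cF.
  - by move=> t _; rewrite derive1E derive_val.
under eq_fun do rewrite expiX.
rewrite /cintegral /expi /=.
have dl (t : R) : is_derive t (1 : R) (fun u : R => n%:R * u) n%:R.
  have h := is_deriveZ n%:R (is_derive_id t (1 : R)).
  by rewrite /GRing.scale /= mulr1 in h.
have c1 : continuous (fun t : R => cos (n%:R * t)).
  by move=> t; apply: continuous_comp; [exact: c_lin|exact: continuous_cos].
have d1 t : is_derive t (1 : R) (fun t => n%:R^-1 * sin (n%:R * t)) (cos (n%:R * t)).
  have h := is_deriveZ n%:R^-1 (is_derive1_comp (is_derive_sin (n%:R * t)) (dl t)).
  by rewrite /GRing.scale /= mulrCA mulVf// mulr1 in h.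
have c2 : continuous (fun t : R => sin (n%:R * t)).
  by move=> t; apply: continuous_comp; [exact: c_lin|exact: continuous_sin].
have d2 t : is_derive t (1 : R) (fun t => - n%:R^-1 * cos (n%:R * t)) (sin (n%:R * t)).
  have h := is_deriveZ (- n%:R^-1) (is_derive1_comp (is_derive_cos (n%:R * t)) (dl t)).
  by rewrite /GRing.scale /= mulrCA !mulNr mulVf// mulrN1 opprK in h.
rewrite (FTC _ _ c1 d1) (FTC _ _ c2 d2).
have := expiX (2 * pi : R) n; rewrite expi_2pi expr1n => /eqP.
rewrite eq_complex /= => /andP[/eqP <- /eqP <-].
by rewrite !mulr0 sin0 cos0 mulr0 !subrr mulr0.
Qed.

Lemma mean_expi a b :
  mean (fun t => expi t ^+ a * (expi t)^* ^+ b) = (a == b)%:R.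
Proof.
have key n m : (m <= n)%N ->
    mean (fun t => expi t ^+ n * (expi t)^* ^+ m) = (n == m)%:R.
  move=> mn; have -> : (fun t : R => expi t ^+ n * (expi t)^* ^+ m) =
      fun t => expi t ^+ (n - m).
    apply/funext => t; rewrite -{1}(subnK mn) exprD -mulrA -exprMn expiJr.
    by rewrite expr1n mulr1.
  move: mn; rewrite leq_eqVlt => /orP[/eqP ->|mn].
    by rewrite subnn eqxx; exact: mean_cst.
  by rewrite mean_expi_mul ?subn_gt0// gtn_eqF.
case: (leqP b a) => [|/ltnW ab]; first exact: key.
have := key _ _ ab; rewrite eq_sym => h.
have -> : (fun t : R => expi t ^+ a * (expi t)^* ^+ b) =
    fun t => (expi t ^+ b * (expi t)^* ^+ a)^*.
  by apply/funext => t; rewrite rmorphM !rmorphXn /= conjCK mulrC.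
rewrite meanJ ?h ?rmorph_nat//.
apply: ccontM; apply: ccontX; first exact: ccont_expi.
by apply: ccontJ; exact: ccont_expi.
Qed.

Lemma ccont_expiJX n : ccont (fun t : R => (expi t)^* ^+ n).
Proof. by apply: ccontX; apply: ccontJ; exact: ccont_expi. Qed.

Lemma ccont_poly_expi (p : {poly C}) : ccont (fun t => p.[expi t]).
Proof. by apply: ccont_horner; exact: ccont_expi. Qed.

Lemma mean_coef (p : {poly C}) m :
  mean (fun t => p.[expi t] * (expi t)^* ^+ m) = p`_m.
Proof.
under eq_fun do rewrite horner_coef mulr_suml.
rewrite mean_sum; last first.
  move=> i; apply: ccontM; last exact: ccont_expiJX.
  by apply: ccontM; [exact: ccont_cst|apply: ccontX; exact: ccont_expi].
have E i : mean (fun t => p`_i * expi t ^+ i * (expi t)^* ^+ m) = p`_i * (i == m)%:R.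
  rewrite -mean_expi -meanZ; last first.
    by apply: ccontM; [apply: ccontX; exact: ccont_expi|exact: ccont_expiJX].
  by apply: eq_mean => t; rewrite mulrA.
under eq_bigr do rewrite E.
have [mp|mp] := ltnP m (size p).
  rewrite (bigD1 (Ordinal mp))//= eqxx mulr1 big1 ?addr0// => i im.
  by rewrite (_ : (_ == _) = false) ?mulr0//; apply/negbTE.
rewrite nth_default// big1// => i _.
by rewrite ltn_eqF ?mulr0// (leq_trans (ltn_ord i)).
Qed.

Lemma parseval (p : {poly C}) (n : nat) : (size p <= n)%N ->
  rmean (fun t => cmod p.[expi t] ^+ 2) = \sum_(i < n) cmod p`_i ^+ 2.
Proof.
move=> pn; apply: complexI; rewrite -mean_real; last first.
  move=> t; apply: (@continuous_comp _ _ _ _ (fun x : R => x ^+ 2)).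
    by apply: continuous_cmod; exact: ccont_poly_expi.
  exact: exprn_continuous.
transitivity (mean (fun t => \sum_(i < n) (p`_i)^* * (p.[expi t] * (expi t)^* ^+ i))).
  apply: eq_mean => t; rewrite cmod_sqrC mulrC {1}(horner_coef_wide _ pn).
  rewrite rmorph_sum mulr_suml; apply: eq_bigr => i _.
  by rewrite rmorphM rmorphXn /= -mulrA; congr (_ * _); rewrite mulrC.
have cc i : ccont (fun t => p.[expi t] * (expi t)^* ^+ i).
  by apply: ccontM; [exact: ccont_poly_expi|exact: ccont_expiJX].
rewrite mean_sum; last by move=> i; apply: ccontM => //; exact: ccont_cst.
rewrite rmorph_sum; apply: eq_bigr => i _.
by rewrite meanZ// mean_coef /= mulrC cmod_sqrC.
Qed.

End Mean.

(** * Goursat's theorem on rectangles *)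

Lemma nested_intervals (R : realType) (u v : nat -> R) :
  (forall n, u n <= u n.+1) -> (forall n, v n.+1 <= v n) -> (forall n, u n <= v n) ->
  exists x, forall n, u n <= x <= v n.
Proof.
move=> uS vS uv.
have ui : {homo u : m n / (m <= n)%N >-> m <= n}.
  by apply: homo_leq => //; exact: le_trans.
have vd : {homo v : m n / (m <= n)%N >-> n <= m}.
  by apply: homo_leq => // x y z yx zy; exact: le_trans zy yx.
have uvmn m n : u m <= v n.
  apply: le_trans (ui _ _ (leq_maxl m n)) _.
  by apply: le_trans (uv _) _; apply: vd; exact: leq_maxr.
pose S := [set u n | n in [set: nat]].
have S0 : S !=set0 by exists (u 0); exists 0%N.
exists (sup S) => n; apply/andP; split.
  apply: ub_le_sup; last by exists n.
  by exists (v 0) => _ [m _ <-]; exact: uvmn.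
by apply: ge_sup => // _ [m _ <-]; exact: uvmn.
Qed.

Lemma itv_sub (R : realType) (a L x l u : R) :
  a <= x -> x + l <= L -> x <= u <= x + l -> a <= u <= L.
Proof. lra. Qed.

Lemma itv_dist (R : realType) (x l u v : R) :
  x <= u <= x + l -> x <= v <= x + l -> `|u - v| <= l.
Proof. by rewrite ler_norml; lra. Qed.

Lemma itv_l (R : realType) (x l : R) : 0 <= l -> x <= x <= x + l.
Proof. lra. Qed.

Lemma itv_r (R : realType) (x l : R) : 0 <= l -> x <= x + l <= x + l.
Proof. lra. Qed.

Section Goursat.
Context (R : realType).
Local Notation C := R[i].
Variable g : R -> R -> C.
Hypothesis gx : forall y, ccont (fun s => g s y).
Hypothesis gy : forall x, ccont (g x).

(* The integral of [g] along the boundary of the rectangle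
   [x, x + p] x [y, y + q]. *)
Definition bd (x y p q : R) : C :=
  cintegral x (x + p) (fun s => g s y - g s (y + q)) +
  'i * cintegral y (y + q) (fun t => g (x + p) t - g x t).

Let ccx y y' : ccont (fun s => g s y - g s y').
Proof. exact: ccontB. Qed.

Let ccy x x' : ccont (fun t => g x t - g x' t).
Proof. exact: ccontB. Qed.

Lemma bd_splitx x y p p' q : 0 <= p -> 0 <= p' ->
  bd x y (p + p') q = bd x y p q + bd (x + p) y p' q.
Proof.
move=> p0 p'0; rewrite /bd addrA (@cintegral_cat _ x (x + p) (x + p + p'))//; last 2 first.
- by rewrite lerDl.
- by rewrite lerDl.
rewrite addrACA; congr (_ + _); rewrite -mulrDr -cintegralD//.
by congr (_ * cintegral _ _ _); apply/funext => t; rewrite [RHS]addrC addrA subrK.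
Qed.

Lemma bd_splity x y p q q' : 0 <= q -> 0 <= q' ->
  bd x y p (q + q') = bd x y p q + bd x (y + q) p q'.
Proof.
move=> q0 q'0; rewrite /bd addrA (@cintegral_cat _ y (y + q) (y + q + q'))//; last 2 first.
- by rewrite lerDl.
- by rewrite lerDl.
rewrite mulrDr addrACA; congr (_ + _); rewrite -cintegralD//.
by congr (cintegral _ _ _); apply/funext => t; rewrite addrA subrK.
Qed.

Variables (a b A B : R).
Hypothesis A0 : 0 < A.
Hypothesis B0 : 0 < B.
Hypothesis dg : forall x y, a <= x <= a + A -> b <= y <= b + B ->
  exists c : C, forall e, 0 < e -> exists2 d, 0 < d &
    forall x' y', a <= x' <= a + A -> b <= y' <= b + B ->
      `|x' - x| + `|y' - y| < d ->
      cmod (g x' y' - g x y - c * ((x' - x)%:C + 'i * (y' - y)%:C)) <=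
      e * (`|x' - x| + `|y' - y|).

Let K := cmod (bd a b A B).
Let p n := A / 2 ^+ n.
Let q n := B / 2 ^+ n.
Let bad n (z : R * R) := K / 4 ^+ n <= cmod (bd z.1 z.2 (p n) (q n)).

(** Picks a quarter that keeps its share of the boundary integral. The upper right one is the
    default: the four integrals add up, so it qualifies when the other three fail. *)
Let next n (z : R * R) : R * R :=
  if bad n.+1 z then z
  else if bad n.+1 (z.1 + p n.+1, z.2) then (z.1 + p n.+1, z.2)
  else if bad n.+1 (z.1, z.2 + q n.+1) then (z.1, z.2 + q n.+1)
  else (z.1 + p n.+1, z.2 + q n.+1).

Let corner := fix corner n := if n is m.+1 then next m (corner m) else (a, b).

Let p_gt0 n : 0 < p n.
Proof. by rewrite divr_gt0// exprn_gt0. Qed.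

Let q_gt0 n : 0 < q n.
Proof. by rewrite divr_gt0// exprn_gt0. Qed.

Let pS n : p n = p n.+1 + p n.+1.
Proof. by rewrite /p exprS; field; rewrite expf_neq0. Qed.

Let qS n : q n = q n.+1 + q n.+1.
Proof. by rewrite /q exprS; field; rewrite expf_neq0. Qed.

Let corner_bad n : bad n (corner n).
Proof.
elim: n => [|n IH].
  by rewrite /bad /p /q !expr0 !divr1.
rewrite /= /next; case: ifPn => [//|h1]; case: ifPn => [//|h2]; case: ifPn => [//|h3].
rewrite /bad leNgt; apply/negP => h4; move: IH h1 h2 h3 h4; rewrite /bad -!ltNge.
case: (corner n) => x y /=.
have p0 := ltW (p_gt0 n.+1); have q0 := ltW (q_gt0 n.+1).
have -> : bd x y (p n) (q n) =
    (bd x y (p n.+1) (q n.+1) + bd x (y + q n.+1) (p n.+1) (q n.+1)) +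
    (bd (x + p n.+1) y (p n.+1) (q n.+1) +
     bd (x + p n.+1) (y + q n.+1) (p n.+1) (q n.+1)).
  by rewrite {1}(pS n) {1}(qS n) bd_splitx//; congr (_ + _); exact: bd_splity.
set z1 := bd _ _ _ _; set z2 := bd _ _ _ _; set z3 := bd _ _ _ _; set z4 := bd _ _ _ _.
move=> h h1 h2 h3 h4.
have le4 : cmod (z1 + z2 + (z3 + z4)) <= cmod z1 + cmod z2 + (cmod z3 + cmod z4).
  by apply: le_trans (ler_cmodD _ _) _; apply: lerD; exact: ler_cmodD.
have K4 : K / 4 ^+ n = 4 * (K / 4 ^+ n.+1).
  by rewrite exprS; field; rewrite expf_neq0.
have := le_trans h le4; rewrite K4 leNgt => /negP; apply.
rewrite (_ : 4 * _ = K / 4 ^+ n.+1 + K / 4 ^+ n.+1 + (K / 4 ^+ n.+1 + K / 4 ^+ n.+1)).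
  exact: (ltrD (ltrD h1 h3) (ltrD h2 h4)).
by rewrite -!mulr2n -mulrnA mulr_natl.
Qed.

Let cornerx n : (corner n).1 <= (corner n.+1).1 <= (corner n).1 + p n.+1.
Proof.
rewrite /= /next; have := p_gt0 n.+1.
by do 3 (case: ifP => _ /=; first lra); lra.
Qed.

Let cornery n : (corner n).2 <= (corner n.+1).2 <= (corner n).2 + q n.+1.
Proof.
rewrite /= /next; have := q_gt0 n.+1.
by do 3 (case: ifP => _ /=; first lra); lra.
Qed.

(** The chosen quarters shrink to a point near which [g] is affine up to [e * s], [s] being their
    half perimeter. The affine part integrates to zero along the boundary, so the integral is at
    most [2 * e * s ^+ 2], while it is at least [K / 4 ^+ n], a quantity of the same order in
    [n]. *)
Theorem goursat : bd a b A B = 0.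
Proof.
apply/eqP; rewrite -cmod_eq0 -/K; apply: contraT => Kn0.
have K0 : 0 < K by rewrite lt_neqAle eq_sym Kn0 cmod_ge0.
have [xs xsP] : exists x, forall n, (corner n).1 <= x <= (corner n).1 + p n.
  apply: nested_intervals => n.
  - by have /andP[] := cornerx n.
  - by have := cornerx n; have := pS n; lra.
  - by have := p_gt0 n; lra.
have [ys ysP] : exists y, forall n, (corner n).2 <= y <= (corner n).2 + q n.
  apply: nested_intervals => n.
  - by have /andP[] := cornery n.
  - by have := cornery n; have := qS n; lra.
  - by have := q_gt0 n; lra.
have inx n : a <= (corner n).1 /\ (corner n).1 + p n <= a + A.
  elim: n => [|n [h1 h2]]; first by rewrite /= /p expr0 divr1.
  by have := cornerx n; have := pS n; lra.
have iny n : b <= (corner n).2 /\ (corner n).2 + q n <= b + B.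
  elim: n => [|n [h1 h2]]; first by rewrite /= /q expr0 divr1.
  by have := cornery n; have := qS n; lra.
have xsin : a <= xs <= a + A by have := xsP 0; rewrite /= /p expr0 divr1.
have ysin : b <= ys <= b + B by have := ysP 0; rewrite /= /q expr0 divr1.
have [c cP] := dg xsin ysin.
have AB0 : 0 < A + B by rewrite addr_gt0.
(* Chosen so that [2 * e * s ^+ 2] is exactly half of [K / 4 ^+ n]. *)
pose e := K / (4 * (A + B) ^+ 2).
have e0 : 0 < e by rewrite divr_gt0// mulr_gt0// exprn_gt0.
have [del del0 dP] := cP e e0.
have [n nP] : exists n : nat, (A + B) / 2 ^+ n < del.
  exists (Num.bound ((A + B) / del)).
  rewrite ltr_pdivrMr ?exprn_gt0// mulrC -ltr_pdivrMr//.
  apply: lt_trans (archi_boundP (ltW (divr_gt0 AB0 del0))) _.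
  by rewrite -natrX ltr_nat ltn_expl.
pose s := (A + B) / 2 ^+ n.
have sE : p n + q n = s by rewrite /s mulrDl.
pose x := (corner n).1; pose y := (corner n).2.
have [x1 x2] := inx n; have [y1 y2] := iny n.
have xsn := xsP n; have ysn := ysP n.
rewrite -/x in x1 x2 xsn; rewrite -/y in y1 y2 ysn.
have rho x' y' : x <= x' <= x + p n -> y <= y' <= y + q n ->
    cmod (g x' y' - g xs ys - c * ((x' - xs)%:C + 'i * (y' - ys)%:C)) <= e * s.
  move=> hx hy; have hs : `|x' - xs| + `|y' - ys| <= s.
    by rewrite -sE; apply: lerD; [exact: itv_dist hx xsn|exact: itv_dist hy ysn].
  have ix := itv_sub x1 x2 hx; have iy := itv_sub y1 y2 hy.
  apply: le_trans (dP _ _ ix iy (le_lt_trans hs nP)) _.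
  by rewrite ler_wpM2l// ltW.
(* The increments of the linear part are subtracted; their integrals over the two pairs of sides are
   opposite and cancel in [bdE]. *)
pose E1 := fun t => g t y - g t (y + q n) - (- ('i * c * (q n)%:C)).
pose E2 := fun t => g (x + p n) t - g x t - c * (p n)%:C.
have bdE : bd x y (p n) (q n) =
    cintegral x (x + p n) E1 + 'i * cintegral y (y + q n) E2.
  rewrite /bd /E1 /E2.
  rewrite (cintegralB _ _ (ccx y (y + q n)) (ccont_cst _)).
  rewrite (cintegralB _ _ (ccy (x + p n) x) (ccont_cst _)).
  have hp : x <= x + p n by rewrite lerDl ltW.
  have hq : y <= y + q n by rewrite lerDl ltW.
  rewrite !cintegral_cst//.
  have -> : x + p n - x = p n by rewrite addrAC subrr add0r.
  have -> : y + q n - y = q n by rewrite addrAC subrr add0r.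
  by ring.
have bound1 : cmod (cintegral x (x + p n) E1) <= p n * (2 * (e * s)).
  rewrite -[X in X * _](_ : x + p n - x = _); last by rewrite addrAC subrr add0r.
  apply: ler_cmod_cintegral_cst.
  - by apply: ccontB => //; exact: ccont_cst.
  - by rewrite lerDl ltW.
  move=> t ht; rewrite mulr_natl mulr2n.
  have -> : E1 t =
      (g t y - g xs ys - c * ((t - xs)%:C + 'i * (y - ys)%:C)) -
      (g t (y + q n) - g xs ys - c * ((t - xs)%:C + 'i * (y + q n - ys)%:C)).
    by rewrite /E1 !rmorphB !rmorphD /=; ring.
  apply: le_trans (ler_cmodB _ _) _; apply: lerD.
    exact: rho ht (itv_l _ (ltW (q_gt0 n))).
  exact: rho ht (itv_r _ (ltW (q_gt0 n))).
have bound2 : cmod (cintegral y (y + q n) E2) <= q n * (2 * (e * s)).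
  rewrite -[X in X * _](_ : y + q n - y = _); last by rewrite addrAC subrr add0r.
  apply: ler_cmod_cintegral_cst.
  - by apply: ccontB => //; exact: ccont_cst.
  - by rewrite lerDl ltW.
  move=> t ht; rewrite mulr_natl mulr2n.
  have -> : E2 t =
      (g (x + p n) t - g xs ys - c * ((x + p n - xs)%:C + 'i * (t - ys)%:C)) -
      (g x t - g xs ys - c * ((x - xs)%:C + 'i * (t - ys)%:C)).
    by rewrite /E2 !rmorphB !rmorphD /=; ring.
  apply: le_trans (ler_cmodB _ _) _; apply: lerD.
    exact: rho (itv_r _ (ltW (p_gt0 n))) ht.
  exact: rho (itv_l _ (ltW (p_gt0 n))) ht.
have := corner_bad n; rewrite /bad -/x -/y bdE => h.
have h' := ler_cmodD (cintegral x (x + p n) E1) ('i * cintegral y (y + q n) E2).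
rewrite cmodM cmod_i mul1r in h'.
have hh : K / 4 ^+ n <= 2 * e * s ^+ 2.
  by rewrite -[in leRHS]sE in bound1 bound2 *; nra.
have : K / 4 ^+ n <= (K / 4 ^+ n) / 2.
  apply: le_trans hh _; rewrite le_eqVlt; apply/orP; left; apply/eqP.
  have e4 : (2 ^+ n) ^+ 2 = 4 ^+ n :> R.
    by rewrite -exprM mulnC exprM -natrX.
  have z1 : A + B != 0 by rewrite gt_eqF.
  have z4 : 4 ^+ n != 0 :> R by rewrite expf_neq0// pnatr_eq0.
  by rewrite /e /s expr_div_n e4; field; rewrite ?z1 ?z4.
have : 0 < K / 4 ^+ n by rewrite divr_gt0// exprn_gt0.
by lra.
Qed.

End Goursat.

(** * Means of holomorphic functions *)

Lemma derivable_small_o (K : numFieldType) (f : K -> K^o) (x : K) :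
  derivable f x 1 -> forall e : K, 0 < e -> exists2 d, 0 < d &
    forall y, `|y - x| < d -> `|f y - f x - 'D_1 f x * (y - x)| <= e * `|y - x|.
Proof.
move=> df e e0.
have cf : (fun h => h^-1 *: (f (h *: 1 + x) - f x)) @ 0^' --> 'D_1 f x := df.
have /cvgrPdist_lt/(_ e e0)/nbhs_ballP[d d0 dP] := cf.
exists d => // y yx; have [->|ynx] := eqVneq y x.
  by rewrite !subrr mulr0 subrr !normr0 mulr0.
have h0 : y - x != 0 by rewrite subr_eq0.
have := dP (y - x); rewrite /ball/= sub0r normrN => /(_ yx h0) /ltW.
rewrite /GRing.scale /= mulr1 subrK => h.
rewrite -[leRHS]mulrC -ler_pdivrMl ?normr_gt0// -normfV -normrM mulrBr.
by rewrite [_ * ('D_1 f x * _)]mulrCA mulVf// mulr1 distrC.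
Qed.

Section HolomorphicMeans.
Context (R : realType).
Local Notation C := R[i].

Lemma derivable_cmod (h : R[i]^o -> R[i]^o) (z : R[i]^o) : derivable h z 1 ->
  exists c : C, forall e : R, 0 < e -> exists2 d : R, 0 < d &
    forall w : C, cmod (w - z) < d ->
      cmod (h w - h z - c * (w - z)) <= e * cmod (w - z).
Proof.
move=> dh; exists ('D_1 h z) => e e0.
have e0' : (0 : C) < e%:C by rewrite ltcR.
have [d d0 dP] := derivable_small_o dh e0'.
have dE : d = (complex.Re d)%:C by rewrite RRe_real// gtr0_real.
exists (complex.Re d); first by rewrite -ltcR -dE.
move=> w wd; rewrite -lecR rmorphM /= -!normcmodE; apply: dP.
by rewrite dE normcmodE ltcR.
Qed.

Lemma derivable_ccont (h : R[i]^o -> R[i]^o) (z : R[i]^o) : derivable h z 1 ->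
  forall e : R, 0 < e -> exists2 d : R, 0 < d &
    forall w : C, cmod (w - z) < d -> cmod (h w - h z) < e.
Proof.
move=> /derivable_cmod[c cP] e e0; have [d d0 dP] := cP 1 ltr01.
pose L := 1 + cmod c; have L0 : 0 < L by rewrite ltr_pwDl ?cmod_ge0.
exists (Num.min d (e / L)); first by rewrite lt_min d0 divr_gt0.
move=> w; rewrite lt_min => /andP[/dP h1 h2].
have : cmod (h w - h z) <= L * cmod (w - z).
  rewrite /L mulrDl -cmodM; apply: le_trans (lerD h1 (lexx _)).
  by apply: le_trans (ler_cmodD _ _); rewrite subrK.
move/le_lt_trans; apply; by rewrite mulrC -ltr_pdivlMr.
Qed.

Lemma ccont_comp (h : C -> C) (ga : R -> C) : ccont ga ->
  (forall t e, 0 < e -> exists2 d, 0 < d &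
     forall w, cmod (w - ga t) < d -> cmod (h w - h (ga t)) < e) ->
  ccont (fun t => h (ga t)).
Proof.
move=> /ccontP cg ch; apply/ccontP => t e e0.
have [d d0 dP] := ch t e e0; have [d' d'0 d'P] := cg t d d0.
by exists d' => // s /d'P /dP.
Qed.

Lemma ccont_holomorphic (h : C -> C) (ga : R -> C) : holomorphic_disc h ->
  ccont ga -> (forall t, cmod (ga t) < 1) -> ccont (fun t => h (ga t)).
Proof.
move=> hh cg g1; apply: ccont_comp => // t e e0.
exact: (derivable_ccont (hh _ (g1 t)) e0).
Qed.

Let small_o (f : R -> R) (x df : R) : is_derive x 1 f df ->
  forall e : R, 0 < e -> exists2 d : R, 0 < d &
    forall y, `|y - x| < d -> `|f y - f x - df * (y - x)| <= e * `|y - x|.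
Proof.
by move=> [h <-] e e0; exact: (@derivable_small_o R f x h e e0).
Qed.

Let expi_small_o (y e : R) : 0 < e -> exists2 d : R, 0 < d &
  forall y', `|y' - y| < d ->
    cmod (expi y' - expi y - 'i * expi y * (y' - y)%:C) <= e * `|y' - y|.
Proof.
move=> e0; have e2 : 0 < e / 2 by rewrite divr_gt0.
have [d1 d10 h1] := small_o (is_derive_cos y) e2.
have [d2 d20 h2] := small_o (is_derive_sin y) e2.
exists (Num.min d1 d2); first by rewrite lt_min d10.
move=> y'; rewrite lt_min => /andP[/h1 {}h1 /h2 {}h2].
apply: le_trans (cmod_le_ReIm _) _.
rewrite [e]splitr mulrDl; apply: lerD.
  apply: le_trans h1; rewrite le_eqVlt; apply/orP; left; apply/eqP.
  by congr `|_|; rewrite /expi; simpc; rewrite /=; ring.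
apply: le_trans h2; rewrite le_eqVlt; apply/orP; left; apply/eqP.
by congr `|_|; rewrite /expi; simpc; rewrite /=; ring.
Qed.

(* Goursat's theorem is applied to [H \o logpolar] on [x0, x1] x [0, 2 pi]: the
   horizontal sides cancel by periodicity, so the mean of [H] over the circle of
   radius [expR x] does not depend on [x]. *)
Definition logpolar (x y : R) : C := (expR x)%:C * expi y.

Lemma cmod_logpolar x y : cmod (logpolar x y) = expR x.
Proof. by rewrite cmodM cmod_expi mulr1 cmod_real ger0_norm ?expR_ge0. Qed.

(** [logpolar] is the complex exponential of [x + i y], hence its own derivative. The remainder
    splits into a radial, an angular and a mixed part, and [x <= 0] bounds the factor [expR x] by
    [1]. *)
Lemma logpolar_small_o (x y e : R) : x <= 0 -> 0 < e -> exists2 d : R, 0 < d &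
  forall x' y', `|x' - x| + `|y' - y| < d ->
    cmod (logpolar x' y' - logpolar x y -
      logpolar x y * ((x' - x)%:C + 'i * (y' - y)%:C)) <=
    e * (`|x' - x| + `|y' - y|).
Proof.
move=> x0 e0; pose e' := Num.min (e / 2) 1.
have e'0 : 0 < e' by rewrite lt_min divr_gt0/=.
have [d1 d10 h1] := small_o (is_derive_expR x) e'0.
have [d2 d20 h2] := expi_small_o y e'0.
exists (Num.min (Num.min d1 d2) (e' / 2)).
  by rewrite !lt_min d10 d20 divr_gt0.
move=> x' y'; rewrite !lt_min => /andP[/andP[s1 s2] s3].
have xn := normr_ge0 (x' - x); have yn := normr_ge0 (y' - y).
have e'1 : e' <= 1 by rewrite ge_min lexx orbT.
have e'2 : 2 * e' <= e.
  by rewrite mulrC -ler_pdivlMr// /e' ge_min lexx.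
have {}h1 : `|expR x' - expR x - expR x * (x' - x)| <= e' * `|x' - x|.
  by apply: h1; apply: le_lt_trans s1; rewrite lerDl.
have {}h2 : cmod (expi y' - expi y - 'i * expi y * (y' - y)%:C) <= e' * `|y' - y|.
  by apply: h2; apply: le_lt_trans s2; rewrite lerDr.
have h3 : cmod (expi y' - expi y) <= e'.
  have := ler_cmodD (expi y' - expi y - 'i * expi y * (y' - y)%:C)
    ('i * expi y * (y' - y)%:C).
  rewrite subrK !cmodM cmod_i cmod_expi cmod_real !mul1r => h3.
  have : e' * `|y' - y| <= 1 * `|y' - y| by rewrite ler_wpM2r.
  by move: s3 h2 h3 xn; clear -R; lra.
have ex1 : expR x <= 1 by rewrite -expR0 ler_expR.
have -> : logpolar x' y' - logpolar x y -
      logpolar x y * ((x' - x)%:C + 'i * (y' - y)%:C) =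
    (expR x' - expR x - expR x * (x' - x))%:C * expi y' +
    (expR x)%:C * (expi y' - expi y - 'i * expi y * (y' - y)%:C) +
    (expR x * (x' - x))%:C * (expi y' - expi y).
  by rewrite /logpolar !rmorphB !rmorphM /= !rmorphB /=; ring.
apply: le_trans (ler_cmodD _ _) _.
apply: le_trans (lerD (ler_cmodD _ _) (lexx _)) _.
rewrite !cmodM cmod_expi !cmod_real mulr1 normrM !(ger0_norm (expR_ge0 x)).
have t1 : expR x * cmod (expi y' - expi y - 'i * expi y * (y' - y)%:C) <=
    e' * `|y' - y|.
  by rewrite -[leRHS]mul1r ler_pM ?expR_ge0 ?cmod_ge0.
have t2 : expR x * `|x' - x| * cmod (expi y' - expi y) <= `|x' - x| * e'.
  rewrite ler_pM ?cmod_ge0 ?mulr_ge0 ?expR_ge0//.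
  by rewrite -[leRHS]mul1r ler_wpM2r.
apply: le_trans (lerD (lerD h1 t1) t2) _.
rewrite mulrDr; have : 2 * e' * `|x' - x| <= e * `|x' - x| by rewrite ler_wpM2r.
have : 2 * e' * `|y' - y| <= e * `|y' - y| by rewrite ler_wpM2r.
have : 0 <= e' * `|y' - y| by rewrite mulr_ge0// ltW.
move: (`|x' - x|) (`|y' - y|) => u v; rewrite -!mulrA (mulrC u); lra.
Qed.

Lemma mean_polar_const (H : C -> C) (x0 x1 : R) : holomorphic_disc H ->
  x0 < x1 -> x1 < 0 ->
  mean (fun t => H ((expR x0)%:C * expi t)) = mean (fun t => H ((expR x1)%:C * expi t)).
Proof.
move=> hH x01 x10.
(* Clamping extends the integrand continuously to all real [x] without leaving the disc, as
   [goursat] asks for continuity on full lines; on the rectangle [m] is the identity. *)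
pose m x := Num.min x x1.
pose g x y := H (logpolar (m x) y).
have mlt x : m x < 0 by rewrite gt_min x10 orbT.
have disc x y : cmod (logpolar (m x) y) < 1.
  by rewrite cmod_logpolar -expR0 ltr_expR.
have gx y : ccont (fun s => g s y).
  apply: (@ccont_holomorphic H (fun s => logpolar (m s) y) hH _ (disc^~ y)).
  apply: ccontM; last exact: ccont_cst.
  apply: ccont_real => t; apply: continuous_comp; last exact: continuous_expR.
  by apply: continuous_min => //; exact: cvg_cst.
have gy x : ccont (g x).
  apply: (@ccont_holomorphic H (logpolar (m x)) hH _ (disc x)).
  by apply: ccontM; [exact: ccont_cst|exact: ccont_expi].
have A0 : 0 < x1 - x0 by rewrite subr_gt0.
have B0 : 0 < 2 * pi :> R by rewrite mulr_gt0// pi_gt0.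
have mE x : x <= x0 + (x1 - x0) -> m x = x.
  by rewrite addrC subrK => xx; apply/min_idPl.
have dg x y : x0 <= x <= x0 + (x1 - x0) -> 0 <= y <= 0 + 2 * pi ->
  exists c : C, forall e, 0 < e -> exists2 d, 0 < d &
    forall x' y', x0 <= x' <= x0 + (x1 - x0) -> 0 <= y' <= 0 + 2 * pi ->
      `|x' - x| + `|y' - y| < d ->
      cmod (g x' y' - g x y - c * ((x' - x)%:C + 'i * (y' - y)%:C)) <=
      e * (`|x' - x| + `|y' - y|).
  move=> /andP[_ /mE mx] _.
  have xle : x <= 0 by rewrite -mx ltW.
  have zd : unit_disc (logpolar x y : R[i]^o) by rewrite -mx; exact: disc.
  have [c cP] := derivable_cmod (hH _ zd).
  exists (c * logpolar x y) => e e0.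
  pose L := cmod c + 1; have L0 : 0 < L by rewrite ltr_wpDl ?cmod_ge0.
  have e4 : 0 < e / 4 by rewrite divr_gt0.
  pose et := Num.min (e / (2 * L)) 1.
  have et0 : 0 < et by rewrite lt_min divr_gt0 ?mulr_gt0/=.
  have et1 : et <= 1 by rewrite ge_min lexx orbT.
  have etL : et * L <= e / 2.
    have : et <= e / (2 * L) by rewrite ge_min lexx.
    by rewrite -(ler_pM2r L0) => h; apply: le_trans h _;
    rewrite le_eqVlt; apply/orP; left; apply/eqP; field; rewrite gt_eqF.
  have [d1 d10 h1] := cP _ e4; have [d2 d20 h2] := logpolar_small_o y xle et0.
  exists (Num.min (d1 / 2) d2); first by rewrite lt_min d20 divr_gt0.
  move=> x' y' /andP[_ /mE mx'] _; rewrite lt_min => /andP[s1 /h2 {}h2].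
  rewrite /g mx mx'; set w := logpolar x' y' in h2 *; set z := logpolar x y in h1 h2 *.
  set De := _%:C + _ in h2 *; set S := _ + _ in s1 h2 *.
  have S0 : 0 <= S by rewrite addr_ge0.
  have zn : cmod z <= 1 by rewrite /z cmod_logpolar -expR0 ler_expR.
  have DeS : cmod De <= S.
    apply: le_trans (ler_cmodD _ _) _; rewrite cmodM !cmod_real.
    by rewrite cmod_i mul1r.
  have wz : cmod (w - z) <= 2 * S.
    rewrite -[w - z](subrK (z * De)); apply: le_trans (ler_cmodD _ _) _.
    rewrite mulr_natl mulr2n; apply: lerD.
      by apply: le_trans h2 _; rewrite -[leRHS]mul1r ler_wpM2r.
    by rewrite cmodM -[leRHS]mul1r ler_pM ?cmod_ge0.
  have {}h1 : cmod (H w - H z - c * (w - z)) <= e / 4 * cmod (w - z).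
    by apply: h1; apply: le_lt_trans wz _; rewrite mulrC -ltr_pdivlMr.
  have -> : H w - H z - c * z * De = (H w - H z - c * (w - z)) + c * (w - z - z * De).
    by ring.
  apply: le_trans (ler_cmodD _ _) _; rewrite cmodM [e]splitr mulrDl; apply: lerD.
    apply: le_trans h1 _; have : e / 4 * cmod (w - z) <= e / 4 * (2 * S).
      by rewrite ler_wpM2l// ltW.
    by move=> h; apply: le_trans h _; rewrite le_eqVlt; apply/orP; left; apply/eqP; field.
  apply: le_trans (_ : L * (et * S) <= _).
    rewrite ler_pM ?cmod_ge0//.
    by rewrite lerDl.
  by rewrite mulrA [L * et]mulrC ler_wpM2r.
have i0 : ('i : C) != 0 by rewrite -cmod_eq0 cmod_i oner_neq0.
have J1 : cintegral x0 (x0 + (x1 - x0)) (fun s => g s 0 - g s (0 + 2 * pi)) = 0.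
  rewrite -[RHS](mulr0 (x0 + (x1 - x0) - x0)%:C) -cintegral_cst ?lerDl ?ltW//.
  by apply: eq_cintegral => s _; rewrite /g /logpolar add0r expi_2pi expi0 subrr.
have J2 : cintegral 0 (0 + 2 * pi) (fun t => g (x0 + (x1 - x0)) t - g x0 t) = 0.
  apply: (mulfI i0); rewrite mulr0 -[RHS](goursat gx gy A0 B0 dg) /bd.
  by rewrite J1 [RHS]add0r.
have hh : cintegral 0 (2 * pi) (g x1) = cintegral 0 (2 * pi) (g x0).
  apply/eqP; rewrite -subr_eq0 -(cintegralB _ _ (gy x1) (gy x0)).
  by move: J2; rewrite add0r addrC subrK => ->.
have m0 : m x0 = x0 by apply/min_idPl; rewrite ltW.
have m1 : m x1 = x1 by apply/min_idPl.
by move: hh; rewrite /mean /g /logpolar m0 m1 => ->.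
Qed.

(** The mean does not depend on the radius, and for small radii continuity at the centre brings it
    close to [H 0]. *)
Lemma mean_holomorphic (H : C -> C) (r : R) : holomorphic_disc H ->
  0 < r -> r < 1 -> mean (fun t => H (r%:C * expi t)) = H 0.
Proof.
move=> hH r0 r1; apply/eqP; rewrite -subr_eq0 -cmod_eq0; apply: contraT => K0.
set K := cmod _ in K0; have {}K0 : 0 < K by rewrite lt_neqAle eq_sym K0 cmod_ge0.
have zd : unit_disc (0 : R[i]^o) by rewrite /unit_disc /= cmod0.
have [d d0 dP] := derivable_ccont (hH _ zd) (divr_gt0 K0 (ltr0n _ 2)).
pose s := Num.min (r / 2) (d / 2).
have s0 : 0 < s by rewrite lt_min !divr_gt0.
have sr : s < r by rewrite gt_min; apply/orP; left; lra.
have sd : s < d by rewrite gt_min; apply/orP; right; lra.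
have hm : mean (fun t => H (s%:C * expi t)) = mean (fun t => H (r%:C * expi t)).
  have := @mean_polar_const H (ln s) (ln r) hH.
  rewrite !lnK ?posrE//; apply; first by rewrite ltr_ln ?posrE.
  by rewrite ln_lt0// r0.
have cs : ccont (fun t => H (s%:C * expi t)).
  apply: ccont_holomorphic => [//| |t].
    by apply: ccontM; [exact: ccont_cst|exact: ccont_expi].
  by rewrite cmodM cmod_expi mulr1 cmod_real gtr0_norm// (lt_trans sr).
have : K <= K / 2.
  rewrite {1}/K -hm -[H 0]mean_cst -meanB//; last exact: ccont_cst.
  apply: ler_cmod_mean_cst; first by apply: ccontB => //; exact: ccont_cst.
  move=> t _; apply/ltW/dP.
  by rewrite subr0 cmodM cmod_expi mulr1 cmod_real gtr0_norm.
by lra.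
Qed.

(** The function [h z * z ^+ n.+1] is holomorphic and vanishes at [0]. These means are the Fourier
    coefficients of [h] of negative index. *)
Lemma mean_holomorphic_mulX (h : C -> C) (r : R) n : holomorphic_disc h ->
  0 < r -> r < 1 -> mean (fun t => h (r%:C * expi t) * expi t ^+ n.+1) = 0.
Proof.
move=> hh r0 r1.
have hH : holomorphic_disc (fun z : R[i]^o => h z * z ^+ n.+1 : R[i]^o).
  move=> z zd; have d1 := hh z zd.
  have d2 := @exprn_derivable R[i] n.+1 z 1.
  exact: derivableM d1 d2.
have := mean_holomorphic hH r0 r1; rewrite expr0n mulr0 => h0.
have rn : (r%:C ^+ n.+1 : C) != 0.
  by rewrite expf_neq0// (inj_eq (@complexI R) _ 0) gt_eqF.
apply: (mulfI rn); rewrite mulr0 -h0 -meanZ; last first.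
  apply: ccontM; last by apply: ccontX; exact: ccont_expi.
  apply: ccont_holomorphic => [//| |t].
    by apply: ccontM; [exact: ccont_cst|exact: ccont_expi].
  by rewrite cmodM cmod_expi mulr1 cmod_real gtr0_norm.
by apply: eq_mean => t; rewrite exprMn mulrCA.
Qed.

End HolomorphicMeans.

(** * Trigonometric approximation *)

(** Bounds the normalizing factor of [kap] by [n.+1], which the geometric decay away from the
    diagonal overcomes. *)
Lemma exp4_le_central_bin n : (4 ^ n <= n.+1 * 'C(n.*2, n))%N.
Proof.
elim: n => // n IH.
have b1 : ('C(n.+1.*2, n.+1) = 2 * 'C(n.*2.+1, n))%N.
  rewrite doubleS binS mulSn mul1n; congr (_ + _)%N.
  by rewrite -bin_sub ?subSS -?addnn ?addnK// ltnS leq_addr.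
have b2 : (n.+1 * 'C(n.*2.+1, n) = n.*2.+1 * 'C(n.*2, n))%N.
  have := mul_bin_down n.*2.+1 n; rewrite /= => ->.
  by rewrite subSn -addnn ?addnK// leq_addr.
rewrite -(@leq_pmul2l n.+1)// b1 expnS.
apply: (@leq_trans (n.+1 * (4 * (n.+1 * 'C(n.*2, n))))).
  by rewrite leq_mul2l leq_mul2l IH !orbT.
have -> : (n.+1 * (n.+2 * (2 * 'C(n.*2.+1, n))) =
    n.+2 * 2 * (n.*2.+1 * 'C(n.*2, n)))%N by rewrite -b2; lia.
set c := 'C(_, _); nia.
Qed.

Lemma bernoulli_ineq (R : realType) (x : R) n : 0 <= x -> 1 + n%:R * x <= (1 + x) ^+ n.
Proof.
move=> x0; elim: n => [|n IH]; first by rewrite mul0r addr0 expr0.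
rewrite exprS; have : (1 + x) * (1 + n%:R * x) <= (1 + x) * (1 + x) ^+ n.
  by rewrite ler_wpM2l// addr_ge0.
apply: le_trans; rewrite -natr1.
have := mulr_ge0 (mulr_ge0 (ler0n R n) x0) x0; set y := n%:R; nra.
Qed.

Lemma linear_geometric_small (R : realType) (q K e : R) : 0 <= q -> q < 1 -> 0 <= K ->
  0 < e -> exists n, K * (n.+1%:R * q ^+ n) <= e.
Proof.
move=> q0 q1 K0 e0.
have [->|qn0] := eqVneq q 0.
  by exists 1%N; rewrite expr1 !mulr0 ltW.
have qp : 0 < q by rewrite lt_neqAle eq_sym qn0.
pose x := q^-1 - 1; have x0 : 0 < x by rewrite subr_gt0 invf_gt1.
pose m := Num.bound (3 * K / (e * x ^+ 2)).
have mP : 3 * K / (e * x ^+ 2) < m%:R.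
  by apply: archi_boundP; rewrite divr_ge0// ?mulr_ge0// ?sqr_ge0// ltW.
have m0 : (0 < m)%N.
  rewrite -(ltr_nat R) (le_lt_trans _ mP)//.
  by rewrite divr_ge0// ?mulr_ge0// ?sqr_ge0// ltW.
(* Bernoulli gives [q ^+ m <= (m x)^-1]; squaring it yields a quadratic decay, which beats the
   linear factor. *)
exists (m * 2)%N; rewrite exprM.
have qm : 0 <= q ^+ m <= (m%:R * x)^-1.
  rewrite exprn_ge0//= -[q]invrK exprVn lef_pV2 ?posrE ?mulr_gt0 ?exprn_gt0 ?invr_gt0 ?ltr0n//.
  have := bernoulli_ineq m (ltW x0); rewrite /x [1 + (_ - 1)]addrC subrK.
  by apply: le_trans; rewrite lerDr.
have h1 : (q ^+ m) ^+ 2 <= (m%:R * x)^-1 ^+ 2.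
  have /andP[h1 h2] := qm.
  by rewrite ler_pXn2r ?nnegrE// (le_trans h1).
have h2 : (m * 2).+1%:R <= 3 * m%:R :> R by rewrite -natrM ler_nat -add1n mulSn leq_add// mulnC.
apply: (@le_trans _ _ (K * (3 * m%:R * (m%:R * x)^-1 ^+ 2))).
  by rewrite ler_wpM2l// ler_pM// ?exprn_ge0// ltW.
have mR : 0 < m%:R :> R by rewrite ltr0n.
have -> : K * (3 * m%:R * (m%:R * x)^-1 ^+ 2) = 3 * K / (e * x ^+ 2) * (e / m%:R).
  by field; rewrite !gt_eqF.
rewrite mulrA ler_pdivrMr// mulrC ler_wpM2l ?ltW//.
Qed.

Section CircleKernel.
Context (R : realType).
Local Notation C := R[i].
Implicit Types (t s : R) (g : R -> C).

(** Uniform continuity on the circle: nearness is that of the points and not of the angles, so that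
    [0] and [2 * pi] are close. *)
Definition circle_uc g := forall e, 0 < e -> exists2 d, 0 < d &
  forall s t, 0 <= s <= 2 * pi -> 0 <= t <= 2 * pi ->
    cmod (expi s - expi t) < d -> cmod (g s - g t) < e.

(* The de la Vallee-Poussin kernel, a trigonometric polynomial of degree [n] in
   [s - t]. *)
Definition kap n s t : R :=
  4 ^+ n / 'C(n.*2, n)%:R * ((cmod (expi s + expi t) / 2) ^+ 2) ^+ n.

Lemma kap_ge0 n s t : 0 <= kap n s t.
Proof. by rewrite mulr_ge0// ?divr_ge0// ?exprn_ge0// ?exprn_ge0// divr_ge0 ?cmod_ge0. Qed.

Lemma ccont_kap n s : ccont (fun t => (kap n s t)%:C).
Proof.
apply: ccont_real => t; rewrite /kap.
apply: cvgM; first exact: cvg_cst.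
apply: (@continuous_comp _ _ _ (fun t => (cmod (expi s + expi t) / 2) ^+ 2) (fun x : R => x ^+ n)).
  apply: (@continuous_comp _ _ _ (fun t => cmod (expi s + expi t) / 2) (fun x : R => x ^+ 2)).
    apply: cvgM; last exact: cvg_cst.
    apply: continuous_cmod; apply: ccontD; [exact: ccont_cst|exact: ccont_expi].
  exact: exprn_continuous.
exact: exprn_continuous.
Qed.

(** For unimodular [u] and [v], the square of [|u + v|] is [(u + v) ^+ 2] times the conjugate of
    [u * v], and the binomial formula applies to its powers. *)
Lemma kapE n s t : (kap n s t)%:C = ('C(n.*2, n)%:R^-1)%:C *
  \sum_(j < n.*2.+1) ('C(n.*2, j)%:R * (expi s ^+ j * (expi s)^* ^+ n)) *
    (expi t ^+ (n.*2 - j) * (expi t)^* ^+ n).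
Proof.
have h : ((cmod (expi s + expi t) ^+ 2) ^+ n)%:C =
    (expi s + expi t) ^+ n.*2 * ((expi s)^* * (expi t)^*) ^+ n.
  rewrite rmorphXn /= cmod_sqrC -mul2n exprM -exprMn; congr (_ ^+ n).
  rewrite expr2 -mulrA; congr (_ * _); rewrite rmorphD /= mulrDl.
  by rewrite !mulrA expiJr mul1r -mulrA mulrCA expiJr mulr1 addrC.
have -> : kap n s t = 'C(n.*2, n)%:R^-1 * (cmod (expi s + expi t) ^+ 2) ^+ n.
  have e4 : 2 ^+ 2 = 4 :> R by rewrite -natrX.
  rewrite /kap expr_div_n e4 expr_div_n; field.
  by rewrite expf_neq0 ?pnatr_eq0//= -lt0n bin_gt0 -addnn leq_addr.
rewrite rmorphM /= h; congr (_ * _); rewrite addrC exprDn mulr_suml.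
apply: eq_bigr => j _; rewrite [LHS]mulrnAl -[LHS]mulr_natl exprMn.
move: (_ ^+ j) (_ ^+ (_ - _)) (_ ^+ n) (_ ^+ n) => u v x y; ring.
Qed.

Definition conv n g s : C := mean (fun t => g t * (kap n s t)%:C).

Let ccont_term j n : ccont (fun t : R => expi t ^+ (n.*2 - j) * (expi t)^* ^+ n).
Proof. by apply: ccontM; [apply: ccontX; exact: ccont_expi|exact: ccont_expiJX]. Qed.

Lemma convE n g s : ccont g -> conv n g s = ('C(n.*2, n)%:R^-1)%:C *
  \sum_(j < n.*2.+1) ('C(n.*2, j)%:R * (expi s ^+ j * (expi s)^* ^+ n)) *
    mean (fun t => g t * (expi t ^+ (n.*2 - j) * (expi t)^* ^+ n)).
Proof.
move=> cg; pose a j : C := 'C(n.*2, j)%:R * (expi s ^+ j * (expi s)^* ^+ n).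
have cj j : ccont (fun t => g t * (expi t ^+ (n.*2 - j) * (expi t)^* ^+ n)).
  exact: ccontM.
have caj j : ccont (fun t => a j * (g t * (expi t ^+ (n.*2 - j) * (expi t)^* ^+ n))).
  by apply: ccontM => //; exact: ccont_cst.
transitivity (mean (fun t => ('C(n.*2, n)%:R^-1)%:C *
    \sum_(j < n.*2.+1) a j * (g t * (expi t ^+ (n.*2 - j) * (expi t)^* ^+ n)))).
  apply: eq_mean => t; rewrite kapE mulrCA; congr (_ * _).
  by rewrite mulr_sumr; apply: eq_bigr => j _; rewrite mulrCA.
rewrite meanZ; last by apply: ccont_sum => j; exact: caj.
by rewrite mean_sum//; congr (_ * _); apply: eq_bigr => j _; rewrite meanZ.
Qed.

(** Only the middle term [j = n] of the expansion has nonzero mean, and its binomial coefficient is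
    the normalization. *)
Lemma rmean_kap n s : rmean (kap n s) = 1.
Proof.
have [ck _] := ccont_kap n s.
apply: complexI; rewrite -mean_real//.
have -> : mean (fun t => (kap n s t)%:C) = conv n (fun=> 1) s.
  by apply: eq_mean => t; rewrite mul1r.
rewrite convE; last exact: ccont_cst.
have nn : (n < n.*2.+1)%N by rewrite ltnS -addnn leq_addr.
rewrite (bigD1 (Ordinal nn))//= big1 ?addr0 => [|j jn].
  under eq_mean do rewrite mul1r.
  rewrite mean_expi -addnn addnK eqxx mulr1 -exprMn expiJr expr1n mulr1.
  rewrite -(rmorph_nat (real_complex R)) -rmorphM /= mulVf//.
  by rewrite pnatr_eq0 -lt0n bin_gt0 leq_addr.
under eq_mean do rewrite mul1r.
rewrite mean_expi (_ : (_ == _) = false) ?mulr0//; apply/negbTE.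
apply: contra jn => /eqP h; apply/eqP/val_inj => /=.
by have := ltn_ord j; move: (j : nat) h => i; rewrite -addnn; lia.
Qed.

(** The parallelogram identity turns a large distance between two points of the circle into a sum of
    modulus well below [2]. *)
Lemma ler_kap_far n s t d : 0 <= d -> d <= cmod (expi s - expi t) ->
  kap n s t <= n.+1%:R * (1 - d ^+ 2 / 4) ^+ n.
Proof.
move=> d0 dd; rewrite /kap; apply: ler_pM.
- by rewrite divr_ge0// exprn_ge0.
- by rewrite exprn_ge0// exprn_ge0// divr_ge0 ?cmod_ge0.
- rewrite ler_pdivrMr ?ltr0n ?bin_gt0 -?addnn ?leq_addr//.
  by rewrite -natrX -natrM ler_nat addnn exp4_le_central_bin.
have par : cmod (expi s + expi t) ^+ 2 + cmod (expi s - expi t) ^+ 2 = 4.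
  apply: complexI; rewrite rmorphD /= !cmod_sqrC !rmorphB !rmorphD /=.
  transitivity (2 * (expi s * (expi s)^*) + 2 * (expi t * (expi t)^*)); first ring.
  by rewrite !expiJr !mulr1 !(rmorph1 (real_complex R)); ring.
have e4 : 2 ^+ 2 = 4 :> R by rewrite -natrX.
have d2 : d ^+ 2 <= cmod (expi s - expi t) ^+ 2.
  by rewrite ler_pXn2r ?nnegrE ?cmod_ge0.
have eqn : (cmod (expi s + expi t) / 2) ^+ 2 = 1 - cmod (expi s - expi t) ^+ 2 / 4.
  by rewrite expr_div_n e4 -par; field; rewrite par.
have le1 : (cmod (expi s + expi t) / 2) ^+ 2 <= 1 - d ^+ 2 / 4.
  by rewrite eqn lerD2l lerN2 ler_wpM2r// invr_ge0.
by apply: lerXn2r; rewrite ?nnegrE ?sqr_ge0//; apply: le_trans le1; exact: sqr_ge0.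
Qed.

Lemma conv_approx g (B e : R) : ccont g -> circle_uc g ->
  (forall t, 0 <= t <= 2 * pi -> cmod (g t) <= B) -> 0 < e ->
  exists n, forall s, 0 <= s <= 2 * pi -> cmod (conv n g s - g s) <= e.
Proof.
move=> cg ucg gB e0; have e2 : 0 < e / 2 by rewrite divr_gt0.
have [d1 d10 d1P] := ucg _ e2.
(* The cap at [1] keeps the ratio [q] nonnegative. *)
pose d := Num.min d1 1; have d0 : 0 < d by rewrite lt_min d10/=.
have d1' : d <= 1 by rewrite ge_min lexx orbT.
have B0 : 0 <= B.
  by apply: le_trans (gB 0 _); rewrite ?cmod_ge0// lexx mulr_ge0// pi_ge0.
pose q := 1 - d ^+ 2 / 4.
have d2 : 0 < d ^+ 2 <= 1 by rewrite exprn_gt0//= expr_le1// ltW.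
have q0 : 0 <= q by rewrite /q; lra.
have q1 : q < 1 by rewrite /q; lra.
have B2 : 0 <= 2 * B by rewrite mulr_ge0.
have [n nP] := linear_geometric_small q0 q1 B2 e2.
exists n => s hs.
have ck := ccont_kap n s.
have cgs : ccont (fun t => (g t - g s) * (kap n s t)%:C).
  by apply: ccontM => //; apply: ccontB => //; exact: ccont_cst.
have -> : conv n g s - g s = mean (fun t => (g t - g s) * (kap n s t)%:C).
  have hK : mean (fun t => g s * (kap n s t)%:C) = g s.
    by rewrite meanZ// mean_real ?rmean_kap ?mulr1//; exact: ck.1.
  rewrite -[X in _ - X]hK /conv -meanB//; last by apply: ccontM => //; exact: ccont_cst.
    by apply: eq_mean => t; rewrite mulrBl.
  exact: ccontM.
apply: le_trans (ler_cmod_mean cgs) _.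
have ck1 : continuous (kap n s) := ck.1.
(* The first term dominates near the diagonal, by uniform continuity; the second dominates far from
   it, by decay of the kernel. *)
apply: (@le_trans _ _ (rmean (fun t => e / 2 * kap n s t + e / 2))).
  apply: ler_rmean; first exact: continuous_cmod.
    by move=> t; apply: cvgD; [apply: cvgM; [exact: cvg_cst|exact: ck1]|exact: cvg_cst].
  move=> t ht; rewrite cmodM cmod_real ger0_norm ?kap_ge0//.
  have [near|far] := ltP (cmod (expi s - expi t)) d.
    rewrite -[leLHS]addr0; apply: lerD; last exact: ltW.
    rewrite ler_wpM2r ?kap_ge0// ltW// d1P//.
    by rewrite cmodB (lt_le_trans near)// ge_min lexx.
  rewrite -[leLHS]add0r; apply: lerD; first by rewrite mulr_ge0 ?kap_ge0// ltW.
  apply: le_trans nP; apply: ler_pM; rewrite ?cmod_ge0 ?kap_ge0//.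
    apply: le_trans (ler_cmodB _ _) _; rewrite mulr_natl mulr2n.
    by apply: lerD; exact: gB.
  exact: ler_kap_far (ltW d0) far.
rewrite rmeanD; last 2 first.
- by move=> t; apply: cvgM; [exact: cvg_cst|exact: ck1].
- by move=> t; exact: cvg_cst.
by rewrite rmeanZ// rmean_kap rmean_cst mulr1 -splitr.
Qed.

End CircleKernel.

(** * Polynomial approximation on circles inside the disc *)

Section HardyApprox.
Context (R : realType).
Local Notation C := R[i].

(** By compactness: pairs of angles violating uniform continuity would accumulate at a point of the
    circle of radius [r], where [h] is continuous. *)
Lemma circle_uc_holomorphic (h : C -> C) (r : R) : holomorphic_disc h ->
  0 < r -> r < 1 -> circle_uc (fun t => h (r%:C * expi t)).
Proof.
move=> hh r0 r1 e e0; apply: contrapT => nuc.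
have /choice[u uP] (n : nat) : exists st : R * R,
    [/\ 0 <= st.1 <= 2 * pi, 0 <= st.2 <= 2 * pi,
      cmod (expi st.1 - expi st.2) < n.+1%:R^-1 &
      e <= cmod (h (r%:C * expi st.1) - h (r%:C * expi st.2))].
  apply: contrapT => H; apply: nuc; exists n.+1%:R^-1; first by rewrite invr_gt0.
  move=> s t hs ht st; rewrite ltNge; apply/negP => he; apply: H.
  by exists (s, t).
have ub : bounded_fun (fun n => (u n).1).
  exists (2 * pi); split; first exact: num_real.
  move=> x px n _ /=; have [/andP[h1 h2] _ _ _] := uP n.
  by rewrite ger0_norm// (le_trans h2)// ltW.
have [f finc fcv] := bolzano_weierstrass ub.
set l := limn ((fun n => (u n).1) \o f).
have ld : unit_disc (r%:C * expi l : R[i]^o).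
  by rewrite /unit_disc /= cmodM cmod_expi mulr1 cmod_real gtr0_norm.
have [d d0 dP] := derivable_ccont (hh _ ld) (divr_gt0 e0 (ltr0n _ 2)).
have d2 : 0 < d / 2 by rewrite divr_gt0.
have /ccontP/(_ l _ d2)[d' d'0 d'P] := ccont_expi R.
have /cvgrPdist_lt/(_ _ d'0)[N1 _ hN1] := fcv.
pose N := maxn N1 (Num.bound (d / 2)^-1).
have sN : `|(u (f N)).1 - l| < d'.
  by rewrite distrC; apply: hN1 => /=; exact: leq_maxl.
have fN : (N <= f N)%N.
  elim: (N) => // k IH; apply: leq_ltn_trans IH _; rewrite ltnNge.
  by have := finc k.+1 k; rewrite /Order.le /= ltnn => ->.
have [_ _ st] := uP (f N); rewrite leNgt => /negP; apply.
set s := (u (f N)).1 in sN st *; set t := (u (f N)).2 in st *.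
have close w : cmod (expi w - expi l) < d ->
    cmod (h (r%:C * expi w) - h (r%:C * expi l)) < e / 2.
  move=> wl; apply: dP; rewrite -mulrBr cmodM cmod_real gtr0_norm//.
  by apply: le_lt_trans wl; rewrite -[leRHS]mul1r ler_wpM2r ?cmod_ge0// ltW.
have sl : cmod (expi s - expi l) < d / 2 by exact: d'P.
have st2 : cmod (expi s - expi t) < d / 2.
  apply: lt_trans st _; rewrite invf_plt ?posrE//.
  apply: lt_trans (archi_boundP _) _; first by rewrite invr_ge0 ltW.
  by rewrite ltr_nat ltnS; apply: leq_trans fN; exact: leq_maxr.
rewrite [e]splitr; apply: le_lt_trans (ler_cmod_dist (h (r%:C * expi l)) _ _) _.
apply: ltrD; first by apply: close; apply: lt_trans sl _; lra.
rewrite cmodB; apply: close; rewrite [d]splitr.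
apply: le_lt_trans (ler_cmod_dist (expi s) _ _) _.
by rewrite cmodB; apply: ltrD.
Qed.

Lemma ccont_bounded (g : R -> C) : ccont g -> exists B, forall t,
  0 <= t <= 2 * pi -> cmod (g t) <= B.
Proof.
move=> cg; have p0 : 0 <= 2 * pi :> R by rewrite mulr_ge0// pi_ge0.
have cc : {within `[0, 2 * pi], continuous (fun t => cmod (g t))}.
  by apply: continuous_subspaceT; exact: continuous_cmod.
have [c _ cP] := EVT_max p0 cc.
by exists (cmod (g c)) => t ht; apply: cP; rewrite in_itv.
Qed.

Lemma expi_mulJ (s : R) j n : (n <= j)%N ->
  expi s ^+ j * (expi s)^* ^+ n = expi s ^+ (j - n).
Proof.
by move=> nj; rewrite -{1}(subnK nj) exprD -mulrA -exprMn expiJr expr1n mulr1.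
Qed.

Lemma expi_mulJ_lt (s : R) j n : (j <= n)%N ->
  expi s ^+ j * (expi s)^* ^+ n = (expi s ^+ (n - j))^*.
Proof.
move=> jn; rewrite rmorphXn /= -{1}(subnK jn) addnC exprD mulrA -exprMn expiJr.
by rewrite expr1n mul1r.
Qed.

(** The terms [j < n] of the kernel carry the negative frequencies, and their coefficients are the
    means assumed to vanish. *)
Lemma conv_analytic n (g : R -> C) : ccont g ->
  (forall k, mean (fun t => g t * expi t ^+ k.+1) = 0) ->
  exists H : {poly C}, forall s, conv n g s = H.[expi s].
Proof.
move=> cg g0.
pose a j := mean (fun t => g t * (expi t ^+ (n.*2 - j) * (expi t)^* ^+ n)).
exists (('C(n.*2, n)%:R^-1)%:C *: \sum_(j < n.*2.+1)
  (if (n <= j)%N then ('C(n.*2, j)%:R * a j) *: 'X^(j - n) else 0)).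
move=> s; rewrite convE// hornerZ horner_sum; congr (_ * _).
apply: eq_bigr => j _; case: leqP => nj.
  by rewrite hornerZ hornerXn -/(a j) expi_mulJ// mulrAC.
rewrite horner0 -[RHS](mulr0 ('C(n.*2, j)%:R * (expi s ^+ j * (expi s)^* ^+ n))).
congr (_ * _).
have nj1 : (n.*2 - j = (n - j).-1.+1 + n)%N by move: (j : nat) nj => i; lia.
rewrite -(g0 (n - j).-1); apply: eq_mean => t; congr (_ * _).
by rewrite nj1 expi_mulJ ?leq_addl// addnK.
Qed.

(** Kernel means of a holomorphic function are polynomials in [expi s]; they play the part of Taylor
    polynomials. *)
Lemma holomorphic_poly_approx (h : C -> C) (r e : R) : holomorphic_disc h ->
  0 < r -> r < 1 -> 0 < e ->
  exists H : {poly C}, forall s, 0 <= s <= 2 * pi ->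
    cmod (H.[expi s] - h (r%:C * expi s)) <= e.
Proof.
move=> hh r0 r1 e0; pose g t := h (r%:C * expi t).
have cg : ccont g.
  apply: ccont_holomorphic => [//| |t].
    by apply: ccontM; [exact: ccont_cst|exact: ccont_expi].
  by rewrite cmodM cmod_expi mulr1 cmod_real gtr0_norm.
have [B gB] := ccont_bounded cg.
have ug : circle_uc g by exact: circle_uc_holomorphic.
have [n nP] := conv_approx cg ug gB e0.
have [k|H HE] := conv_analytic n cg.
  exact: mean_holomorphic_mulX.
by exists H => s hs; rewrite -HE; exact: nP.
Qed.

(** In a kernel mean of [L], conjugating the terms of negative frequency leaves the real part
    unchanged and produces a polynomial in [expi s]. *)
Lemma real_poly_approx (L : R -> R) (e : R) : continuous L ->
  circle_uc (fun t => (L t)%:C) -> 0 < e ->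
  exists Q : {poly C}, forall s, 0 <= s <= 2 * pi ->
    `|complex.Re Q.[expi s] - L s| <= e.
Proof.
move=> cL uL e0; have cg := ccont_real cL.
have [B gB] := ccont_bounded cg.
have [n nP] := conv_approx cg uL gB e0.
pose g t : C := (L t)%:C.
pose a j := mean (fun t => g t * (expi t ^+ (n.*2 - j) * (expi t)^* ^+ n)).
pose Q : {poly C} := ('C(n.*2, n)%:R^-1)%:C *: \sum_(j < n.*2.+1)
  (if (n <= j)%N then ('C(n.*2, j)%:R * a j) *: 'X^(j - n)
   else ('C(n.*2, j)%:R * (a j)^*) *: 'X^(n - j)).
exists Q => s hs; have := nP s hs; apply: le_trans.
have -> : complex.Re Q.[expi s] = complex.Re (conv n g s).
  rewrite /Q convE// hornerZ horner_sum !ReM /= !mul0r !subr0; congr (_ * _).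
  have ReS (I : finType) (F G : I -> C) : (forall i, complex.Re (F i) = complex.Re (G i)) ->
      complex.Re (\sum_i F i) = complex.Re (\sum_i G i).
    move=> FG; elim/big_rec2: _ => // i x y _ xy.
    by rewrite !ReD FG xy.
  apply: ReS => j; rewrite -/(a j).
  have -> : (if (n <= j)%N then ('C(n.*2, j)%:R * a j) *: 'X^(j - n)
     else ('C(n.*2, j)%:R * (a j)^*) *: 'X^(n - j)).[expi s] =
    if (n <= j)%N then 'C(n.*2, j)%:R * a j * expi s ^+ (j - n)
     else 'C(n.*2, j)%:R * (a j)^* * expi s ^+ (n - j).
    by case: ifP => _; rewrite hornerZ hornerXn.
  case: leqP => nj.
    by rewrite expi_mulJ// [in RHS]mulrAC.
  have -> : 'C(n.*2, j)%:R * (expi s ^+ j * (expi s)^* ^+ n) * a j =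
      ('C(n.*2, j)%:R * (a j)^* * expi s ^+ (n - j))^*.
    rewrite expi_mulJ_lt 1?ltnW//; move: (a j) (expi s ^+ _) => aj x.
    by rewrite !rmorphM rmorph_nat /= conjCK mulrAC.
  by rewrite [in RHS]conj_ReIm.
by rewrite -[L s]/(complex.Re (g s)) -ReB ler_Re_cmod.
Qed.

End HardyApprox.

(** * Logarithms of moduli on the circle *)

Section LogModulus.
Context (R : realType).
Local Notation C := R[i].

Lemma ler_cmod_expB (z w : C) n : cmod z <= 1 -> cmod w <= 1 ->
  cmod (z ^+ n - w ^+ n) <= n%:R * cmod (z - w).
Proof.
move=> z1 w1; elim: n => [|n IH]; first by rewrite !expr0 subrr cmod0 mul0r.
have -> : z ^+ n.+1 - w ^+ n.+1 = z * (z ^+ n - w ^+ n) + (z - w) * w ^+ n.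
  by rewrite !exprS; ring.
apply: le_trans (ler_cmodD _ _) _; rewrite !cmodM cmodX -[n.+1%:R]natr1 mulrDl mul1r.
apply: lerD.
  by apply: le_trans IH; rewrite -[leRHS]mul1r ler_wpM2r ?cmod_ge0.
rewrite -[leRHS]mulr1 ler_wpM2l ?cmod_ge0//.
by apply: exprn_ile1 => //; exact: cmod_ge0.
Qed.

Lemma poly_lipschitz (p : {poly C}) : exists2 K : R, 0 < K & forall z w,
  cmod z <= 1 -> cmod w <= 1 -> cmod (p.[z] - p.[w]) <= K * cmod (z - w).
Proof.
exists (1 + \sum_(i < size p) cmod p`_i * i%:R).
  by rewrite ltr_pwDl// sumr_ge0// => i _; rewrite mulr_ge0 ?cmod_ge0.
move=> z w z1 w1; rewrite !horner_coef -sumrB mulrDl mul1r.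
apply: le_trans (ler_cmod_sum _ _ _) _.
rewrite -[leLHS]add0r lerD ?cmod_ge0// mulr_suml ler_sum// => i _.
by rewrite -mulrBr cmodM -mulrA ler_wpM2l ?cmod_ge0// ler_cmod_expB.
Qed.

Lemma ler_dist_ln (e a b : R) : 0 < e -> e <= a -> e <= b ->
  `|ln a - ln b| <= `|a - b| / e.
Proof.
move=> e0.
have main x y : e <= x -> e <= y -> ln x - ln y <= `|x - y| / e.
  move=> ex ey; have x0 := lt_le_trans e0 ex; have y0 := lt_le_trans e0 ey.
  rewrite -ln_div ?posrE//.
  have h1 : ln (x / y) <= x / y - 1.
    have := expR_ge1Dx (ln (x / y)); rewrite lnK ?posrE ?divr_gt0//; lra.
  apply: le_trans h1 _.
  have -> : x / y - 1 = (x - y) / y by rewrite mulrBl divff ?gt_eqF.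
  apply: le_trans (_ : `|x - y| / y <= _).
    by rewrite ler_pM2r ?invr_gt0// ler_norm.
  by rewrite ler_wpM2l// lef_pV2 ?posrE.
move=> ea eb; rewrite ler_norml; apply/andP; split; last exact: main.
by rewrite -lerN2 opprB opprK distrC main.
Qed.

Lemma cmod_expi_le1 (s : R) : cmod (expi s) <= 1.
Proof. by rewrite cmod_expi. Qed.

(** The shift by [eps] keeps the logarithm Lipschitz across the zeros of [H]. The factor one half
    makes the squared modulus of [exp Q] comparable to [|H| + eps]. *)
Lemma log_modulus_approx (H : {poly C}) (eps e : R) : 0 < eps -> 0 < e ->
  exists Q : {poly C}, forall s, 0 <= s <= 2 * pi ->
    `|complex.Re Q.[expi s] - 2^-1 * ln (cmod H.[expi s] + eps)| <= e.
Proof.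
move=> eps0 e0; have [K K0 KP] := poly_lipschitz H.
have Lb s t : `|2^-1 * ln (cmod H.[expi s] + eps) - 2^-1 * ln (cmod H.[expi t] + eps)|
    <= K / eps * cmod (expi s - expi t).
  rewrite -mulrBr normrM ger0_norm ?invr_ge0//.
  have h1 : `|ln (cmod H.[expi s] + eps) - ln (cmod H.[expi t] + eps)| <=
      cmod (H.[expi s] - H.[expi t]) / eps.
    apply: le_trans (ler_dist_ln eps0 _ _) _; rewrite ?lerDr ?cmod_ge0//.
    rewrite ler_pM2r ?invr_gt0// (_ : _ - _ = cmod H.[expi s] - cmod H.[expi t]); last by ring.
    rewrite ler_norml; apply/andP; split.
      rewrite cmodB; have := ler_cmodD (H.[expi t] - H.[expi s]) H.[expi s].
      by rewrite subrK; lra.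
    by have := ler_cmodD (H.[expi s] - H.[expi t]) H.[expi t]; rewrite subrK; lra.
  have h2 := KP _ _ (cmod_expi_le1 s) (cmod_expi_le1 t).
  rewrite mulrAC; apply: le_trans (_ : cmod (H.[expi s] - H.[expi t]) / eps <= _).
    by apply: le_trans h1; rewrite ler_piMl// invf_le1// ler1n.
  by rewrite ler_pM2r ?invr_gt0.
apply: (real_poly_approx (L := fun s => 2^-1 * ln (cmod H.[expi s] + eps))) => //.
  apply/continuous_epsP => t a a0.
  have /ccontP/(_ t (a / (K / eps)))[] := @ccont_expi R; first by rewrite !divr_gt0.
  move=> d d0 dP; exists d => // s st; apply: le_lt_trans (Lb s t) _.
  by have := dP _ st; rewrite ltr_pdivlMr ?divr_gt0// mulrC.
move=> a a0; exists (a / (K / eps)); first by rewrite !divr_gt0.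
move=> s t _ _; rewrite ltr_pdivlMr ?divr_gt0// mulrC => st.
rewrite -rmorphB /= cmod_real; exact: le_lt_trans (Lb s t) st.
Qed.

End LogModulus.

(** * Factorization of analytic polynomials *)

Section ApproximateFactorization.
Context (R : realType).
Local Notation C := R[i].

Lemma ler_cmod_exp1B (x : C) (b : R) n : cmod (x - 1) <= b ->
  cmod (x ^+ n - 1) <= n%:R * b * expR (n%:R * b).
Proof.
move=> xb; have b0 : 0 <= b := le_trans (cmod_ge0 _) xb.
have x1 : cmod x <= expR b.
  apply: le_trans (expR_ge1Dx b); have := ler_cmodD (x - 1) 1.
  by rewrite subrK cmod1; lra.
elim: n => [|n IH]; first by rewrite expr0 subrr cmod0 !mul0r.
have -> : x ^+ n.+1 - 1 = x * (x ^+ n - 1) + (x - 1) by rewrite exprS; ring.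
apply: le_trans (ler_cmodD _ _) _; rewrite cmodM.
have -> : n.+1%:R * b * expR (n.+1%:R * b) =
    expR b * (n%:R * b * expR (n%:R * b)) + b * expR (n.+1%:R * b).
  by rewrite -natr1 !mulrDl !mul1r expRD; ring.
apply: lerD; first by apply: ler_pM => //; exact: cmod_ge0.
apply: le_trans xb _; rewrite ler_peMr// -expR0 ler_expR.
by rewrite mulr_ge0.
Qed.

Lemma ler_cmod_1D_exp (a : C) n :
  (cmod (1 + a) ^+ n) ^+ 2 <= expR (n%:R * (2 * complex.Re a + cmod a ^+ 2)).
Proof.
rewrite -exprM mulnC exprM expRM_natl lerXn2r ?nnegrE ?sqr_ge0 ?expR_ge0//.
apply: le_trans (expR_ge1Dx _).
by rewrite !cmod_sqr ReD ImD /=; lra.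
Qed.

(* With [Re Q] close to [ln (|H| + eps) / 2], the polynomials [(1 + Q / n) ^ n] and
   [H (1 - Q / n) ^ n] stand in for [exp Q] and [H exp (- Q)], which split [H] into
   two factors of equal modulus up to constants. *)
Lemma approx_factorization (H : {poly C}) (eps eta : R) : 0 < eps -> 0 < eta ->
  exists U V : {poly C}, forall s, 0 <= s <= 2 * pi ->
    [/\ cmod U.[expi s] ^+ 2 <= expR 1 * (cmod H.[expi s] + eps),
        cmod V.[expi s] ^+ 2 <= expR 1 * cmod H.[expi s] &
        cmod ((U * V).[expi s] - H.[expi s]) <= eta].
Proof.
move=> eps0 eta0.
(* Doubling the accuracy [1 / 4] of [Re Q] and adding [1 / 2] for the quadratic terms gives the
   exponent in [expR 1]. *)
have e4 : 0 < 4^-1 :> R by rewrite invr_gt0.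
have [Q QP] := log_modulus_approx H eps0 e4.
have [B QB] := ccont_bounded (ccont_poly_expi Q).
have [K HK] := ccont_bounded (ccont_poly_expi H).
have pi0 : 0 <= (0 : R) <= 2 * pi by rewrite lexx mulr_ge0 ?pi_ge0.
have K0 : 0 <= K := le_trans (cmod_ge0 _) (HK 0 pi0).
have B0 : 0 <= B := le_trans (cmod_ge0 _) (QB 0 pi0).
(* The first term makes the quadratic contribution at most [1 / 2], the second brings the error of
   the product below [eta]. *)
pose m := Num.bound (2 * B ^+ 2 + K * (B ^+ 2 * expR 1) / eta).
have mP : 2 * B ^+ 2 + K * (B ^+ 2 * expR 1) / eta < m.+1%:R.
  apply: lt_trans (archi_boundP _) _; last by rewrite ltr_nat.
  by rewrite addr_ge0 ?mulr_ge0 ?invr_ge0 ?expR_ge0 ?sqr_ge0// ltW.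
have m0 : 0 < m.+1%:R :> R by [].
move: (m.+1) mP m0 => n nP n0.
have n1 : n%:R^-1 * B ^+ 2 <= 2^-1.
  rewrite mulrC ler_pdivrMr//.
  have : 0 <= K * (B ^+ 2 * expR 1) / eta.
    by rewrite !mulr_ge0 ?invr_ge0 ?expR_ge0 ?sqr_ge0// ltW.
  move: nP; lra.
have n2 : K * (n%:R^-1 * B ^+ 2 * expR 1) <= eta.
  rewrite -mulrA mulrCA mulrC ler_pdivrMr// [leRHS]mulrC -ler_pdivrMr//.
  by have := sqr_ge0 B; move: nP; lra.
pose c : C := (n%:R^-1 : R)%:C.
exists ((1 + c *: Q) ^+ n), (H * (1 - c *: Q) ^+ n) => s hs.
set q := Q.[expi s]; set h := H.[expi s].
have qB : cmod q <= B := QB _ hs.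
have hK : cmod h <= K := HK _ hs.
have := QP _ hs; rewrite -/q -/h ler_distl => /andP[ql qu].
have he : 0 < cmod h + eps by rewrite ltr_wpDl ?cmod_ge0.
have cqB : n%:R * cmod (c * q) ^+ 2 <= 2^-1.
  rewrite cmodM cmod_real ger0_norm ?invr_ge0// exprMn [n%:R^-1 ^+ 2]expr2.
  rewrite !mulrA divff ?gt_eqF// mul1r; apply: le_trans n1.
  rewrite -mulrA -expr2 ler_wpM2l ?invr_ge0//.
  by rewrite lerXn2r ?nnegrE ?cmod_ge0.
have Recq : n%:R * complex.Re (c * q) = complex.Re q.
  by rewrite ReM /= mul0r subr0 mulrA divff ?gt_eqF// mul1r.
split.
- rewrite horner_exp hornerD hornerZ hornerC -/q cmodX.
  apply: le_trans (ler_cmod_1D_exp _ _) _.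
  rewrite -[X in _ <= _ * X](lnK (x := cmod h + eps)) ?posrE// -expRD ler_expR.
  by rewrite mulrDr mulrCA Recq; lra.
- rewrite hornerM horner_exp hornerD hornerN hornerZ hornerC -/q -/h cmodM cmodX.
  rewrite -mulNr exprMn.
  apply: le_trans (_ : cmod h ^+ 2 * (expR 1 / (cmod h + eps)) <= _).
    rewrite ler_wpM2l ?sqr_ge0// mulNr.
    apply: le_trans (ler_cmod_1D_exp _ _) _.
    rewrite -[X in _ <= _ / X](lnK (x := cmod h + eps)) ?posrE// -expRN -expRD ler_expR.
    have -> : complex.Re (- (c * q)) = - complex.Re (c * q) by case: (c * q).
    by rewrite cmodN mulrDr !mulrN mulrCA Recq; lra.
  rewrite mulrCA ler_wpM2l ?expR_ge0// expr2 -mulrA ler_piMr ?cmod_ge0//.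
  by rewrite ler_pdivrMr// mul1r lerDl ltW.
(* The two powers do not cancel exactly: their product is the [n]-th power of [1 - (Q / n) ^+ 2],
   which differs from [1] by an error of order [1 / n]. *)
- have -> : ((1 + c *: Q) ^+ n * (H * (1 - c *: Q) ^+ n)).[expi s] - h =
      h * ((1 - (c * q) ^+ 2) ^+ n - 1).
    rewrite !hornerM !horner_exp !hornerD hornerN hornerZ hornerC -/q -/h.
    rewrite mulrBr mulr1 mulrCA -exprMn; congr (_ * _ ^+ _ - _); ring.
  rewrite cmodM; apply: le_trans n2.
  apply: ler_pM; rewrite ?cmod_ge0//.
  have /(ler_cmod_exp1B n) : cmod (1 - (c * q) ^+ 2 - 1) <= n%:R^-1 ^+ 2 * B ^+ 2.
    rewrite addrAC subrr sub0r cmodN cmodX -exprMn lerXn2r ?nnegrE ?cmod_ge0 ?mulr_ge0 ?invr_ge0//.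
    by rewrite cmodM cmod_real ger0_norm ?invr_ge0// ler_wpM2l ?invr_ge0.
  have -> : n%:R * (n%:R^-1 ^+ 2 * B ^+ 2) = n%:R^-1 * B ^+ 2.
    by rewrite expr2 !mulrA divff ?gt_eqF// mul1r.
  move=> h1; apply: le_trans h1 _; rewrite ler_wpM2l ?mulr_ge0 ?invr_ge0 ?sqr_ge0//.
  by rewrite ler_expR; apply: le_trans n1 _; rewrite invf_le1// ler1n.
Qed.

End ApproximateFactorization.

(** * Hankel matrices *)

Section HankelFactorizations.
Context (R : realType).
Local Notation C := R[i].

(* The square sum on the left is the mean of [g / F * Y * Z] for two polynomials
   in [(expi t)^*] whose mean squares are the two sides. *)
Lemma hankel_contraction (g : R -> C) (F : R) M (y : 'I_M -> C) : ccont g -> 0 < F ->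
  (forall t, 0 <= t <= 2 * pi -> cmod (g t) <= F) ->
  \sum_(a < M) cmod (\sum_(b < M)
     mean (fun t => g t * (expi t)^* ^+ (a + b)) / F%:C * y b) ^+ 2 <=
  \sum_(b < M) cmod (y b) ^+ 2.
Proof.
move=> cg F0 gF.
pose x (a : 'I_M) := \sum_(b < M)
  mean (fun t => g t * (expi t)^* ^+ (a + b)) / F%:C * y b.
pose Y : {poly C} := \sum_(b < M) (y b)^* *: 'X^b.
pose Z : {poly C} := \sum_(a < M) x a *: 'X^a.
have sizeM (w : 'I_M -> C) : (size (\sum_(b < M) w b *: 'X^b)%R <= M)%N.
  apply: (big_ind (fun p : {poly C} => (size p <= M)%N)).
  - by rewrite size_poly0.
  - by move=> p q hp hq; apply: leq_trans (size_polyD _ _) _; rewrite geq_max hp.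
  - by move=> b _; apply: leq_trans (size_scale_leq _ _) _; rewrite size_polyXn.
have coefM (w : 'I_M -> C) (b : 'I_M) : (\sum_(b < M) w b *: 'X^b)`_b = w b.
  rewrite coef_sum (bigD1 b)//= coefZ coefXn eqxx mulr1 big1 ?addr0// => c cb.
  by rewrite coefZ coefXn eq_sym (inj_eq val_inj) (negbTE cb) mulr0.
have PY : rmean (fun t => cmod Y.[expi t] ^+ 2) = \sum_(b < M) cmod (y b) ^+ 2.
  by rewrite (parseval (sizeM _)); apply: eq_bigr => b _; rewrite coefM cmodJ.
have PZ : rmean (fun t => cmod Z.[expi t] ^+ 2) = \sum_(b < M) cmod (x b) ^+ 2.
  by rewrite (parseval (sizeM _)); apply: eq_bigr => b _; rewrite coefM.
pose G t := g t / F%:C * (Y.[expi t])^* * (Z.[expi t])^*.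
have cG : ccont G.
  apply: ccontM; last by apply: ccontJ; exact: ccont_poly_expi.
  apply: ccontM; last by apply: ccontJ; exact: ccont_poly_expi.
  by apply: ccontM => //; exact: ccont_cst.
have SE : (\sum_(a < M) cmod (x a) ^+ 2)%:C = mean G.
  have GE : G =1 fun t => \sum_(a < M) \sum_(b < M)
      ((x a)^* * (y b / F%:C)) * (g t * (expi t)^* ^+ (a + b)).
    move=> t; rewrite /G /Y /Z !horner_sum !rmorph_sum /= mulr_sumr.
    apply: eq_bigr => a _; rewrite mulr_sumr mulr_suml; apply: eq_bigr => b _.
    rewrite !hornerZ !hornerXn; move: (x a) (y b) (expi t) (g t) F%:C => xa yb w gt f.
    by rewrite !rmorphM !rmorphXn /= conjCK exprD; ring.
  rewrite (eq_mean GE) mean_sum => [|a]; last first.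
    apply: ccont_sum => b; apply: ccontM; first exact: ccont_cst.
    by apply: ccontM => //; exact: ccont_expiJX.
  rewrite rmorph_sum /=; apply: eq_bigr => a _.
  rewrite mean_sum => [|b]; last first.
    apply: ccontM; first exact: ccont_cst.
    by apply: ccontM => //; exact: ccont_expiJX.
  rewrite cmod_sqrC [in LHS]mulrC {2}/x mulr_sumr; apply: eq_bigr => b _.
  rewrite meanZ; last by apply: ccontM => //; exact: ccont_expiJX.
  by move: (x a)^* => xa; ring.
have cc p : continuous (fun t : R => cmod (p.[expi t] : C) ^+ 2).
  have := continuous_cmod (ccont_poly_expi p) => cp t.
  by apply: (cvgM (cp t) (cp t)).
have S0 : 0 <= \sum_(a < M) cmod (x a) ^+ 2 by rewrite sumr_ge0// => a _; exact: sqr_ge0.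
(* Pointwise, [2 u v <= u ^+ 2 + v ^+ 2]; the half that involves [x] is absorbed by the left
   side. *)
suff : \sum_(a < M) cmod (x a) ^+ 2 <=
    2^-1 * \sum_(b < M) cmod (y b) ^+ 2 + 2^-1 * \sum_(a < M) cmod (x a) ^+ 2.
  by rewrite -/x; lra.
rewrite -{1}[X in X <= _]ger0_norm// -cmod_real SE -PY -PZ.
apply: le_trans (ler_cmod_mean cG) _.
have cZ p : continuous (fun t : R => 2^-1 * cmod (p.[expi t] : C) ^+ 2).
  by move=> t; apply: cvgM; [exact: cvg_cst|exact: cc].
rewrite -!rmeanZ// -rmeanD//.
apply: ler_rmean; first exact: continuous_cmod.
  by move=> t; apply: cvgD; exact: cZ.
move=> t ht; rewrite /G !cmodM !cmodJ cmodV cmod_real gtr0_norm//.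
set u := cmod _.[_]; set v := cmod _.[_].
have u0 : 0 <= u := cmod_ge0 _; have v0 : 0 <= v := cmod_ge0 _.
apply: le_trans (_ : u * v <= _); last by have := sqr_ge0 (u - v); lra.
by rewrite -mulrA ler_piMl ?mulr_ge0// ler_pdivrMr// mul1r gF.
Qed.

Lemma factored_of_finType (I : finType) (row col : I -> C) (mid : I -> I -> C)
    (e1 e2 : I -> nat) (c : R) :
  \sum_i cmod (row i) ^+ 2 <= c ^+ 2 -> \sum_i cmod (col i) ^+ 2 <= c ^+ 2 ->
  (forall y : I -> C, \sum_i cmod (\sum_j mid i j * y j) ^+ 2 <=
     \sum_j cmod (y j) ^+ 2) ->
  exists2 a : factored R, fbounded c a &
    fpoly a = \sum_i \sum_j (row i * mid i j * col j) *: 'X^(e1 i + e2 j).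
Proof.
move=> hr hc hm; pose v (i : 'I_#|I|) := enum_val i.
exists (Factored (row \o v) (fun i j => mid (v i) (v j)) (col \o v) (e1 \o v) (e2 \o v)).
  have re (F : I -> R) : \sum_i F (v i) = \sum_i F i.
    by rewrite (reindex v)//; apply: onW_bij; exact: enum_val_bij.
  split => /=; first by rewrite (re (fun i => cmod (row i) ^+ 2)).
    by rewrite (re (fun i => cmod (col i) ^+ 2)).
  move=> y; have := hm (fun i => y (enum_rank i)).
  rewrite -(re (fun i => cmod (y (enum_rank i)) ^+ 2)) -re.
  under [X in _ <= X -> _]eq_bigr do rewrite /v enum_valK.
  apply: le_trans; rewrite le_eqVlt; apply/orP; left; apply/eqP.
  apply: eq_bigr => i _; congr (cmod _ ^+ 2).
  rewrite [RHS](reindex v)/=; last by apply: onW_bij; exact: enum_val_bij.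
  by apply: eq_bigr => j _; rewrite /v enum_valK.
rewrite /fpoly /= [RHS](reindex v)/=; last by apply: onW_bij; exact: enum_val_bij.
apply: eq_bigr => i _.
by rewrite [RHS](reindex v)/=; last by apply: onW_bij; exact: enum_val_bij.
Qed.

Lemma factored_of_coef (e : {poly C}) n (c : R) : (size e <= n)%N ->
  \sum_(m < n) cmod e`_m <= c ^+ 2 ->
  exists2 a : factored R, fbounded c a & fpoly a = e.
Proof.
move=> en ec.
(* Each coefficient is shared evenly in modulus, the column taking the phase. At a zero coefficient
   the quotient by zero is [0], the right value. *)
pose row (m : 'I_n) : C := (Num.sqrt (cmod e`_m))%:C.
pose col (m : 'I_n) : C := e`_m / row m.
have rowE m : cmod (row m) ^+ 2 = cmod e`_m.
  by rewrite cmod_real ger0_norm ?sqrtr_ge0// sqr_sqrtr ?cmod_ge0.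
have rc m : row m * col m = e`_m.
  have [r0|r0] := eqVneq (row m) 0; last by rewrite /col mulrCA divff// mulr1.
  by rewrite r0 mul0r; apply/esym/eqP; rewrite -cmod_eq0 -rowE r0 cmod0 expr0n.
have colE m : cmod (col m) ^+ 2 <= cmod e`_m.
  have [r0|r0] := eqVneq (row m) 0.
    by rewrite /col r0 invr0 mulr0 cmod0 expr0n cmod_ge0.
  have p0 : 0 < cmod (row m) ^+ 2 by rewrite exprn_gt0// lt0r cmod_eq0 r0 cmod_ge0.
  by rewrite -(ler_pM2l p0) -exprMn -cmodM rc rowE expr2.
have [||y|a ab aE] := @factored_of_finType 'I_n row col (fun i j => (i == j)%:R)
    (fun i => i) (fun=> 0%N) c.
- by under eq_bigr do rewrite rowE.
- by apply: le_trans ec; apply: ler_sum => m _; exact: colE.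
- rewrite le_eqVlt; apply/orP; left; apply/eqP; apply: eq_bigr => i _.
  congr (cmod _ ^+ 2); rewrite (bigD1 i)//= eqxx mul1r big1 ?addr0// => j ji.
  by rewrite eq_sym (negbTE ji) mul0r.
exists a => //; rewrite aE; apply/polyP => m; rewrite coef_sum.
under eq_bigr => i _.
  rewrite (bigD1 i)//= big1 => [|j ji]; last by rewrite eq_sym (negbTE ji) mulr0 mul0r scale0r.
  rewrite eqxx mulr1 addr0 addn0 rc coefZ coefXn; over.
have [mn|nm] := ltnP m n; last first.
  rewrite big1 => [|i _]; first by rewrite nth_default// (leq_trans en).
  by rewrite gtn_eqF ?mulr0//; apply: leq_trans nm.
rewrite (bigD1 (Ordinal mn))//= eqxx mulr1 big1 ?addr0// => i im.
by rewrite -(inj_eq val_inj) eq_sym /= in im; rewrite (negbTE im) mulr0.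
Qed.

Lemma sum_pairs (V : nmodType) (I J : finType) (G : I * J -> V) :
  \sum_i G i = \sum_i \sum_j G (i, j).
Proof. by rewrite pair_bigA; apply: eq_bigr => -[]. Qed.

(** The middle matrix is block diagonal in [k], each block being the Hankel matrix of [g k] divided
    by [F k]. Row and column each take a factor [sqrt (F k)] in exchange, and the dilation splits as
    [r ^+ a * r ^+ b]. *)
Lemma factored_of_symbols K (g : 'I_K -> R -> C) (F : 'I_K -> R) (U V : 'I_K -> {poly C})
    (r c : R) : 0 <= r -> r <= 1 ->
  (forall k, ccont (g k)) -> (forall k, 0 < F k) ->
  (forall k t, 0 <= t <= 2 * pi -> cmod (g k t) <= F k) ->
  \sum_k F k * rmean (fun t => cmod (U k).[expi t] ^+ 2) <= c ^+ 2 ->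
  \sum_k F k * rmean (fun t => cmod (V k).[expi t] ^+ 2) <= c ^+ 2 ->
  exists2 a : factored R, fbounded c a &
    forall m, (fpoly a)`_m = r%:C ^+ m *
      \sum_k mean (fun t => g k t * (expi t)^* ^+ m) * (U k * V k)`_m.
Proof.
move=> r0 r1 cg F0 gF hU hV.
pose M := \max_k maxn (size (U k)) (size (V k)).
have UM k : (size (U k) <= M)%N.
  by apply: leq_trans (leq_bigmax k); exact: leq_maxl.
have VM k : (size (V k) <= M)%N.
  by apply: leq_trans (leq_bigmax k); exact: leq_maxr.
pose w (W : 'I_K -> {poly C}) (i : 'I_K * 'I_M) : C :=
  (Num.sqrt (F i.1) * r ^+ i.2)%:C * (W i.1)`_i.2.
pose ghat k m := mean (fun t => g k t * (expi t)^* ^+ m).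
pose mid (i j : 'I_K * 'I_M) : C :=
  if i.1 == j.1 then ghat i.1 (i.2 + j.2)%N / (F i.1)%:C else 0.
have wE (W : 'I_K -> {poly C}) : (forall k, (size (W k) <= M)%N) ->
    \sum_k F k * rmean (fun t => cmod (W k).[expi t] ^+ 2) <= c ^+ 2 ->
    \sum_i cmod (w W i) ^+ 2 <= c ^+ 2.
  move=> WM; apply: le_trans.
  rewrite sum_pairs; apply: ler_sum => k _.
  rewrite (parseval (WM k)) mulr_sumr; apply: ler_sum => a _.
  rewrite cmodM cmod_real exprMn ger0_norm ?mulr_ge0 ?sqrtr_ge0 ?exprn_ge0//.
  rewrite exprMn sqr_sqrtr ?(ltW (F0 _))// ler_wpM2r ?sqr_ge0// ler_piMr ?(ltW (F0 _))//.
  by rewrite -exprM exprn_ile1.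
have [||y|a ab aE] := @factored_of_finType _ (w U) (w V) mid
    (fun i => i.2) (fun i => i.2) c; [exact: wE|exact: wE| |].
  rewrite sum_pairs.
  rewrite sum_pairs; apply: ler_sum => k _.
  apply: le_trans (hankel_contraction (fun b => y (k, b)) (cg k) (F0 k) (gF k)).
  rewrite le_eqVlt; apply/orP; left; apply/eqP; apply: eq_bigr => a _.
  congr (cmod _ ^+ 2); rewrite sum_pairs.
  rewrite (bigD1 k)//= [X in _ + X]big1 ?addr0 => [|l lk].
    by apply: eq_bigr => b _; rewrite /mid /= eqxx.
  by apply: big1 => b _; rewrite /mid /= eq_sym (negbTE lk) mul0r.
exists a => // m; rewrite {}aE.
rewrite sum_pairs.
rewrite coef_sum mulr_sumr; apply: eq_bigr => k _.
have WE (W : {poly C}) : (size W <= M)%N -> W = \sum_(a < M) W`_a *: 'X^a.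
  move=> sW; rewrite -[LHS]coefK poly_def (big_ord_widen M (fun i => W`_i *: 'X^i))//.
  rewrite big_mkcond /=; apply: eq_bigr => i _; case: ltnP => // sWi.
  by rewrite nth_default// scale0r.
rewrite [in RHS](WE _ (UM k)) [in RHS](WE _ (VM k)) mulr_suml !coef_sum !mulr_sumr.
apply: eq_bigr => b _; rewrite mulr_sumr coef_sum.
rewrite sum_pairs.
rewrite (bigD1 k)//= [X in _ + X]big1 ?addr0 => [|l lk]; last first.
  by apply: big1 => b' _; rewrite /mid /= eq_sym (negbTE lk) mulr0 mul0r scale0r coef0.
rewrite coef_sum !mulr_sumr; apply: eq_bigr => b' _.
have -> : (U k)`_b *: 'X^b * ((V k)`_b' *: 'X^b') =
    ((U k)`_b * (V k)`_b') *: 'X^(b + b') :> {poly C}.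
  by rewrite -scalerAl -scalerAr -exprD scalerA.
rewrite !coefZ coefXn /mid /w /= eqxx.
case: eqP => [->|_]; last by rewrite !mulr0.
rewrite !mulr1 -/(ghat k _) exprD !rmorphM !rmorphXn /=.
have FE : (Num.sqrt (F k))%:C * (Num.sqrt (F k))%:C = (F k)%:C :> C.
  by rewrite -rmorphM /= -expr2 sqr_sqrtr// ltW.
have Fn : (F k)%:C != 0 :> C by rewrite fmorph_eq0 gt_eqF.
move: (ghat k _) (U k)`_b (V k)`_b' r%:C => G u v x.
transitivity ((Num.sqrt (F k))%:C * (Num.sqrt (F k))%:C / (F k)%:C *
   (x ^+ b * x ^+ b' * (G * (u * v)))); first by field.
by rewrite FE divff// mul1r.
Qed.

End HankelFactorizations.

(** * Convolution with boundary values *)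

Section StarEstimates.
Context (R : realType).
Local Notation C := R[i].
Local Notation mu := (@lebesgue_measure R).

Lemma circle_angle_sub (a s : R) : 0 <= a <= 2 * pi -> 0 <= s <= 2 * pi ->
  exists2 u, 0 <= u <= 2 * pi & expi u = expi (a - s).
Proof.
move=> ha hs; have [sa|sa] := leP s a; first by exists (a - s) => //; lra.
exists (a - s + 2 * pi); first by lra.
by rewrite expiD expi_2pi mulr1.
Qed.

Lemma Re_mean (g : R -> C) : complex.Re (mean g) = rmean (fun t => complex.Re (g t)).
Proof. by rewrite /mean ReM /= mul0r subr0. Qed.

(* The coefficients are those of the convolution of [g] with [p]. *)
Definition convp (g : R -> C) (p : {poly C}) : {poly C} :=
  \poly_(j < size p) (mean (fun s => g s * (expi s)^* ^+ j) * p`_j).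

Lemma coef_convp g p m : (convp g p)`_m = mean (fun s => g s * (expi s)^* ^+ m) * p`_m.
Proof. by rewrite coef_poly; case: ltnP => // pm; rewrite nth_default// mulr0. Qed.

Lemma mean_convp (g : R -> C) (p : {poly C}) (w : C) : ccont g ->
  mean (fun s => g s * p.[w * (expi s)^*]) = (convp g p).[w].
Proof.
move=> cg; have E : (fun s => g s * p.[w * (expi s)^*]) =1 fun s =>
    \sum_(j < size p) (p`_j * w ^+ j) * (g s * (expi s)^* ^+ j).
  move=> s; rewrite horner_coef mulr_sumr; apply: eq_bigr => j _.
  by rewrite exprMn; ring.
have cj j : ccont (fun s => g s * (expi s)^* ^+ j).
  by apply: ccontM => //; exact: ccont_expiJX.
rewrite (eq_mean E) mean_sum => [|j]; last by apply: ccontM => //; exact: ccont_cst.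
rewrite horner_poly; apply: eq_bigr => j _; rewrite meanZ//.
by rewrite mulrC mulrA.
Qed.

Lemma continuous_subl (L : R -> R) a : continuous L -> continuous (fun s => L (a - s)).
Proof.
move=> cL s; apply: continuous_comp; last exact: cL.
by apply: cvgB; [exact: cvg_cst|exact: cvg_id].
Qed.

(* Both means are within [e / 2] of the real part of the constant coefficient of a
   polynomial [Q] with [Re Q] uniformly close to [L] on the circle. *)
Lemma rmean_reflect (L : R -> R) (a : R) : continuous L ->
  circle_uc (fun t => (L t)%:C) -> (forall s t, expi s = expi t -> L s = L t) ->
  0 <= a <= 2 * pi -> rmean (fun s => L (a - s)) = rmean L.
Proof.
move=> cL uL pL ha; apply/eqP; rewrite -subr_eq0 -normr_le0.
apply/ler_addgt0Pr => e e0; rewrite add0r.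
have e2 : 0 < e / 2 by rewrite divr_gt0.
have [Q QP] := real_poly_approx cL uL e2.
have near_mean (f1 f2 : R -> R) : continuous f1 -> continuous f2 ->
    (forall t, 0 <= t <= 2 * pi -> `|f1 t - f2 t| <= e / 2) ->
    `|rmean f1 - rmean f2| <= e / 2.
  move=> c1 c2 h; rewrite ler_distl; apply/andP; split.
    rewrite lerBlDr -(rmean_cst (e / 2)) -rmeanD//; last by move=> ?; exact: cvg_cst.
    apply: ler_rmean => //; first by move=> t; apply: cvgD; [exact: c1|exact: cvg_cst].
    by move=> t /h; rewrite ler_distl; lra.
  rewrite -[leRHS](_ : rmean (fun t => f2 t + e / 2) = _); last first.
    by rewrite rmeanD// ?rmean_cst// => ?; exact: cvg_cst.
  apply: ler_rmean => //; first by move=> t; apply: cvgD; [exact: c2|exact: cvg_cst].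
  by move=> t /h; rewrite ler_distl; lra.
have cQ : ccont (fun s => Q.[expi a * (expi s)^*]).
  by apply: ccont_horner; apply: ccontM; [exact: ccont_cst|apply: ccontJ; exact: ccont_expi].
have h1 : `|complex.Re Q`_0 - rmean L| <= e / 2.
  have -> : complex.Re Q`_0 = rmean (fun s => complex.Re Q.[expi s]).
    rewrite -(mean_coef Q 0) Re_mean; congr rmean; apply/funext => s.
    by rewrite expr0 mulr1.
  by apply: near_mean => //; exact: (ccont_poly_expi Q).1.
have h2 : `|complex.Re Q`_0 - rmean (fun s => L (a - s))| <= e / 2.
  have -> : complex.Re Q`_0 = rmean (fun s => complex.Re Q.[expi a * (expi s)^*]).
    rewrite -Re_mean.
    have /eq_mean -> : (fun s => Q.[expi a * (expi s)^*]) =1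
        fun s => 1 * Q.[expi a * (expi s)^*] by move=> s; rewrite mul1r.
    rewrite mean_convp; last exact: ccont_cst.
    have -> : convp (fun=> 1) Q = (Q`_0)%:P; last by rewrite hornerC.
    apply/polyP => m; rewrite coef_convp coefC.
    have /eq_mean -> : (fun s => 1 * (expi s)^* ^+ m) =1
        fun s : R => expi s ^+ 0 * (expi s)^* ^+ m by move=> s; rewrite expr0.
    by rewrite mean_expi; case: m => [|m] /=; rewrite ?mul1r ?mul0r.
  apply: near_mean; [exact: cQ.1|exact: continuous_subl|].
  move=> s hs; have [u hu uE] := circle_angle_sub ha hs.
  by rewrite -expiN -expiD -uE -(pL _ _ uE); exact: QP.
rewrite [e]splitr -[_ - _](_ : rmean (fun s => L (a - s)) - complex.Re Q`_0 +
   (complex.Re Q`_0 - rmean L) = _); last by ring.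
by apply: le_trans (ler_normD _ _) _; apply: lerD => //; rewrite distrC.
Qed.

Lemma ccont_CT (f : C -> C) : CT f -> ccont (fun t => f (expi t)).
Proof.
move=> /subspace_continuousP cf; apply/ccontP => t e e0.
have e0' : (0 : C) < e%:C by rewrite ltcR.
have /cvgrPdist_lt/(_ _ e0')/nbhs_ballP[d d0 dP] := cf _ (cmod_expi t).
have dE : d = (complex.Re d)%:C by rewrite RRe_real// gtr0_real.
have d0' : 0 < complex.Re d by rewrite -ltcR -dE.
have /ccontP/(_ t _ d0')[d' d'0 d'P] := ccont_expi R.
exists d' => // s /d'P st.
have hb : `|expi t - expi s : C| < d by rewrite normcmodE dE ltcR cmodB.
have : `|f (expi t) - f (expi s) : C| < e%:C := dP (expi s) hb (cmod_expi s).
by rewrite normcmodE ltcR cmodB.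
Qed.

Lemma rmean_H1 (h : C -> C) (h1 r : R) : holomorphic_disc h -> H1_norm h = h1%:E ->
  0 <= r -> r < 1 -> rmean (fun t => cmod (h (r%:C * expi t))) <= h1.
Proof.
move=> hh hE r0 r1.
have cg : ccont (fun t => h (r%:C * expi t)).
  apply: ccont_holomorphic => [//| |t].
    by apply: ccontM; [exact: ccont_cst|exact: ccont_expi].
  by rewrite cmodM cmod_expi mulr1 cmod_real ger0_norm.
have itg := continuous_integrable_itv 0 (2 * pi) (continuous_cmod cg).
rewrite -lee_fin -hE /rmean EFinM /Rintegral fineK; last exact: integrable_fin_num.
by apply: ereal_sup_ubound; exists r => //=; rewrite r0.
Qed.

Section Star.
Variables (f h : C -> C) (F h1 r : R).
Hypotheses (cf : CT f) (hh : holomorphic_disc h).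
Hypotheses (fF : sup_norm f = F%:E) (hE : H1_norm h = h1%:E).
Hypotheses (r0 : 0 < r) (r1 : r < 1).

Lemma cmod_le_sup_norm t : cmod (f (expi t)) <= F.
Proof.
rewrite -lee_fin -fF; apply: ereal_sup_ubound; exists (expi t) => //.
exact: cmod_expi.
Qed.

Lemma sup_norm_real_ge0 : 0 <= F.
Proof. exact: le_trans (cmod_ge0 _) (cmod_le_sup_norm 0). Qed.

Let ccf : ccont (fun t => f (expi t)).
Proof. exact: ccont_CT. Qed.

Let arg_lt1 (a s : R) : cmod (expi (- s) * (r%:C * expi a)) < 1.
Proof. by rewrite !cmodM !cmod_expi mul1r mulr1 cmod_real gtr0_norm. Qed.

Let argE (a s : R) : expi (- s) * (r%:C * expi a) = r%:C * expi (a - s).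
Proof. by rewrite mulrCA -expiD [- s + a]addrC. Qed.

(** Since [r < 1], the argument of [h] stays in the open disc, where [boundary_ext h] is [h]. *)
Lemma starE a : star f h (r%:C * expi a) =
  mean (fun s => f (expi s) * h (r%:C * expi (a - s))).
Proof.
rewrite /star -/(mean _); apply: eq_mean => s.
by rewrite /boundary_ext arg_lt1 argE.
Qed.

Let cch a : ccont (fun s => h (r%:C * expi (a - s))).
Proof.
have -> : (fun s => h (r%:C * expi (a - s))) = fun s => h (expi (- s) * (r%:C * expi a)).
  by apply/funext => s; rewrite argE.
apply: ccont_holomorphic => [//| |s]; last exact: arg_lt1.
apply: ccontM; last exact: ccont_cst.
have -> : (fun s : R => expi (- s)) = fun s => (expi s)^*.
  by apply/funext => s; rewrite expiN.
by apply: ccontJ; exact: ccont_expi.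
Qed.

Let cch0 : ccont (fun s => h (r%:C * expi s)).
Proof.
apply: ccont_holomorphic => [//| |s].
  by apply: ccontM; [exact: ccont_cst|exact: ccont_expi].
by rewrite cmodM cmod_expi mulr1 cmod_real gtr0_norm.
Qed.

(** Young's inequality for a sup norm and an integral norm; [rmean_reflect] undoes the change of
    variable from [a - s] to [s]. *)
Lemma ler_cmod_star a : 0 <= a <= 2 * pi ->
  cmod (star f h (r%:C * expi a)) <= F * h1.
Proof.
move=> ha; rewrite starE; apply: le_trans (ler_cmod_mean _) _; first exact: ccontM.
apply: le_trans (_ : rmean (fun s => F * cmod (h (r%:C * expi (a - s)))) <= _).
  apply: ler_rmean; first by apply: continuous_cmod; exact: ccontM.
    move=> t; apply: cvgM; [exact: cvg_cst|exact: (continuous_cmod (cch a))].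
  by move=> t _; rewrite cmodM ler_wpM2r ?cmod_ge0// cmod_le_sup_norm.
rewrite rmeanZ; last exact: continuous_cmod (cch a).
rewrite ler_wpM2l ?sup_norm_real_ge0//.
rewrite (rmean_reflect (L := fun s => cmod (h (r%:C * expi s)))) //.
- by apply: rmean_H1 => //; exact: ltW.
- exact: continuous_cmod.
- move=> e e0; have [d d0 dP] := circle_uc_holomorphic hh r0 r1 e0.
  exists d => // s t hs ht st; have := dP s t hs ht st; apply: le_lt_trans.
  rewrite -rmorphB /= cmod_real ler_norml; apply/andP; split.
    have := ler_cmodD (h (r%:C * expi t) - h (r%:C * expi s)) (h (r%:C * expi s)).
    by rewrite subrK [cmod (h _ - h (_ * expi s))]cmodB; lra.
  have := ler_cmodD (h (r%:C * expi s) - h (r%:C * expi t)) (h (r%:C * expi t)).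
  by rewrite subrK; lra.
- by move=> s t ->.
Qed.

Lemma star_poly_approx (e : R) : 0 < e -> exists2 H : {poly C},
  rmean (fun s => cmod H.[expi s]) <= h1 + e &
  forall a, 0 <= a <= 2 * pi ->
    cmod (star f h (r%:C * expi a) - (convp (fun s => f (expi s)) H).[expi a]) <= F * e.
Proof.
move=> e0; have [H HP] := holomorphic_poly_approx hh r0 r1 e0; exists H.
  apply: le_trans (_ : rmean (fun s => cmod (h (r%:C * expi s)) + e) <= _).
    apply: ler_rmean; first exact: continuous_cmod (ccont_poly_expi H).
      by move=> t; apply: cvgD; [exact: (continuous_cmod cch0)|exact: cvg_cst].
    move=> t ht; have := HP t ht.
    have := ler_cmodD (H.[expi t] - h (r%:C * expi t)) (h (r%:C * expi t)).
    by rewrite subrK; lra.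
  rewrite rmeanD ?rmean_cst ?lerD2r; [|exact: (continuous_cmod cch0)|by move=> t; exact: cvg_cst].
  by apply: rmean_H1 => //; exact: ltW.
move=> a ha; rewrite starE -mean_convp// -meanB.
- apply: ler_cmod_mean_cst.
    apply: ccontB; apply: ccontM => //.
    by apply: ccont_horner; apply: ccontM; [exact: ccont_cst|apply: ccontJ; exact: ccont_expi].
  move=> s hs; rewrite -mulrBr cmodM ler_pM ?cmod_ge0 ?cmod_le_sup_norm//.
  have [u hu uE] := circle_angle_sub ha hs.
  by rewrite -expiN -expiD -uE cmodB; exact: HP.
- exact: ccontM.
- apply: ccontM => //.
  by apply: ccont_horner; apply: ccontM; [exact: ccont_cst|apply: ccontJ; exact: ccont_expi].
Qed.

End Star.

End StarEstimates.

(** * Factorization in the disc algebra *)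

Section DiscAlgebraFactorization.
Context (R : realType).
Local Notation C := R[i].

Lemma unit_circle_expi (z : C) : cmod z = 1 -> exists2 t : R, 0 <= t <= 2 * pi & z = expi t.
Proof.
move=> z1; have := cmod_sqr z; rewrite z1 expr1n; case: z z1 => x y _ /= xy.
have x1 : -1 <= x <= 1.
  by rewrite -ler_norml -(expr_le1 (n := 2))// real_normK ?num_real//; have := sqr_ge0 y; lra.
have ca := acosK x1; have sa := sin_acos x1.
have := acos_ge0 x1; have := acos_lepi x1; have := pi_ge0 R; move=> p0 a1 a0.
have [y0|y0] := leP 0 y.
  exists (acos x); first by lra.
  rewrite /expi ca sa (_ : 1 - x ^+ 2 = y ^+ 2) ?sqrtr_sqr ?ger0_norm//; lra.
exists (2 * pi - acos x); first by lra.
rewrite expiD expi_2pi mul1r expiN conj_ReIm /= ca sa.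
rewrite (_ : 1 - x ^+ 2 = y ^+ 2) ?sqrtr_sqr ?ltr0_norm ?opprK//; lra.
Qed.

Lemma sup_norm_fin (f : C -> C) : CT f -> exists F : R, sup_norm f = F%:E.
Proof.
move=> cf; have [B fB] := ccont_bounded (ccont_CT cf).
have ub : (sup_norm f <= B%:E)%E.
  apply: ge_ereal_sup => _ [z /unit_circle_expi[t ht ->] <-].
  by rewrite lee_fin fB.
have lb : (0 <= sup_norm f)%E.
  apply: le_trans (_ : (cmod (f (expi 0)))%:E <= _)%E; first by rewrite lee_fin cmod_ge0.
  by apply: ereal_sup_ubound; exists (expi 0) => //; exact: cmod_expi.
by case: (sup_norm f) lb ub => [F _ _| |//]; [exists F|rewrite leye_eq].
Qed.

Lemma H1_norm_fin (h : C -> C) : H1 h -> exists2 G : R, 0 <= G & H1_norm h = G%:E.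
Proof.
move=> [hh]; have lb : (0 <= H1_norm h)%E.
  apply: le_trans (ereal_sup_ubound _); last by exists 0 => //=; rewrite lexx ltr01.
  apply: mule_ge0; first by rewrite lee_fin invr_ge0 mulr_ge0 ?pi_ge0.
  by apply: integral_ge0 => t _; rewrite lee_fin cmod_ge0.
by case: (H1_norm h) lb => [G G0 _| |//]; [exists G|rewrite ltxx].
Qed.

(** The infimum need not be attained, so a representation of cost below [2] is taken; its norms are
    finite and become real numbers. *)
Lemma A_norm_repr (p : {poly C}) : (A_norm (fun z : R[i]^o => p.[z]) <= 1)%E ->
  exists f h (F G : nat -> R),
  [/\ (forall k, [/\ CT (f k), holomorphic_disc (h k), sup_norm (f k) = (F k)%:E &
         H1_norm (h k) = (G k)%:E]),
      (forall k, 0 <= G k),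
      (forall n, \sum_(k < n) F k * G k <= 2) &
      forall z, cmod z <= 1 -> forall e : R, 0 < e -> exists N, forall n, (N <= n)%N ->
        cmod (p.[z] - \sum_(k < n) star (f k) (h k) z) <= e].
Proof.
move=> p1; have : (A_norm (fun z : R[i]^o => p.[z]) < 2%:E)%E.
  by apply: le_lt_trans p1 _; rewrite lte_fin ltr1n.
move=> /ereal_inf_lt[_ [f [h [[cf H1h _ cv] ->]]] cost2].
have /choice[F FE] := fun k => sup_norm_fin (cf k).
have /choice[G GE] (k : nat) : exists g : R, 0 <= g /\ H1_norm (h k) = g%:E.
  by have [g g0 gE] := H1_norm_fin (H1h k); exists g.
exists f, h, F, G; split => [k|k|n|z z1 e e0].
- by split => //; [exact: (H1h k).1|exact: (GE k).2].
- exact: (GE k).1.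
- rewrite -lee_fin; apply: le_trans (ltW cost2).
  have FG0 k : (0 <= sup_norm (f k) * H1_norm (h k))%E.
    rewrite FE (GE k).2 -EFinM lee_fin mulr_ge0 ?(GE k).1//.
    exact: sup_norm_real_ge0 (FE k).
  apply: le_trans (nneseries_lim_ge (P := xpredT) n _); last by move=> k _ _; exact: FG0.
  rewrite big_mkord -sumEFin; apply: lee_sum => k _.
  by rewrite EFinM FE (GE k).2.
- have e0' : (0 : C) < e%:C by rewrite ltcR.
  have /cvgrPdist_lt/(_ _ e0')[N _ NP] := cv z z1.
  exists N => n Nn; have : `|p.[z] - series (fun k => star (f k) (h k) z) n : C| < e%:C.
    exact: NP.
  by rewrite /series /= big_mkord normcmodE ltcR => /ltW.
Qed.

Lemma bounded_series_tail (a : nat -> R) (B e : R) : (forall k, 0 <= a k) ->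
  (forall n, \sum_(k < n) a k <= B) -> 0 < e ->
  exists K, forall n, (K <= n)%N -> \sum_(k < n) a k - \sum_(k < K) a k <= e.
Proof.
move=> a0 aB e0; pose s n := \sum_(k < n) a k.
have sh : has_sup (range s).
  by split; [exists (s 0), 0|exists B => _ [n _ <-]; exact: aB].
have [_ [K _ <-] hK] := sup_adherent e0 sh.
exists K => n _; have : s n <= sup (range s) by apply: sup_upper_bound => //; exists n.
by rewrite -/(s n) -/(s K); lra.
Qed.

Section Factorization.
Variables (f h : C -> C) (F G r : R).
Hypotheses (cf : CT f) (hh : holomorphic_disc h).
Hypotheses (fF : sup_norm f = F%:E) (hE : H1_norm h = G%:E).
Hypotheses (r0 : 0 < r) (r1 : r < 1).

(** Replacing [h] by a polynomial and this polynomial by a product costs [F * e] each time. In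
    [G + 2 * e], one [e] comes from each of the two replacements. *)
Lemma star_factorization (e : R) : 0 < e -> exists UV : {poly C} * {poly C},
  [/\ rmean (fun s => cmod UV.1.[expi s] ^+ 2) <= expR 1 * (G + 2 * e),
      rmean (fun s => cmod UV.2.[expi s] ^+ 2) <= expR 1 * (G + 2 * e) &
      forall a, 0 <= a <= 2 * pi ->
        cmod (star f h (r%:C * expi a) -
              (convp (fun s => f (expi s)) (UV.1 * UV.2)).[expi a]) <= 2 * F * e].
Proof.
move=> e0; have [H HG HS] := star_poly_approx cf hh fF hE r0 r1 e0.
have [U [V UVP]] := approx_factorization H e0 e0; exists (U, V) => /=.
have cH := continuous_cmod (ccont_poly_expi H).
have csq p : continuous (fun s : R => cmod (p.[expi s] : C) ^+ 2).
  have := continuous_cmod (ccont_poly_expi p) => cp t.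
  by apply: (cvgM (cp t) (cp t)).
have cHe : continuous (fun s : R => cmod H.[expi s] + e).
  by move=> t; apply: cvgD; [exact: cH|exact: cvg_cst].
have bound W : (forall s, 0 <= s <= 2 * pi ->
    cmod W.[expi s] ^+ 2 <= expR 1 * (cmod H.[expi s] + e)) ->
    rmean (fun s => cmod W.[expi s] ^+ 2) <= expR 1 * (G + 2 * e).
  move=> hW; apply: le_trans (_ : rmean (fun s => expR 1 * (cmod H.[expi s] + e)) <= _).
    by apply: ler_rmean => // t; apply: cvgM; [exact: cvg_cst|exact: cHe].
  rewrite rmeanZ// ler_wpM2l ?expR_ge0// rmeanD// ?rmean_cst; last by move=> t; exact: cvg_cst.
  by move: HG; lra.
split.
- by apply: bound => s /UVP[].
- apply: bound => s /UVP[_ h1 _]; apply: le_trans h1 _.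
  by rewrite ler_wpM2l ?expR_ge0// lerDl ltW.
- move=> a ha; have := HS a ha.
  have cg : ccont (fun s => f (expi s)) := ccont_CT cf.
  have cw p : ccont (fun s : R => p.[expi a * (expi s)^*] : C).
    by apply: ccont_horner; apply: ccontM; [exact: ccont_cst|apply: ccontJ; exact: ccont_expi].
  suff : cmod ((convp (fun s => f (expi s)) H).[expi a] -
      (convp (fun s => f (expi s)) (U * V)).[expi a]) <= F * e.
    move=> h1 h2; apply: le_trans (ler_cmod_dist _ _ _) _; last first.
      have -> : 2 * F * e = F * e + F * e by ring.
      exact: lerD h2 h1.
  rewrite -!mean_convp// -meanB; [|exact: ccontM|exact: ccontM].
  apply: ler_cmod_mean_cst; first by apply: ccontB; exact: ccontM.
  move=> s hs; rewrite -mulrBr cmodM ler_pM ?cmod_ge0 ?(cmod_le_sup_norm fF)//.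
  have [u hu uE] := circle_angle_sub ha hs.
  by rewrite -expiN -expiD -uE cmodB; have [] := UVP _ hu.
Qed.

End Factorization.

Lemma coef_le_circle (p : {poly C}) (e : R) m :
  (forall a, 0 <= a <= 2 * pi -> cmod p.[expi a] <= e) -> cmod p`_m <= e.
Proof.
move=> pe; rewrite -mean_coef; apply: ler_cmod_mean_cst.
  by apply: ccontM; [exact: ccont_poly_expi|exact: ccont_expiJX].
by move=> t ht; rewrite cmodM cmodX cmodJ cmod_expi expr1n mulr1 pe.
Qed.

Lemma geometric_le (r : R) n : 0 <= r -> (1 - r) * \sum_(m < n) r ^+ m <= 1.
Proof.
move=> r0; have -> : (1 - r) * \sum_(m < n) r ^+ m = 1 - r ^+ n.
  by rewrite -[1 - r ^+ n]opprB subrX1 -mulNr opprB.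
by rewrite gerBl exprn_ge0.
Qed.

Lemma sum_coef_widen (p : {poly C}) (w : nat -> R) n : (size p <= n)%N ->
  \sum_(m < n) cmod p`_m * w m = \sum_(m < size p) cmod p`_m * w m.
Proof.
move=> pn; rewrite (big_ord_widen n (fun m => cmod p`_m * w m) pn) [RHS]big_mkcond /=.
by apply: eq_bigr => m _; case: ltnP => // pm; rewrite nth_default// cmod0 mul0r.
Qed.

Lemma sum_ordB (V : zmodType) (u : nat -> V) K n : (K <= n)%N ->
  \sum_(k < n) u k - \sum_(k < K) u k = \sum_(K <= k < n) u k.
Proof.
move=> Kn; rewrite -!(big_mkord xpredT u) (big_cat_nat (n := K))//=.
by rewrite addrAC subrr add0r.
Qed.

(* The summand [a] comes from finitely many terms of a representation of [p],
   evaluated on the circle of radius [r] and dilated once more by [r]; the dilation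
   makes the coefficientwise errors summable, so that [b] has small coefficients. *)
Lemma disc_algebra_factored (p : {poly C}) : (A_norm (fun z : R[i]^o => p.[z]) <= 1)%E ->
  exists a b : factored R, [/\ fbounded (1 + 3 * expR 1) a,
    fbounded (1 + 3 * expR 1) b & p = fpoly a + fpoly b].
Proof.
move=> /A_norm_repr[f [h [F [G [data G0 FG cv]]]]].
have F0 k : 0 <= F k by have [_ _ fF _] := data k; exact: sup_norm_real_ge0 fF.
have c1 : 1 <= 1 + 3 * expR 1 :> R by rewrite lerDl mulr_ge0 ?expR_ge0.
have cE : 3 * expR 1 <= (1 + 3 * expR 1) ^+ 2 :> R.
  rewrite expr2; apply: le_trans (_ : 1 + 3 * expR 1 <= _); first by rewrite lerDr.
  by rewrite ler_peMr// (le_trans ler01).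
pose A := \sum_(m < size p) cmod p`_m * m%:R.
have A0 : 0 <= A by rewrite sumr_ge0// => m _; rewrite mulr_ge0 ?cmod_ge0.
(* Two dilations by [r] change the coefficients of [p] by at most [2 * d * A] in total, which this
   choice keeps below [1 / 2]. *)
pose d : R := (2 + 4 * A)^-1; pose r := 1 - d.
have d0 : 0 < d by rewrite invr_gt0; lra.
have d2 : d <= 2^-1 by rewrite lef_pV2 ?posrE//; lra.
have dA : 2 * d * A <= 2^-1.
  rewrite /d [2 * _]mulrC -mulrA ler_pdivrMl; last by lra.
  by lra.
have r0 : 0 < r by rewrite /r; lra.
have r1 : r < 1 by rewrite /r; lra.
(* As [d = 1 - r], the geometric series weighted by [eta] sums to at most [1 / 2]. *)
pose eta := d / 2; have eta0 : 0 < eta by rewrite divr_gt0.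
have [K KP] := @bounded_series_tail (fun k => F k * G k) 2 (eta / 2)
  (fun k => mulr_ge0 (F0 k) (G0 k)) FG (divr_gt0 eta0 (ltr0n _ 2)).
(* With [de <= 1], the quantity [de * D] bounds both the total factorization error and the excess of
   the sum of [(F k + de) * (G k + 2 * de)] over that of [F k * G k]. Adding [de] also makes the
   bounds on the symbols positive. *)
pose D := \sum_(k < K) (2 * F k + G k + 2).
have D0 : 0 <= D by rewrite sumr_ge0// => k _; rewrite !addr_ge0 ?mulr_ge0.
pose de := eta / 2 / (1 + D).
have de0 : 0 < de by rewrite !divr_gt0//; lra.
have deD : de * (1 + D) = eta / 2 by rewrite divfK// gt_eqF//; lra.
have de1 : de <= 1.
  have : de <= de * (1 + D) by rewrite ler_peMr ?lerDl// ltW.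
  by move: deD d2; rewrite /eta; lra.
have /choice[UV UVP] (k : nat) : exists UV : {poly C} * {poly C},
  [/\ rmean (fun s => cmod UV.1.[expi s] ^+ 2) <= expR 1 * (G k + 2 * de),
      rmean (fun s => cmod UV.2.[expi s] ^+ 2) <= expR 1 * (G k + 2 * de) &
      forall a, 0 <= a <= 2 * pi ->
        cmod (star (f k) (h k) (r%:C * expi a) -
          (convp (fun s => f k (expi s)) (UV.1 * UV.2)).[expi a]) <= 2 * F k * de].
  by have [cf hh fF hE] := data k; exact: star_factorization.
have sums (w : nat -> R) : (forall k, w k <= expR 1 * (G k + 2 * de)) ->
    \sum_(k < K) (F k + de) * w k <= (1 + 3 * expR 1) ^+ 2.
  move=> hw; apply: le_trans cE.
  apply: le_trans (_ : \sum_(k < K) expR 1 * (F k * G k + de * (2 * F k + G k + 2)) <= _).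
    apply: ler_sum => k _.
    apply: le_trans (_ : (F k + de) * (expR 1 * (G k + 2 * de)) <= _).
      by rewrite ler_wpM2l// addr_ge0// ltW.
    rewrite mulrCA ler_wpM2l ?expR_ge0//.
    have : de * de <= de by rewrite ler_piMr// ltW.
    by move: (F k) (G k) => x y; lra.
  rewrite -mulr_sumr [3 * _]mulrC ler_wpM2l ?expR_ge0// big_split /= -mulr_sumr.
  have := FG K; move: deD d2; rewrite /eta -/D mulrDr mulr1; lra.
have [||k|k|k t ht|||a ab aE] := @factored_of_symbols R K (fun k s => f k (expi s))
    (fun k => F k + de) (fun k => (UV k).1) (fun k => (UV k).2) r (1 + 3 * expR 1).
- exact: ltW.
- exact: ltW.
- by have [cf _ _ _] := data k; exact: ccont_CT.
- by rewrite ltr_wpDl.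
- have [_ _ fF _] := data k; apply: le_trans (cmod_le_sup_norm fF t) _.
  by rewrite lerDl ltW.
- by apply: (sums (fun k => rmean (fun s => cmod (UV k).1.[expi s] ^+ 2))) => k; case: (UVP k).
- by apply: (sums (fun k => rmean (fun s => cmod (UV k).2.[expi s] ^+ 2))) => k; case: (UVP k).
pose P1 := \sum_(k < K) convp (fun s => f k (expi s)) ((UV k).1 * (UV k).2).
pose pr : {poly C} := \poly_(m < size p) (p`_m * r%:C ^+ m).
have near_circle t : 0 <= t <= 2 * pi -> cmod (pr - P1).[expi t] <= eta.
  move=> ht; rewrite hornerD hornerN.
  have -> : pr.[expi t] = p.[r%:C * expi t].
    by rewrite horner_poly horner_coef; apply: eq_bigr => m _; rewrite exprMn mulrA.
  have z1 : cmod (r%:C * expi t) <= 1.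
    by rewrite cmodM cmod_expi mulr1 cmod_real gtr0_norm// ltW.
  have h1 : cmod (p.[r%:C * expi t] - \sum_(k < K) star (f k) (h k) (r%:C * expi t)) <= eta / 2.
    apply/ler_addgt0Pr => e e0; have [N NP] := cv _ z1 _ e0.
    pose n := maxn N K.
    have hK := KP n (leq_maxr _ _).
    apply: le_trans (ler_cmod_dist (\sum_(k < n) star (f k) (h k) (r%:C * expi t)) _ _) _.
    rewrite addrC; apply: lerD; last by apply: NP; exact: leq_maxl.
    apply: le_trans hK.
    rewrite (sum_ordB (fun k => star (f k) (h k) (r%:C * expi t)) (leq_maxr N K)).
    rewrite (sum_ordB (fun k => F k * G k) (leq_maxr N K)).
    apply: le_trans (ler_cmod_sum _ _ _) _; apply: ler_sum => k _.
    by have [cf hh fF hE] := data k; exact: ler_cmod_star.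
  have h2 : cmod (\sum_(k < K) star (f k) (h k) (r%:C * expi t) - P1.[expi t]) <= eta / 2.
    rewrite /P1 horner_sum -sumrB; apply: le_trans (ler_cmod_sum _ _ _) _.
    apply: le_trans (_ : \sum_(k < K) de * (2 * F k + G k + 2) <= _).
      apply: ler_sum => k _; have [_ _ /(_ t ht) h2] := UVP k; apply: le_trans h2 _.
      by rewrite mulrC ler_wpM2l ?(ltW de0)//; have := G0 k; lra.
    by rewrite -mulr_sumr -/D; move: deD; rewrite mulrDr mulr1; lra.
  rewrite [eta]splitr.
  apply: le_trans (ler_cmod_dist (\sum_(k < K) star (f k) (h k) (r%:C * expi t)) _ _) _.
  exact: lerD.
have coefP m : cmod (pr - P1)`_m <= eta by exact: coef_le_circle.
have aP1 m : (fpoly a)`_m = r%:C ^+ m * P1`_m.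
  by rewrite aE /P1 coef_sum; congr (_ * _); apply: eq_bigr => k _; rewrite coef_convp.
pose n := maxn (size p) (size (fpoly a)).
have en : (size (p - fpoly a)%R <= n)%N.
  by apply: leq_trans (size_polyD _ _) _; rewrite size_polyN.
have small : \sum_(m < n) cmod (p - fpoly a)`_m <= (1 + 3 * expR 1) ^+ 2.
  apply: le_trans (_ : 1 <= _); last by rewrite expr_ge1 ?(le_trans ler01).
  apply: le_trans (_ : 2 * d * \sum_(m < n) cmod p`_m * m%:R + eta * \sum_(m < n) r ^+ m <= _).
    rewrite !mulr_sumr -big_split /=; apply: ler_sum => m _.
    (* The exponent is doubled because [P1] approximates [p] dilated by [r], and [fpoly a] is [P1]
       dilated once more. *)
    have -> : (p - fpoly a)`_m = p`_m * (1 ^+ m.*2 - r%:C ^+ m.*2) + r%:C ^+ m * (pr - P1)`_m.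
      rewrite !coefB aP1 coef_poly expr1n -addnn exprD.
      case: ltnP => pm; first by ring.
      by rewrite nth_default//; ring.
    apply: le_trans (ler_cmodD _ _) _; apply: lerD.
      rewrite cmodM; have := @ler_cmod_expB R 1 r%:C m.*2; rewrite cmod1 cmod_real.
      rewrite gtr0_norm// => /(_ (lexx _) (ltW r1)) hB.
      apply: le_trans (ler_wpM2l (cmod_ge0 _) hB) _.
      rewrite -rmorphB /= cmod_real /r opprB addrCA subrr addr0 gtr0_norm// -muln2 natrM.
      by rewrite le_eqVlt; apply/orP; left; apply/eqP; ring.
    by rewrite cmodM cmodX cmod_real gtr0_norm// mulrC ler_wpM2r ?exprn_ge0// ltW.
  rewrite (sum_coef_widen (fun m => m%:R)) ?leq_maxl// -/A.
  have := geometric_le n (ltW r0); rewrite /r opprB addrCA subrr addr0 -/r.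
  by rewrite /eta; move: dA; lra.
have [b bb bE] := factored_of_coef en small.
by exists a, b; split => //; rewrite bE addrC subrK.
Qed.

End DiscAlgebraFactorization.

(** * Gamma-boundedness from the two factored summands *)

Unset Implicit Arguments.

Theorem theorem4p20 (R : realType) (d : measure_display)
    (Sigma : measurableType d) (P : probability Sigma R)
    (gamma : nat -> Sigma -> R[i]) (hgamma : iid_complex_gaussian P gamma)
    (X : completeNormedModType R[i]) (T : {linear X -> X})
    (hT : continuous T) (hpow : power_gamma_bounded P gamma T) :
  gamma_bounded P gamma
    [set S : X -> X | exists2 p : {poly R[i]},
       (A_norm (fun z : R[i]^o => p.[z]) <= 1)%E & S = poly_op p T].
Proof.
move: hpow => /gamma_boundedP[c c0 powers].
have powers0 := sq_bounded_powers0 hgamma c0 powers.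
have c0' : 0 <= 2 * c + 2 by rewrite addr_ge0 ?mulr_ge0.
have K0 : 0 < 1 + 3 * expR 1 :> R by rewrite ltr_pwDl// mulr_ge0 ?expR_ge0.
have := sq_bounded_factored hgamma c0' K0 powers0.
set B := (X in sq_bounded _ _ _ X) => factoredB.
have B0 : 0 <= B by rewrite !mulr_ge0 ?sqr_ge0.
(* Each of the two summands has the bound [B], and the square of a sum costs a factor [2] on
   each. *)
apply/gamma_boundedP; exists (4 * B); first by rewrite mulr_ge0.
move=> N S x hS.
have /choice[ab abP] (n : 'I_N) : exists ab : factored R * factored R,
    [/\ fbounded (1 + 3 * expR 1) ab.1, fbounded (1 + 3 * expR 1) ab.2 &
        S n = poly_op (fpoly ab.1 + fpoly ab.2) T].
  have [p p1 ->] := hS n; have [a [b [ha hb ->]]] := disc_algebra_factored p1.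
  by exists (a, b).
have -> : (fun n => S n (x n)) = (fun n =>
    poly_op (fpoly (ab n).1) T (x n) + poly_op (fpoly (ab n).2) T (x n)).
  by apply/funext => n; have [_ _ ->] := abP n; rewrite poly_opD.
apply: le_trans (gintD hgamma _ _) _.
have -> : ((4 * B)%:E = 2%:E * B%:E + 2%:E * B%:E)%E.
  by rewrite -!EFinM -EFinD; congr EFin; ring.
rewrite ge0_muleDl ?lee_fin ?mulr_ge0// -!muleA.
have part (a : 'I_N -> factored R) : (forall n, fbounded (1 + 3 * expR 1) (a n)) ->
    (2%:E * gint P gamma (fun n => poly_op (fpoly (a n)) T (x n)) <=
     2%:E * (B%:E * gint P gamma x))%E.
  move=> ha; apply: lee_wpmul2l => //.
  by apply: (factoredB _ (fun n => poly_op (fpoly (a n)) T)) => n; exists (a n).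
by apply: leeD; apply: part => n; case: (abP n).
Qed.
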